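(* Let $p>1$, and let $u\ge0$ satisfy $$u_t+(-\Delta)^su\ge\frac{u^p}{|x|^{2s}}\quad\text{in }\Omega\times(0,T)$$ in the weak sense. Then $u\equiv0$.
   Context: Throughout, $0<s<1$, $N>2s$, $\Omega\subset\mathbb{R}^N$ is a bounded $C^{1,1}$ domain with $0\in\Omega$, and $0<T<\infty$. The fractional Laplacian is $(-\Delta)^su(x)=a_{N,s}\,\mathrm{P.V.}\int_{\mathbb{R}^N}\frac{u(x)-u(y)}{|x-y|^{N+2s}}dy$ with $a_{N,s}=2^{2s}\pi^{-N/2}\frac{\Gamma(\frac{N+2s}{2})}{|\Gamma(-s)|}$. Test class: $\mathcal{T}$ is the set of $\phi:\mathbb{R}^N\times[0,T]\to\mathbb{R}$ such that $-\phi_t+(-\Delta)^s\phi=\varphi$ in $\Omega\times(0,T)$ for some bounded $\varphi$ on $\Omega\times(0,T)$ that is Hölder continuous in space and time ($\varphi\in L^\infty\cap\mathcal{C}^{\alpha',\beta'}(\Omega\times(0,T))$ for some exponents), with $\phi=0$ in $(\mathbb{R}^N\setminus\Omega)\times(0,T]$ and $\phi(x,T)=0$ in $\Omega$; such $\phi$ is the bounded finite-energy solution, and it satisfies the equation pointwise (strong solution). A nonnegative function $u$ on $\mathbb{R}^N\times[0,T)$ satisfies $u_t+(-\Delta)^su\ge F$ in $\Omega\times(0,T)$ in the weak sense if $u\in\mathcal{C}([0,T);L^1(\Omega))$, $F\in L^1(\Omega\times[0,T))$ and, for all nonnegative $\phi\in\mathcal{T}$, $$\int_0^T\!\!\int_\Omega-\phi_tu\,dx\,dt+\int_0^T\!\!\int_{\mathbb{R}^N}u(-\Delta)^s\phi\,dx\,dt\ge\int_0^T\!\!\int_\Omega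 F\phi\,dx\,dt+\int_\Omega u(x,0)\phi(x,0)\,dx .$$ Here $F=\frac{u^p}{|x|^{2s}}$. *)

(* Defs.v *)
From HB Require Import structures.
From mathcomp Require Import all_boot all_order all_algebra.
From mathcomp Require Import all_classical all_reals all_analysis.
Set Implicit Arguments.
Unset Strict Implicit.
Unset Printing Implicit Defensive.
Import Order.TTheory GRing.Theory Num.Theory.
Import numFieldNormedType.Exports.
Local Open Scope classical_set_scope.
Local Open Scope ring_scope.

Definition measure_rV_display : measure_display -> measure_display.
Proof. exact. Qed.

Definition rV_coord (R : realType) n (i : 'I_n) (x : 'rV[R]_n) :
  measurableTypeR R := x ord0 i.

(* Product sigma-algebra on R^n, i.e. the Borel sigma-algebra. *)
Section measurable_rV.
Context {R : realType}.
Variable n : nat.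

Let rV_set0 : g_sigma_preimage (@rV_coord R n) set0.
Proof. exact: sigma_algebra0. Qed.

Let rV_setC A : g_sigma_preimage (@rV_coord R n) A ->
  g_sigma_preimage (@rV_coord R n) (~` A).
Proof. exact: sigma_algebraC. Qed.

Let rV_bigcup (F : _^nat) :
  (forall i, g_sigma_preimage (@rV_coord R n) (F i)) ->
  g_sigma_preimage (@rV_coord R n) (\bigcup_i (F i)).
Proof. exact: sigma_algebra_bigcup. Qed.

HB.instance Definition _ := @isMeasurable.Build
  (measure_rV_display default_measure_display) 'rV[R]_n
  (g_sigma_preimage (@rV_coord R n)) rV_set0 rV_setC rV_bigcup.

End measurable_rV.

Lemma measurable_rV_coord (R : realType) n (i : 'I_n) :
  measurable_fun [set: 'rV[R]_n] (@rV_coord R n i).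
Proof.
move=> _ Y mY; rewrite setTI; apply: sub_sigma_algebra => /=.
rewrite -bigcup_seq/=; exists i => /=; first by rewrite mem_index_enum.
by exists Y => //; rewrite setTI.
Qed.

Lemma measurable_fun_rV d (T : measurableType d) (R : realType) n
    (f : T -> 'rV[R]_n) :
  (forall i, measurable_fun setT (@rV_coord R n i \o f)) ->
  measurable_fun setT f.
Proof.
move=> mf.
suff H : g_sigma_preimage (fun i => @rV_coord R n i \o f) `<=` measurable.
  move=> _ A mA; apply: H; rewrite g_sigma_preimage_comp.
  by exists A.
apply: smallest_sub; first exact: sigma_algebra_measurable.
case: n f mf => [|n] f mf; first by rewrite big_ord0.
rewrite -bigcup_mkord_ord; apply: bigcup_sub => i Ii.
by move=> A [B mB <-]; exact: mf.
Qed.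

Section lebesgue_rV.
Context {R : realType}.

Definition rV_cons n (z : measurableTypeR R * 'rV[R]_n) : 'rV[R]_n.+1 :=
  row_mx (const_mx z.1 : 'rV[R]_1) z.2.

Lemma rV_consE0 n z : @rV_cons n z ord0 ord0 = z.1.
Proof.
have := row_mxEl (const_mx z.1 : 'rV[R]_1) z.2 ord0 (ord0 : 'I_1).
by rewrite [RHS]mxE => <-; congr (_ _ _); exact/val_inj.
Qed.

Lemma rV_consE n z j : @rV_cons n z ord0 (lift ord0 j) = z.2 ord0 j.
Proof.
have <- := row_mxEr (const_mx z.1 : 'rV[R]_1) z.2 ord0 j.
by congr (_ _ _); exact/val_inj.
Qed.

Lemma measurable_rV_cons n : measurable_fun setT (@rV_cons n).
Proof.
apply: measurable_fun_rV => i; case: (unliftP ord0 i) => [j ->|->].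
  rewrite (_ : _ \o _ = rV_coord j \o snd).
    by apply: measurableT_comp; [exact: measurable_rV_coord|].
  by apply/funext => z; exact: rV_consE.
rewrite (_ : _ \o _ = fst); first exact: measurable_fst.
by apply/funext => z; exact: rV_consE0.
Qed.

Definition rV_uncons n (x : 'rV[R]_n.+1) : measurableTypeR R * 'rV[R]_n :=
  (rV_coord ord0 x, rsubmx (x : 'rV[R]_(1 + n))).

Lemma rV_consK n : cancel (@rV_cons n) (@rV_uncons n).
Proof.
move=> [a x]; rewrite /rV_uncons /rV_coord rV_consE0; congr pair.
exact: row_mxKr.
Qed.

Lemma measurable_rV_uncons n : measurable_fun setT (@rV_uncons n).
Proof.
apply: measurable_fun_pair; first exact: measurable_rV_coord.
apply: measurable_fun_rV => i.
rewrite (_ : _ \o _ = @rV_coord R n.+1 (rshift 1 i)).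
  exact: measurable_rV_coord.
by apply/funext => x; rewrite /rV_coord /= mxE.
Qed.

Section step.
Variables (n : nat) (mu : {sigma_finite_measure set 'rV[R]_n -> \bar R}).

Definition lebesgue_rV_step : set 'rV[R]_n.+1 -> \bar R :=
  pushforward (lebesgue_measure \x mu)%E (@rV_cons n).

Let step_preimage (A : set 'rV[R]_n.+1) : measurable A ->
  measurable (@rV_cons n @^-1` A).
Proof.
by move=> mA; rewrite -[X in measurable X]setTI; exact: measurable_rV_cons.
Qed.

Let step0 : lebesgue_rV_step set0 = 0%E.
Proof. by rewrite /lebesgue_rV_step /pushforward preimage_set0 measure0. Qed.

Let step_ge0 A : (0 <= lebesgue_rV_step A)%E.
Proof. by rewrite /lebesgue_rV_step /pushforward; exact: measure_ge0. Qed.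

Let step_sigma_additive : semi_sigma_additive lebesgue_rV_step.
Proof.
move=> F mF tF mUF; rewrite /lebesgue_rV_step /pushforward preimage_bigcup.
apply: measure_semi_sigma_additive.
- by move=> i; exact: step_preimage.
- apply/trivIsetP => /= i j _ _ ij; rewrite -preimage_setI.
  by move/trivIsetP : tF => /(_ _ _ _ _ ij) ->//; rewrite preimage_set0.
- by rewrite -preimage_bigcup; exact: step_preimage.
Qed.

HB.instance Definition _ := isMeasure.Build _ _ _ lebesgue_rV_step
  step0 step_ge0 step_sigma_additive.

Let step_sigma_finite : sigma_finite setT lebesgue_rV_step.
Proof.
have /sigma_finiteP[F [FT Fnd Foo]] :=
  sigma_finiteT (@lebesgue_measure R : {sigma_finite_measure set _ -> \bar R}).
have /sigma_finiteP[G [GT Gnd Goo]] := sigma_finiteT mu.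
exists (fun k => @rV_uncons n @^-1` (F k `*` G k)).
  rewrite -preimage_bigcup (_ : \bigcup_k _ = setT) ?preimage_setT//.
  rewrite -subTset => -[x y] _.
  have [i _ Fix] : (\bigcup_k F k) x by rewrite -FT.
  have [j _ Gjy] : (\bigcup_k G k) y by rewrite -GT.
  exists (maxn i j) => //; split => /=.
    by move: x Fix; exact/subsetPset/Fnd/leq_maxl.
  by move: y Gjy; exact/subsetPset/Gnd/leq_maxr.
move=> k; have [mF Fk] := Foo k; have [mG Gk] := Goo k; split.
  rewrite -[X in measurable X]setTI; apply: measurable_rV_uncons => //.
  exact: measurableX.
rewrite /lebesgue_rV_step /pushforward -comp_preimage.
rewrite (_ : @rV_uncons n \o @rV_cons n = id); last first.
  by apply/funext => z; exact: rV_consK.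
by rewrite preimage_id product_measure1E// lte_mul_pinfty// ge0_fin_numE.
Qed.

HB.instance Definition _ := Measure_isSigmaFinite.Build _ _ _ lebesgue_rV_step
  step_sigma_finite.

End step.

(* Lebesgue measure on R^n (see lebesgue_rV_box), by iterated products. *)
Fixpoint lebesgue_rV n : {sigma_finite_measure set 'rV[R]_n -> \bar R} :=
  match n with
  | 0 => \d_(0 : 'rV[R]_0)
  | n'.+1 => lebesgue_rV_step (lebesgue_rV n')
  end.

End lebesgue_rV.

Lemma lebesgue_rV_box (R : realType) n (a b : 'I_n -> R) :
  (forall i, a i <= b i) ->
  lebesgue_rV n [set x : 'rV[R]_n | forall i, x ord0 i \in `[a i, b i]] =
  (\prod_(i < n) (b i - a i))%:E.
Proof.
elim: n a b => [|n IH] a b ab.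
  rewrite big_ord0 /= diracE mem_set//= => -[]//.
rewrite /= /lebesgue_rV_step /pushforward.
rewrite (_ : _ @^-1` _ = `[a ord0, b ord0]%classic `*`
  [set x : 'rV[R]_n | forall i,
     x ord0 i \in `[a (lift ord0 i), b (lift ord0 i)]]).
  rewrite product_measure1E//.
  - rewrite IH// big_ord_recl EFinM; congr (_ * _)%E.
    rewrite /= lebesgue_measure_itv/= lte_fin; case: ltP => [//|ba].
    by rewrite (_ : b ord0 = a ord0) ?subrr//; apply/eqP; rewrite eq_le ba ab.
  - rewrite (_ : mkset _ = \bigcap_(i in [set: 'I_n])
        (@rV_coord R n i @^-1`
           `[a (lift ord0 i), b (lift ord0 i)]%classic)).
      apply: fin_bigcap_measurable => // i _.
      by rewrite -[X in measurable X]setTI; exact: measurable_rV_coord.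
    by apply/seteqP; split => x /= H i; [move=> _|]; exact: H.
apply/seteqP; split => [[x y]/= H|[x y]/= [H1 H2] i].
  split=> [|j]; first by have := H ord0; rewrite rV_consE0.
  by have := H (lift ord0 j); rewrite rV_consE.
by case: (unliftP ord0 i) => [j ->|->]; rewrite ?rV_consE0// rV_consE.
Qed.

Notation lebesgue_xt R N := (@lebesgue_rV R N \x @lebesgue_measure R)%E.

Section euclidean.
Context {R : realType} {N : nat}.
Implicit Types x y : 'rV[R]_N.

Definition dot x y : R := \sum_i x ord0 i * y ord0 i.

(* The library norm on 'rV[R]_N is the sup norm. *)
Definition enorm x : R := Num.sqrt (dot x x).

(* C^{1,1}: differentiable with Lipschitz differential. *)
Definition C11_fun (g : 'rV[R]_N -> R) : Prop :=
  (forall x, differentiable g x) /\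
  exists L : R, forall x y v,
    `|'d g x v - 'd g y v| <= L * enorm (x - y) * enorm v.

(* Near each boundary point, Omega is the strict subgraph in the direction nu
   of a C^{1,1} function of the variables orthogonal to nu; such a function is
   encoded as a function on R^N that is invariant under translation along nu,
   which covers N = 1 too. *)
Definition C11_boundary (Omega : set 'rV[R]_N) : Prop :=
  forall x0, (closure Omega `\` Omega°) x0 ->
    exists (r : R) (nu : 'rV[R]_N) (g : 'rV[R]_N -> R),
      [/\ 0 < r, enorm nu = 1, C11_fun g,
          (forall y c, g (y + c *: nu) = g y) &
          forall y, enorm (y - x0) < r -> (Omega y <-> dot y nu < g y)].

Definition bounded_C11_domain (Omega : set 'rV[R]_N) : Prop :=
  [/\ open Omega, connected Omega, bounded_set Omega & C11_boundary Omega].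

End euclidean.

(* Euler integral for z > 0, extended to the negative non-integers by the
   functional equation Gamma (z + 1) = z * Gamma z. *)
Definition Gamma (R : realType) (z : R) : R :=
  let n := `|Num.floor (Num.min z 0%R)|%N in
  (\int[lebesgue_measure]_(t in `]0, +oo[) (t `^ (z + n%:R - 1) * expR (- t)))
    / \prod_(k < n) (z + k%:R).

Section fractional_laplacian.
Context {R : realType} {N : nat}.
Variable s : R.
Implicit Types (v w : 'rV[R]_N -> R) (x : 'rV[R]_N).

Definition frac_lap_const : R :=
  2 `^ (2 * s) * pi `^ (- (N%:R / 2)) *
  (Gamma ((N%:R + 2 * s) / 2) / `|Gamma (- s)|).

Definition frac_lap_trunc v x (e : R) : R :=
  \int[@lebesgue_rV R N]_(y in [set y | e < enorm (x - y)])
    ((v x - v y) / enorm (x - y) `^ (N%:R + 2 * s)).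

Definition has_frac_lap v x : Prop :=
  cvg (frac_lap_trunc v x e @[e --> 0^'+]).

(* The principal value; meaningful when has_frac_lap v x. *)
Definition frac_lap v x : R :=
  frac_lap_const * lim (frac_lap_trunc v x e @[e --> 0^'+]).

Definition energy_density v w (z : 'rV[R]_N * 'rV[R]_N) : R :=
  frac_lap_const / 2 * ((v z.1 - v z.2) * (w z.1 - w z.2)) /
  enorm (z.1 - z.2) `^ (N%:R + 2 * s).

(* H^s_0(Omega), realised as the functions of H^s(R^N) that vanish outside
   Omega. *)
Definition Hs0 (Omega : set 'rV[R]_N) v : Prop :=
  [/\ measurable_fun setT v,
      (forall x, ~ Omega x -> v x = 0),
      (\int[@lebesgue_rV R N]_x (v x ^+ 2)%:E < +oo)%E &
      (\int[@lebesgue_rV R N \x @lebesgue_rV R N]_z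
         (energy_density v v z)%:E < +oo)%E].

End fractional_laplacian.

Section parabolic.
Context {R : realType} {N : nat}.
Variables (s : R) (Omega : set 'rV[R]_N) (T : R).
Implicit Types (phi u f F : 'rV[R]_N -> R -> R).

Definition measurable_xt (J : set (measurableTypeR R)) f : Prop :=
  measurable_fun (setT `*` J : set ('rV[R]_N * measurableTypeR R))
    (fun z => f z.1 z.2).

(* w : J -> L^q(Omega) is continuous. *)
Definition continuous_Lq (q : nat) (J : set R) (w : 'rV[R]_N -> R -> R) :
    Prop :=
  forall t0, J t0 ->
    [/\ measurable_fun Omega (w ^~ t0),
        (\int[@lebesgue_rV R N]_(x in Omega) (`|w x t0| ^+ q)%:E < +oo)%E &
        (\int[@lebesgue_rV R N]_(x in Omega) (`|w x t - w x t0| ^+ q)%:E)%E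
          @[t --> within J (nbhs t0)] --> 0%E].

Definition bounded_xt f : Prop :=
  exists M : R, forall x (t : R), Omega x -> 0 < t < T -> `|f x t| <= M.

Definition holder_xt f : Prop :=
  exists (alpha beta C : R), [/\ 0 < alpha < 1, 0 < beta < 1 &
    forall x y (t t' : R), Omega x -> Omega y -> 0 < t < T -> 0 < t' < T ->
      `|f x t - f y t'| <= C * (enorm (x - y) `^ alpha + `|t - t'| `^ beta)].

Definition strong_solution f phi : Prop :=
  forall x (t : R), Omega x -> 0 < t < T ->
    [/\ derivable (phi x) t 1, has_frac_lap s (phi ^~ t) x &
        - derive1 (phi x) t + frac_lap s (phi ^~ t) x = f x t].

(* Backward problem with final datum 0: phi lies in L^2(0,T; H^s_0(Omega)) and
   in C([0,T]; L^2(Omega)), and the equation holds against every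
   v in H^s_0(Omega), integrated in time over (t, T). *)
Definition finite_energy_solution f phi : Prop :=
  [/\ measurable_xt `]0, T[ phi,
      continuous_Lq 2 `[0, T] phi,
      (\int[(@lebesgue_rV R N \x @lebesgue_rV R N) \x @lebesgue_measure R]_(z
          in setT `*` `]0%R, T[)
        (energy_density s (phi ^~ z.2) (phi ^~ z.2) z.1)%:E < +oo)%E &
      forall v (t : R), Hs0 s Omega v -> 0 <= t <= T ->
        \int[@lebesgue_rV R N]_(x in Omega) (phi x t * v x) +
        \int[((@lebesgue_rV R N \x @lebesgue_rV R N)
               \x @lebesgue_measure R)%E]_(z in setT `*` `]t, T[)
          energy_density s (phi ^~ z.2) v z.1 =
        \int[lebesgue_xt R N]_(z in Omega `*` `]t, T[) (f z.1 z.2 * v z.1)].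

Definition test_class phi : Prop :=
  (exists f, [/\ bounded_xt f, holder_xt f, strong_solution f phi &
                 finite_energy_solution f phi]) /\
  [/\ (forall x (t : R), ~ Omega x -> 0 < t <= T -> phi x t = 0),
      (forall x, Omega x -> phi x T = 0) &
      exists M : R, forall x (t : R),
        Omega x -> 0 <= t <= T -> `|phi x t| <= M].

(* u_t + (-Delta)^s u >= F in Omega x (0,T), weakly.  The second integral runs
   over the whole of R^N and is taken in the extended reals: it is -oo when u
   grows too fast, and the inequality then fails. *)
Definition weak_supersolution F u : Prop :=
  [/\ measurable_xt `[0, T[ u,
      continuous_Lq 1 `[0, T[ u,
      (lebesgue_xt R N).-integrable (Omega `*` `[0, T[)
        (fun z => (F z.1 z.2)%:E) &
      forall phi, test_class phi ->
        (forall x (t : R), 0 <= t <= T -> 0 <= phi x t) ->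
        (\int[lebesgue_xt R N]_(z in Omega `*` `]0%R, T[)
            (- derive1 (phi z.1) z.2 * u z.1 z.2)%:E +
         \int[lebesgue_xt R N]_(z in setT `*` `]0%R, T[)
            (u z.1 z.2 * frac_lap s (phi ^~ z.2) z.1)%:E >=
         \int[lebesgue_xt R N]_(z in Omega `*` `]0%R, T[)
            (F z.1 z.2 * phi z.1 z.2)%:E +
         \int[@lebesgue_rV R N]_(x in Omega) (u x 0 * phi x 0)%:E)%E].

End parabolic.

(* Main.v *)
Require Import Defs.
From HB Require Import structures.
From mathcomp Require Import all_boot all_order all_algebra.
From mathcomp Require Import all_classical all_reals all_analysis.
From mathcomp Require Import measurable_realfun ring lra.
Set Implicit Arguments.
Unset Strict Implicit.
Unset Printing Implicit Defensive.
Import Order.TTheory GRing.Theory Num.Theory.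
Import numFieldNormedType.Exports.
Local Open Scope classical_set_scope.
Local Open Scope ring_scope.

(** The idea is that the potential |x|^(-2s) is critical: at the scale d around
    the origin it acts like d^(-2s), the rate at which the fractional Laplacian
    acts at that scale. If u does not vanish, then it turns out to be large
    near the origin, and as soon as u >= k with k large the reaction
    u^p / |x|^(2s) >= k^(p-1) d^(-2s) u beats the diffusion, so that u grows like
    exp (d^(-2s) t) at the scale d. As u is integrable, its averages at the scale
    d are at most of order d^(-N). Letting d tend to 0 gives a contradiction.

    Only test functions eta(t) psi(x) are used, with psi a C^{1,1} function
    vanishing outside Omega and eta(T) = 0; the main ingredient of
    product_test_class, which admits them, is energy_fracL. The test functions
    are translates and dilates of the bump (1 - |x|^2)_+^2. Testing with all of
    its translates at the scale d means that an average v of u, taken over balls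
    of radius d and over time windows of fixed length, satisfies pointwise
    inequalities (concentrated, average_concentrated):

    - v_t + (-Delta)^s v >= m with m > 0 independent of d. Here nonlocality
      enters: at a point where it vanishes, a nonnegative test function has a
      negative fractional Laplacian, of the size of its mass (fracL_far), so that
      the mass of u away from the origin is a source near the origin.
    - v_t + (-Delta)^s v >= (|x| + d)^(-2s) (p k^(p-1) v - (p-1) k^p) for every
      k > 0: the last factor is the tangent at k of the convex function v^p.
    - (-Delta)^s v <= A d^(-2s) v at the origin, by the pointwise inequality
      fracL_bump_le for the bump, and v <= B d^(-N) there.

    These inequalities are contradictory for small d (blow_up). By comparison
    with a bump, the source makes v bounded below near the origin uniformly in d
    (uniform_lower_bound). The second inequality then provides a source of size
    (|x| + d)^(-2s); it supports a barrier made of one bump for each dyadic scale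
    between d and 1, and there are about log (1/d) of them
    (logarithmic_lower_bound). So v exceeds any given k at the origin, and the
    exponential growth sets in. The comparison itself is elementary
    (parabolic_comparison): at a negative minimum of the difference both the time
    derivative and the fractional Laplacian have a sign.

    Hence u has no mass in Omega away from the origin (outer_eq0), and u = 0
    almost everywhere in Omega x (0,T). Continuity in time with values in L^1
    gives every time slice. Off Omega the fractional Laplacian of a nonnegative
    test function is negative, so the weak inequality, now reduced to the
    integral over the complement of Omega, makes u vanish there too. *)

(** * The Euclidean norm *)

Section enorm_theory.
Context {R : realType} {N : nat}.
Implicit Types x y z : 'rV[R]_N.

Lemma dotC x y : dot x y = dot y x.
Proof. by apply: eq_bigr => i _; rewrite mulrC. Qed.

Lemma dotDl x y z : dot (x + y) z = dot x z + dot y z.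
Proof. by rewrite -big_split; apply: eq_bigr => i _; rewrite mxE mulrDl. Qed.

Lemma dotZl a x y : dot (a *: x) y = a * dot x y.
Proof. by rewrite mulr_sumr; apply: eq_bigr => i _; rewrite mxE mulrA. Qed.

Lemma dotDr x y z : dot z (x + y) = dot z x + dot z y.
Proof. by rewrite dotC dotDl !(dotC z). Qed.

Lemma dotZr a x y : dot y (a *: x) = a * dot y x.
Proof. by rewrite dotC dotZl dotC. Qed.

Lemma dotNl x y : dot (- x) y = - dot x y.
Proof. by rewrite -scaleN1r dotZl mulN1r. Qed.

Lemma dotNr x y : dot y (- x) = - dot y x.
Proof. by rewrite dotC dotNl dotC. Qed.

Lemma dot_ge0 x : 0 <= dot x x.
Proof. by apply: sumr_ge0 => i _; rewrite -expr2 sqr_ge0. Qed.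

Lemma enorm_ge0 x : 0 <= enorm x.
Proof. exact: sqrtr_ge0. Qed.

Lemma enorm_sqr x : enorm x ^+ 2 = dot x x.
Proof. by rewrite sqr_sqrtr ?dot_ge0. Qed.

Lemma enorm0 : enorm (0 : 'rV[R]_N) = 0.
Proof.
by rewrite /enorm (_ : dot _ _ = 0) ?sqrtr0// /dot big1// => i _; rewrite mxE mul0r.
Qed.

Lemma enormZ a x : enorm (a *: x) = `|a| * enorm x.
Proof.
by rewrite /enorm dotZl dotZr mulrA -expr2 sqrtrM ?sqr_ge0// sqrtr_sqr.
Qed.

Lemma enormN x : enorm (- x) = enorm x.
Proof. by rewrite -scaleN1r enormZ normrN1 mul1r. Qed.

Lemma enormB x y : enorm (x - y) = enorm (y - x).
Proof. by rewrite -enormN opprB. Qed.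

Lemma coord_le_enorm x i : `|x ord0 i| <= enorm x.
Proof.
rewrite -sqrtr_sqr ler_wsqrtr// /dot (bigD1 i)//= -expr2 lerDl.
by apply: sumr_ge0 => j _; rewrite -expr2 sqr_ge0.
Qed.

Lemma enorm_eq0 x : enorm x = 0 -> x = 0.
Proof.
move=> x0; apply/rowP => i; rewrite mxE; apply/eqP.
by rewrite -normr_eq0 eq_le normr_ge0 andbT -x0 coord_le_enorm.
Qed.

(** Cauchy-Schwarz, from the square of (y.y) x - (x.y) y. *)
Lemma dot_le x y : `|dot x y| <= enorm x * enorm y.
Proof.
have [y0|y0] := eqVneq (enorm y) 0.
  rewrite y0 mulr0 (enorm_eq0 y0) /dot big1 ?normr0// => i _.
  by rewrite mxE mulr0.
have yp : 0 < dot y y by rewrite -enorm_sqr exprn_gt0// lt_neqAle eq_sym y0 enorm_ge0.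
have := dot_ge0 (dot y y *: x - dot x y *: y).
rewrite !(dotDl, dotDr, dotNl, dotNr, dotZl, dotZr) (dotC y x).
rewrite -(ler_sqr (normr_ge0 _)) ?nnegrE ?mulr_ge0 ?enorm_ge0//.
rewrite exprMn !enorm_sqr real_normK ?num_real// => H.
have {}H : 0 <= dot y y * (dot x x * dot y y - dot x y ^+ 2) by nra.
by rewrite pmulr_rge0// subr_ge0 in H.
Qed.

Lemma enormD x y : enorm (x + y) <= enorm x + enorm y.
Proof.
rewrite -(ler_sqr (enorm_ge0 _)) ?nnegrE ?addr_ge0 ?enorm_ge0//.
rewrite enorm_sqr dotDl !dotDr sqrrD !enorm_sqr (dotC y x).
have := dot_le x y; have := ler_norm (dot x y); lra.
Qed.

Lemma enorm_le_sum x : enorm x <= \sum_i `|x ord0 i|.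
Proof.
rewrite -(ler_sqr (enorm_ge0 _)) ?nnegrE; last exact: sumr_ge0.
rewrite enorm_sqr expr2 mulr_suml; apply: ler_sum => i _.
rewrite -expr2 -real_normK ?num_real// expr2 ler_wpM2l// (bigD1 i)//= lerDl.
exact: sumr_ge0.
Qed.

Lemma coord_le_norm x i : `|x ord0 i| <= `|x|.
Proof.
rewrite [leRHS]mx_normrE.
exact: (le_bigmax _ (fun ij => `|x ij.1 ij.2|) (ord0, i)).
Qed.

Lemma enorm_le_norm x : enorm x <= N%:R * `|x|.
Proof.
rewrite (le_trans (enorm_le_sum x))// (@le_trans _ _ (\sum_(i < N) `|x|))//.
  by apply: ler_sum => i _; exact: coord_le_norm.
by rewrite sumr_const card_ord mulr_natl.
Qed.

Lemma norm_le_enorm x : `|x| <= enorm x.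
Proof.
rewrite [leLHS]mx_normrE; apply: bigmax_le => [|[i j] _]/=.
  exact: enorm_ge0.
by rewrite (ord1 i) coord_le_enorm.
Qed.

End enorm_theory.

(** * Affine changes of variables *)

Section measurable_maps.
Context {R : realType} {N : nat}.
Context {d : measure_display} {T : measurableType d}.
Implicit Types f g : T -> 'rV[R]_N.

Lemma measurable_coord f i : measurable_fun setT f ->
  measurable_fun setT (fun t => f t ord0 i).
Proof.
by move=> mf; exact: (measurableT_comp (measurable_rV_coord (R:=R) i) mf).
Qed.

Lemma measurable_rV_coordP f :
  (forall i, measurable_fun setT (fun t => f t ord0 i)) -> measurable_fun setT f.
Proof. by move=> mf; apply: measurable_fun_rV => i; exact: mf. Qed.

Lemma measurable_rVD f g : measurable_fun setT f -> measurable_fun setT g ->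
  measurable_fun setT (fun t => f t + g t).
Proof.
move=> mf mg; apply: measurable_rV_coordP => i.
under eq_fun do rewrite mxE.
by apply: measurable_funD; exact: measurable_coord.
Qed.

Lemma measurable_rVZ a f : measurable_fun setT f ->
  measurable_fun setT (fun t => a *: f t).
Proof.
move=> mf; apply: measurable_rV_coordP => i.
under eq_fun do rewrite mxE.
by apply: measurable_funM => //; exact: measurable_coord.
Qed.

Lemma measurable_rVB f g : measurable_fun setT f -> measurable_fun setT g ->
  measurable_fun setT (fun t => f t - g t).
Proof.
move=> mf mg; apply: measurable_rVD => //.
by under eq_fun do rewrite -scaleN1r; exact: measurable_rVZ.
Qed.

Lemma measurable_enorm f : measurable_fun setT f ->
  measurable_fun setT (fun t => enorm (f t)).
Proof.
move=> mf; apply: (@measurableT_comp _ _ _ _ _ _ (@Num.sqrt R)).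
  by apply: continuous_measurable_fun; exact: sqrt_continuous.
by apply: measurable_sum => i; apply: measurable_funM; exact: measurable_coord.
Qed.

End measurable_maps.

Section affine_change_of_variables.
Context {R : realType}.
Local Open Scope ereal_scope.

(** The dilated image of Lebesgue measure has the right mass on intervals, and
    this characterizes it. *)
Lemma ge0_integral_affine1 (a c : R) (f : R -> \bar R) : (a != 0)%R ->
  measurable_fun [set: measurableTypeR R] f -> (forall t, 0 <= f t) ->
  \int[@lebesgue_measure R]_t f (a * t + c)%R =
  (`|a|^-1)%:E * \int[@lebesgue_measure R]_t f t.
Proof.
move=> a0 mf f0.
pose phi : measurableTypeR R -> measurableTypeR R := fun t => (a * t + c)%R.
have mphi : measurable_fun setT phi.
  by apply: measurable_funD => //; exact: measurable_funM.
have na0 : (0 <= `|a|)%R by [].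
pose pf : {measure set (measurableTypeR R) -> \bar R} :=
  measure_function_pushforward__canonical__measure_function_Measure
    lebesgue_measure mphi.
pose nu := mscale (NngNum na0) pf.
have nuE A : measurable A -> lebesgue_measure A = nu A.
  apply: lebesgue_measure_unique => _ [[x y]/= _ <-].
  rewrite /nu /mscale/= /pushforward.
  have [xy|yx] := ltP x y; last first.
    rewrite set_itv_ge ?bnd_simp ?lt_geF -?leNgt//.
    by rewrite preimage_set0 !measure0 mule0.
  have [ap|an] : (0 < a)%R \/ (a < 0)%R.
    by apply/orP; rewrite orbC -neq_lt.
  - rewrite (_ : phi @^-1` _ = `]((x - c) / a)%R, ((y - c) / a)%R]%classic); last first.
      apply/seteqP; split => t/=; rewrite !in_itv/= /phi ltr_pdivrMr// ler_pdivlMr//.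
        by rewrite ltrBlDr lerBrDr (mulrC t).
      by rewrite ltrBlDr lerBrDr (mulrC t).
    rewrite !lebesgue_measure_itv/= !lte_fin xy ltr_pM2r ?invr_gt0// ltrD2r xy.
    by rewrite -!EFinB -EFinM gtr0_norm//; congr EFin; field.
  - rewrite (_ : phi @^-1` _ = `[((y - c) / a)%R, ((x - c) / a)%R[%classic); last first.
      apply/seteqP; split => t/=; rewrite !in_itv/= /phi ltr_ndivlMr// ler_ndivrMr//.
        by rewrite ltrBlDr lerBrDr (mulrC t) andbC.
      by rewrite ltrBlDr lerBrDr (mulrC t) andbC.
    rewrite !lebesgue_measure_itv/= !lte_fin xy ltr_nM2r ?invr_lt0// ltrD2r xy.
    by rewrite -!EFinB -EFinM ltr0_norm//; congr EFin; field.
have -> : \int[lebesgue_measure]_t f t = \int[nu]_t f t.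
  by apply: eq_measure_integral => A mA _; exact: nuE.
rewrite ge0_integral_mscale//= (ge0_integral_pushforward mphi)//.
by rewrite muleA -EFinM mulVf ?normr_eq0// mul1e preimage_setT.
Qed.

Lemma ge0_integral_rV_cons n (f : 'rV[R]_n.+1 -> \bar R) :
  measurable_fun setT f -> (forall x, 0 <= f x) ->
  \int[lebesgue_rV n.+1]_x f x =
  \int[@lebesgue_measure R]_t \int[lebesgue_rV n]_y f (rV_cons (t, y)).
Proof.
move=> mf f0.
have := ge0_integral_pushforward (@measurable_rV_cons R n)
  (lebesgue_measure \x lebesgue_rV n) measurableT mf (fun y _ => f0 y).
rewrite preimage_setT => H.
rewrite -[RHS](fubini_tonelli1 (m1 := lebesgue_measure) (m2 := lebesgue_rV n)
  (f \o @rV_cons R n)) //.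
- exact: measurableT_comp mf (@measurable_rV_cons R n).
- by move=> x; exact: f0.
Qed.

(** Induction on the dimension: the measure on R^(n+1) is the image of a product,
    and rV_cons turns the affine map into a pair of affine maps. *)
Lemma ge0_integral_affine n (a : R) (c : 'rV[R]_n) (f : 'rV[R]_n -> \bar R) :
  (a != 0)%R -> measurable_fun setT f -> (forall x, 0 <= f x) ->
  \int[lebesgue_rV n]_x f (a *: x + c)%R =
  (`|a| ^- n)%:E * \int[lebesgue_rV n]_x f x.
Proof.
move=> a0; elim: n c f => [|n IH] c f mf f0.
  rewrite expr0 invr1 mul1e; apply: eq_integral => x _; congr f.
  by apply/rowP => -[].
have maff : measurable_fun setT (fun x : 'rV[R]_n.+1 => (a *: x + c)%R).
  by apply: measurable_rVD => //; exact: measurable_rVZ.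
rewrite !ge0_integral_rV_cons//; last exact: measurableT_comp mf maff.
pose c' : 'rV[R]_n := (rV_uncons c).2.
have consE t y : (a *: rV_cons (t, y) + c = rV_cons (a * t + c ord0 ord0, a *: y + c'))%R.
  apply/rowP => i; rewrite [LHS]mxE [X in (X + _)%R]mxE.
  case: (unliftP ord0 i) => [j ->|->].
    rewrite !rV_consE/= !mxE; congr (_ + c _ _)%R; exact/val_inj.
  by rewrite !rV_consE0.
under eq_integral do under eq_integral do rewrite consE.
pose F t := \int[lebesgue_rV n]_y f (rV_cons (t, y)).
have mF : measurable_fun [set: measurableTypeR R] F.
  apply: (measurable_fun_fubini_tonelli_F (m2 := lebesgue_rV n) (f \o @rV_cons R n)).
    exact: measurableT_comp mf (@measurable_rV_cons R n).
  by move=> z; exact: f0.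
have mfc t : measurable_fun setT (fun y : 'rV[R]_n => f (rV_cons (t, y))).
  apply: measurableT_comp mf _.
  exact: measurableT_comp (@measurable_rV_cons R n) (measurable_pair1 _).
transitivity (\int[lebesgue_measure]_t ((`|a| ^- n)%:E * F (a * t + c ord0 ord0)%R)).
  by apply: eq_integral => t _; rewrite -(IH c' (fun y => f (rV_cons (_, y)))).
have F0 t : 0 <= F t by apply: integral_ge0.
have mFa : measurable_fun [set: measurableTypeR R]
    (fun t => F (a * t + c ord0 ord0)%R).
  apply: measurableT_comp mF _.
  by apply: measurable_funD => //; exact: measurable_funM.
have k0 : 0 <= (`|a| ^- n)%:E by rewrite lee_fin invr_ge0 exprn_ge0.
rewrite (ge0_integralZl lebesgue_measure measurableT mFa (fun t _ => F0 _) k0).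
by rewrite (ge0_integral_affine1 _ a0 mF F0) muleA -EFinM -invfM -exprSr.
Qed.

End affine_change_of_variables.

(** * Borel sets and balls *)

Lemma measurable_ltr_set d (T : measurableType d) (R : realType) (f g : T -> R) :
  measurable_fun setT f -> measurable_fun setT g ->
  measurable [set x | f x < g x].
Proof.
move=> mf mg; have := measurable_fun_ltr mf mg measurableT (Y := [set true]).
by rewrite setTI; apply.
Qed.

Lemma measurable_ler_set d (T : measurableType d) (R : realType) (f g : T -> R) :
  measurable_fun setT f -> measurable_fun setT g ->
  measurable [set x | f x <= g x].
Proof.
move=> mf mg; have := measurable_fun_ler mf mg measurableT (Y := [set true]).
by rewrite setTI; apply.
Qed.

Section sets_rV.
Context {R : realType} {N : nat}.
Implicit Types (x y : 'rV[R]_N) (r : R).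

Lemma measurable_box (a b : 'I_N -> R) :
  measurable [set x : 'rV[R]_N | forall i, x ord0 i \in `[a i, b i]].
Proof.
rewrite (_ : mkset _ = \bigcap_(i in [set: 'I_N])
    (@rV_coord R N i @^-1` `[a i, b i]%classic)).
  apply: fin_bigcap_measurable => // i _.
  by rewrite -[X in measurable X]setTI; exact: measurable_rV_coord.
by apply/seteqP; split => x /= H i; [move=> _|]; exact: H.
Qed.

Lemma measurable_cball r : measurable [set x : 'rV[R]_N | enorm x <= r].
Proof. by apply: measurable_ler_set => //; exact: measurable_enorm. Qed.

Lemma measurable_eball r : measurable [set x : 'rV[R]_N | enorm x < r].
Proof. by apply: measurable_ltr_set => //; exact: measurable_enorm. Qed.

Lemma lebesgue_cball_le r : 0 <= r ->
  (lebesgue_rV N [set x : 'rV[R]_N | (enorm x <= r)%R] <= ((2 * r) ^+ N)%:E)%E.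
Proof.
move=> r0.
rewrite (_ : ((2 * r) ^+ N)%:E = (\prod_(i < N) (r - - r))%:E); last first.
  by rewrite prodr_const card_ord; congr (_ ^+ _)%:E; lra.
rewrite -(@lebesgue_rV_box R N (fun=> - r) (fun=> r)); last by move=> _; lra.
apply: le_measure; rewrite ?inE.
- exact: measurable_cball.
- exact: measurable_box.
- move=> x /= xr i; rewrite in_itv/= -ler_norml.
  exact: le_trans (coord_le_enorm _ _) xr.
Qed.

Lemma lebesgue_cball_lty r :
  (lebesgue_rV N [set x : 'rV[R]_N | (enorm x <= r)%R] < +oo)%E.
Proof.
have H := lebesgue_cball_le (normr_ge0 r); apply: le_lt_trans (ltry _).
apply: le_trans H; apply: le_measure; rewrite ?inE; try exact: measurable_cball.
by move=> x /= xr; rewrite (le_trans xr)// ler_norm.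
Qed.

Lemma lebesgue_cball_gt0 r : 0 < r ->
  (0 < lebesgue_rV N [set x : 'rV[R]_N | (enorm x <= r)%R])%E.
Proof.
move=> r0; pose e := r / N.+1%:R.
have e0 : 0 < e by rewrite divr_gt0// ltr0n.
apply: (@lt_le_trans _ _ (lebesgue_rV N
  [set x : 'rV[R]_N | forall i, x ord0 i \in `[- e, e]])).
  rewrite lebesgue_rV_box => [|_]; last by lra.
  by rewrite lte_fin; apply: prodr_gt0 => i _; lra.
apply: le_measure; rewrite ?inE.
- exact: measurable_box.
- exact: measurable_cball.
- move=> x /= H'; apply: le_trans (enorm_le_sum x) _.
  apply: (@le_trans _ _ (\sum_(i < N) e)).
    by apply: ler_sum => i _; rewrite ler_norml; have := H' i; rewrite in_itv.
  rewrite sumr_const card_ord -mulr_natr /e mulrAC ler_pdivrMr ?ltr0n//.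
  by rewrite ler_pM2l// ler_nat.
Qed.

Lemma lebesgue_rV_set0 : (0 < N)%N ->
  lebesgue_rV N [set (0 : 'rV[R]_N)] = 0%E.
Proof.
move=> N0; have := @lebesgue_rV_box R N (fun=> 0) (fun=> 0) (fun=> lexx _).
rewrite prodr_const card_ord subrr expr0n (gtn_eqF N0)/= => H.
rewrite -[RHS]H; congr (lebesgue_rV N _); apply/seteqP; split => x /=.
  by move=> -> i; rewrite mxE in_itv/= lexx.
move=> x0; apply/rowP => i; rewrite mxE.
by have := x0 i; rewrite in_itv/= -eq_le => /eqP.
Qed.

(** An open set is the union of the boxes with rational corners that it
    contains. *)
Lemma open_measurable_rV (U : set 'rV[R]_N) : open U -> measurable U.
Proof.
move=> oU.
pose B (q : {ffun 'I_N -> rat * rat}) : set 'rV[R]_N :=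
  [set x | forall i, x ord0 i \in `[ratr (q i).1, ratr (q i).2]].
rewrite (_ : U = \bigcup_(q in [set q | B q `<=` U]) B q); last first.
  apply/seteqP; split => [x Ux|x [q qU]]; last exact: qU.
  have /nbhs_ballP[e/= e0 xU] : nbhs x U by apply: open_nbhs_nbhs; split.
  have Hq i : exists q : rat * rat,
      [/\ x ord0 i - e / 2 < ratr q.1, ratr q.1 < x ord0 i,
          x ord0 i < ratr q.2 & ratr q.2 < x ord0 i + e / 2].
    have /rat_in_itvoo[q1] : x ord0 i - e / 2 < x ord0 i by clear -e0; lra.
    have /rat_in_itvoo[q2] : x ord0 i < x ord0 i + e / 2 by clear -e0; lra.
    by rewrite !in_itv/= => /andP[? ?] /andP[? ?]; exists (q1, q2).
  have [q Hq'] := choice Hq.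
  exists (finfun q); last first.
    by move=> i; rewrite ffunE in_itv/=; case: (Hq' i) => h1 h2 h3 h4; apply/andP; split; apply/ltW.
  move=> y By; apply: xU; rewrite -ball_normE /=.
  rewrite [ltLHS]mx_normrE; apply: bigmax_lt => // -[j i] _ /=.
  rewrite !mxE (ord1 j); have := By i; rewrite ffunE in_itv/= => /andP[].
  case: (Hq' i) => h1 h2 h3 h4 h5 h6; rewrite ltr_norml.
  by clear -h1 h2 h3 h4 h5 h6 e0; apply/andP; split; lra.
rewrite bigcup_mkcond; apply: countable_bigcupT_measurable => // q.
by case: ifP => // _; exact: measurable_box.
Qed.

Lemma continuous_measurable_rV (f : 'rV[R]_N -> R) : continuous f ->
  measurable_fun setT f.
Proof.
move=> /continuousP cf; apply: (measurability _ (RGenOpens.measurableE R)).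
move=> _ [_ [a [b ->] <-]]; rewrite setTI; apply: open_measurable_rV.
exact/cf/interval_open.
Qed.

End sets_rV.

(** * Integrability of the singular kernel *)

Section dyadic.
Context {d : measure_display} {T : measurableType d} {R : realType}.
Variable mu : {measure set T -> \bar R}.

Lemma geometric_nneseries_lty (C rho : R) : 0 <= C -> 0 <= rho < 1 ->
  (\sum_(0 <= j <oo) (C * rho ^+ j)%:E < +oo)%E.
Proof.
move=> C0 /andP[r0 r1].
apply: (@le_lt_trans _ _ (C / (1 - rho))%:E); last exact: ltry.
apply: lime_le; first by apply: is_cvg_nneseries => j _ _; rewrite lee_fin mulr_ge0 ?exprn_ge0.
apply: nearW => n; rewrite sumEFin lee_fin ler_pdivlMr ?subr_gt0//.
suff -> : (\sum_(0 <= j < n) C * rho ^+ j) * (1 - rho) = C - C * rho ^+ n.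
  by rewrite lerBlDr lerDl mulr_ge0 ?exprn_ge0.
elim: n => [|n IH]; first by rewrite big_nil expr0; ring.
by rewrite big_nat_recr//= mulrDl IH exprS; ring.
Qed.

(** Comparison with a geometric series: f is dominated on the j-th piece of a
    cover by a constant whose mass decays geometrically. *)
Lemma dyadic_integral_lty (f : T -> R) (B : nat -> set T) (c : nat -> R)
    (C rho : R) :
  measurable_fun setT f -> (forall x, 0 <= f x) ->
  (forall j, measurable (B j)) -> (forall j, 0 <= c j) ->
  0 <= C -> 0 <= rho < 1 ->
  (forall j, ((c j)%:E * mu (B j) <= (C * rho ^+ j)%:E)%E) ->
  (forall x, f x != 0 -> exists2 j, B j x & f x <= c j) ->
  (\int[mu]_x (f x)%:E < +oo)%E.
Proof.
move=> mf f0 mB c0 C0 rho01 cB fB.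
apply: le_lt_trans (geometric_nneseries_lty C0 rho01).
pose g j x := ((c j)%:E * (\1_(B j) x)%:E)%E.
have g0 j x : (0 <= g j x)%E by rewrite mule_ge0// lee_fin// indicE.
have mg j : measurable_fun setT (g j).
  by apply: emeasurable_funM => //; exact/measurable_EFinP/measurable_indic.
apply: (@le_trans _ _ (\int[mu]_x \sum_(0 <= j <oo) g j x)%E).
  apply: ge0_le_integral => //.
  - by move=> x _; rewrite lee_fin.
  - exact/measurable_EFinP.
  - by apply: ge0_emeasurable_sum => // j x _ _; exact: g0.
  - move=> x _; have [->|/fB[j Bx fx]] := eqVneq (f x) 0.
      by apply: nneseries_ge0 => j _ _; exact: g0.
    apply: le_trans (nneseries_lim_ge j.+1 _); last by move=> i _ _; exact: g0.
    rewrite big_nat_recr//= (@le_trans _ _ (g j x))//.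
      by rewrite /g indicE mem_set// mule1 lee_fin.
    by rewrite leeDr// sume_ge0.
rewrite (integral_nneseries mu measurableT mg (fun j x _ => g0 j x)).
apply: lee_nneseries => [j _ _|j _]; first by apply: integral_ge0.
have -> : (\int[mu]_x g j x = (c j)%:E * mu (B j))%E; last exact: cB.
rewrite /g (ge0_integralZl mu measurableT) => [|//||//].
- by rewrite integral_indic// setIT.
- exact/measurable_EFinP/measurable_indic.
- by move=> x _; rewrite lee_fin indicE.
- by rewrite lee_fin.
Qed.

End dyadic.

Lemma dyadic_floor (R : realType) (x : R) : 1 <= x ->
  exists j, (2 ^+ j <= x < 2 ^+ j.+1)%R.
Proof.
move=> x1.
have ex : exists n, x < 2 ^+ n.
  exists (Num.truncn x).+1; apply: (lt_le_trans (truncnS_gt _)).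
  by rewrite -natrX ler_nat ltnW// ltn_expl.
case: (ex_minnP ex) => -[|n] xn Hn; first by rewrite expr0 ltNge x1 in xn.
by exists n; rewrite xn andbT leNgt; apply/negP => /Hn; rewrite ltnn.
Qed.

Lemma indic_bool (T : Type) (R : realType) (P : pred T) x :
  \1_[set y | P y] x = (P x)%:R :> R.
Proof.
rewrite indicE; congr (nat_of_bool _)%:R.
by apply/idP/idP; rewrite inE.
Qed.

Lemma measurable_indic_bool d (T : measurableType d) (R : realType)
    (P : pred T) : measurable [set x | P x] ->
  measurable_fun setT (fun x => (P x)%:R : R).
Proof.
move=> mP; rewrite (_ : (fun x => _) = \1_[set x | P x]).
  exact: measurable_indic.
by apply/funext => x; rewrite indic_bool.
Qed.

Lemma pow2N_lt1 (R : realType) (a : R) : 0 < a -> 2 `^ (- a) < 1.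
Proof.
move=> a0; rewrite powRN invf_lt1 ?powR_gt0//.
have := @gt0_ltr_powR R a a0 1 2; rewrite powR1 !nnegrE; apply => //.
by rewrite ltr1n.
Qed.

Section kernel.
Context {R : realType} {N : nat}.
Variable s : R.
Hypothesis hs : 0 < s < 1.

Let A := N%:R + 2 * s.
Let A0 : 0 < A.
Proof. by have := ler0n R N; rewrite /A; move: hs; lra. Qed.

(** The singular kernel of the fractional Laplacian. *)
Definition ker (z : 'rV[R]_N) : R := (enorm z `^ (N%:R + 2 * s))^-1.

Lemma ker_ge0 z : 0 <= ker z.
Proof. by rewrite invr_ge0 powR_ge0. Qed.

Lemma ker0 : ker 0 = 0.
Proof. by rewrite /ker enorm0 powR0 ?invr0// gt_eqF. Qed.

Lemma kerN z : ker (- z) = ker z.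
Proof. by rewrite /ker enormN. Qed.

Lemma kerZ a z : a != 0 -> ker (a *: z) = `|a| `^ (- (N%:R + 2 * s)) * ker z.
Proof. by move=> a0; rewrite /ker enormZ powRM ?enorm_ge0// powRN invfM. Qed.

Lemma measurable_ker : measurable_fun setT ker.
Proof.
have -> : ker = fun z => enorm z `^ (- (N%:R + 2 * s)).
  by apply/funext => z; rewrite powRN.
apply: (measurableT_comp (measurable_powR _)); exact: measurable_enorm.
Qed.

Lemma ker_le r z : 0 < r -> r <= enorm z -> ker z <= r `^ (- (N%:R + 2 * s)).
Proof.
move=> r0 rz; have zp := lt_le_trans r0 rz.
rewrite powRN /ker lef_pV2 ?posrE ?powR_gt0//.
by apply: ge0_ler_powR; rewrite ?nnegrE// ltW.
Qed.

Lemma ker_ge r z : 0 < r -> z != 0 -> enorm z <= r ->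
  r `^ (- (N%:R + 2 * s)) <= ker z.
Proof.
move=> r0 z0 zr; have zp : 0 < enorm z.
  rewrite lt_neqAle enorm_ge0 andbT eq_sym; apply: contra z0 => /eqP.
  by move/enorm_eq0 ->.
rewrite powRN /ker lef_pV2 ?posrE ?powR_gt0//.
by apply: ge0_ler_powR; rewrite ?nnegrE// ltW.
Qed.

Lemma measurable_min_pow q :
  measurable_fun setT (fun z : 'rV[R]_N => Num.min 1 (enorm z `^ q)).
Proof.
apply: measurable_minr => //.
apply: (measurableT_comp (measurable_powR _)); exact: measurable_enorm.
Qed.

Lemma ker_integrable_far :
  (\int[lebesgue_rV N]_z (ker z * (1 <= enorm z)%R%:R)%:E < +oo)%E.
Proof.
pose c j : R := (2 `^ (- A)) ^+ j.
have p2 (a : R) : 0 < 2 `^ a :> R by rewrite powR_gt0.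
pose rho : R := 2 `^ (- (2 * s)).
have rho1 : rho < 1.
  by apply: pow2N_lt1; move: hs; lra.
apply: (@dyadic_integral_lty _ _ _ _ _ (fun j => [set z | enorm z <= 2 ^+ j.+1])
  c (4 ^+ N) rho).
- apply: measurable_funM; first exact: measurable_ker.
  by apply: measurable_indic_bool; apply: measurable_ler_set => //; exact: measurable_enorm.
- by move=> z; rewrite mulr_ge0 ?ker_ge0.
- by move=> j; exact: measurable_cball.
- by move=> j; rewrite exprn_ge0// ltW.
- by rewrite exprn_ge0.
- by rewrite rho1 ltW// p2.
- move=> j; have H : 0 <= 2 ^+ j.+1 :> R by rewrite exprn_ge0.
  apply: (@le_trans _ _ ((c j)%:E * ((2 * 2 ^+ j.+1) ^+ N)%:E)%E).
    by rewrite lee_wpmul2l ?lebesgue_cball_le// lee_fin exprn_ge0// ltW.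
  rewrite -EFinM lee_fin /c /rho le_eqVlt; apply/orP; left; apply/eqP.
  rewrite -!powR_mulrn ?powR_ge0// -!powRrM.
  rewrite (_ : 2 * 2 `^ j.+1%:R = 2 `^ (j%:R + 2)); last first.
    by rewrite powRD ?pnatr_eq0 ?implybT// !powR_mulrn// exprS expr2; ring.
  rewrite (_ : 4 = 2 `^ 2); last by rewrite powR_mulrn// expr2; ring.
  rewrite -!powRrM -!powRD ?pnatr_eq0 ?implybT//; congr (_ `^ _).
  by rewrite /A; ring.
- move=> z; have [z1|z1] := leP 1 (enorm z); last by rewrite mulr0 eqxx.
  rewrite mulr1 => _; have [j /andP[jz zj]] := dyadic_floor z1.
  exists j; first exact: ltW.
  apply: le_trans (ker_le _ jz) _; first by rewrite exprn_gt0.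
  by rewrite /c -!powR_mulrn// -!powRrM mulrC.
Qed.

Lemma ker_integrable_near q : 2 * s < q ->
  (\int[lebesgue_rV N]_z (enorm z `^ q * ker z * (enorm z < 1)%R%:R)%:E < +oo)%E.
Proof.
move=> sq.
pose c j : R := 2 `^ A * (2 `^ (A - q)) ^+ j.
have p2 (a : R) : 0 < 2 `^ a :> R by rewrite powR_gt0.
pose rho : R := 2 `^ (- (q - 2 * s)).
have rho1 : rho < 1.
  by apply: pow2N_lt1; rewrite subr_gt0.
apply: (@dyadic_integral_lty _ _ _ _ _ (fun j => [set z | enorm z <= 2 ^- j])
  c (2 `^ A * 2 ^+ N) rho).
- apply: measurable_funM.
    apply: measurable_funM; last exact: measurable_ker.
    by apply: (measurableT_comp (measurable_powR _)); exact: measurable_enorm.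
  by apply: measurable_indic_bool; exact: measurable_eball.
- by move=> z; rewrite !mulr_ge0 ?ker_ge0 ?powR_ge0.
- by move=> j; exact: measurable_cball.
- by move=> j; rewrite mulr_ge0 ?exprn_ge0 ?ltW.
- by rewrite mulr_ge0 ?exprn_ge0 ?ltW.
- by rewrite rho1 ltW// p2.
- move=> j; have H : 0 <= 2 ^- j :> R by rewrite invr_ge0 exprn_ge0.
  apply: (@le_trans _ _ ((c j)%:E * ((2 * 2 ^- j) ^+ N)%:E)%E).
    by rewrite lee_wpmul2l ?lebesgue_cball_le// lee_fin mulr_ge0 ?exprn_ge0 ?ltW.
  rewrite -EFinM lee_fin /c /rho le_eqVlt; apply/orP; left; apply/eqP.
  rewrite exprMn -!mulrA; congr (_ * _); rewrite mulrCA; congr (_ * _).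
  rewrite -!powR_mulrn ?powR_ge0// -!powRN -!powRrM.
  rewrite -!powRD ?pnatr_eq0 ?implybT//; congr (_ `^ _).
  by rewrite /A; ring.
- move=> z; have [z1|z1] := ltP (enorm z) 1; last by rewrite mulr0 eqxx.
  rewrite mulr1 => z0.
  have zp : 0 < enorm z.
    rewrite lt_neqAle enorm_ge0 andbT eq_sym; apply: contra z0 => /eqP.
    by move/enorm_eq0 ->; rewrite ker0 mulr0.
  have /dyadic_floor[j /andP[jz zj]] : 1 <= (enorm z)^-1.
    by rewrite invf_ge1// ltW.
  have zj2 : enorm z <= 2 ^- j by rewrite -[leLHS]invrK lef_pV2 ?posrE ?invr_gt0 ?exprn_gt0.
  exists j => //=.
  have jz2 : 2 ^- j.+1 <= enorm z.
    by rewrite -[leRHS]invrK lef_pV2 ?posrE ?invr_gt0 ?exprn_gt0// ltW.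
  apply: (@le_trans _ _ ((2 ^- j) `^ q * (2 ^- j.+1) `^ (- A))).
    apply: ler_pM; rewrite ?powR_ge0 ?ker_ge0//.
      apply: ge0_ler_powR; rewrite ?nnegrE ?(ltW zp) ?invr_ge0 ?exprn_ge0//.
      by move: hs; lra.
    by apply: ker_le jz2; rewrite invr_gt0 exprn_gt0.
  rewrite /c -!powR_mulrn ?powR_ge0// -!powRN -!powRrM.
  rewrite -!powRD ?pnatr_eq0 ?implybT// le_eqVlt; apply/orP; left; apply/eqP; congr (_ `^ _).
  by rewrite -natr1; ring.
Qed.

(** The mass of the kernel on the shell of radius 2^j is of order 2^(-2sj): the
    sum over the outer shells converges, and so does the sum over the inner ones
    once the kernel is multiplied by a power of |z| higher than 2s. *)
Lemma ker_integrable q : 2 * s < q ->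
  (lebesgue_rV N).-integrable setT
    (fun z => (Num.min 1 (enorm z `^ q) * ker z)%:E).
Proof.
move=> sq; apply/integrableP; split.
  apply/measurable_EFinP/measurable_funM; [exact: measurable_min_pow|exact: measurable_ker].
pose f1 (z : 'rV[R]_N) := (ker z * (1 <= enorm z)%R%:R)%:E.
pose f2 (z : 'rV[R]_N) := (enorm z `^ q * ker z * (enorm z < 1)%R%:R)%:E.
have f10 z : (0 <= f1 z)%E by rewrite lee_fin mulr_ge0 ?ker_ge0.
have f20 z : (0 <= f2 z)%E by rewrite lee_fin !mulr_ge0 ?ker_ge0 ?powR_ge0.
have mf1 : measurable_fun setT f1.
  apply/measurable_EFinP/measurable_funM; first exact: measurable_ker.
  by apply: measurable_indic_bool; apply: measurable_ler_set => //; exact: measurable_enorm.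
have mf2 : measurable_fun setT f2.
  apply/measurable_EFinP/measurable_funM.
    apply: measurable_funM; last exact: measurable_ker.
    by apply: (measurableT_comp (measurable_powR _)); exact: measurable_enorm.
  by apply: measurable_indic_bool; exact: measurable_eball.
apply: (@le_lt_trans _ _ (\int[lebesgue_rV N]_z (f1 z + f2 z))%E).
  apply: ge0_le_integral => //.
  - apply: measurableT_comp => //; apply/measurable_EFinP/measurable_funM.
      exact: measurable_min_pow.
    exact: measurable_ker.
  - exact: emeasurable_funD.
  - move=> z _; rewrite gee0_abs; last first.
      by rewrite lee_fin mulr_ge0 ?ker_ge0// le_min ler01 powR_ge0.
    rewrite -EFinD lee_fin; have [z1|z1] := leP 1 (enorm z).
      by rewrite mulr1 mulr0 addr0 ler_piMl ?ker_ge0// ge_min lexx.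
    by rewrite mulr0 add0r mulr1 ler_wpM2r ?ker_ge0// ge_min lexx orbT.
rewrite ge0_integralD// lte_add_pinfty//.
  exact: ker_integrable_far.
exact: ker_integrable_near.
Qed.

End kernel.

(** * The fractional Laplacian of a C^{1,1} function *)

Section affine_integrable.
Context {R : realType} {n : nat}.
Local Notation leb := (@lebesgue_rV R n).
Variables (a : R) (c : 'rV[R]_n).
Hypothesis a0 : a != 0.

Lemma measurable_affine : measurable_fun setT (fun x : 'rV[R]_n => a *: x + c).
Proof. by apply: measurable_rVD => //; exact: measurable_rVZ. Qed.

Lemma integrable_affine (f : 'rV[R]_n -> R) :
  leb.-integrable setT (EFin \o f) ->
  leb.-integrable setT (EFin \o (fun x => f (a *: x + c))).
Proof.
move=> /integrableP[mf fi]; apply/integrableP; split.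
  exact: measurableT_comp mf measurable_affine.
rewrite (ge0_integral_affine c a0 (f := fun x => `|(EFin \o f) x|)%E) //.
  by apply: lte_mul_pinfty => //; rewrite lee_fin invr_ge0 exprn_ge0.
exact: measurableT_comp.
Qed.

Lemma Rintegral_affine (f : 'rV[R]_n -> R) :
  leb.-integrable setT (EFin \o f) ->
  \int[leb]_x f (a *: x + c) = `|a| ^- n * \int[leb]_x f x.
Proof.
move=> fi; have /measurable_int mf := fi.
have k0 : (0 <= (`|a| ^- n)%:E)%E by rewrite lee_fin invr_ge0 exprn_ge0.
rewrite /Rintegral integralE [in RHS]integralE.
have /(ge0_integral_affine c a0) Hp := measurable_funepos mf.
have /(ge0_integral_affine c a0) Hn := measurable_funeneg mf.
rewrite (_ : (fun x => _)^\+%E = fun x => ((EFin \o f)^\+ (a *: x + c)%R)%E)//.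
rewrite (_ : (fun x => _)^\-%E = fun x => ((EFin \o f)^\- (a *: x + c)%R)%E)//.
rewrite Hp ?Hn; try by move=> x; rewrite ?funepos_ge0 ?funeneg_ge0.
have fp := integrable_pos_fin_num measurableT fi.
have fn := integrable_neg_fin_num measurableT fi.
rewrite -(fineK fp) -(fineK fn) -!EFinM -!EFinB /=.
  by rewrite mulrBr.
- by apply/funext => x; rewrite !funenegE.
- by apply/funext => x; rewrite !funeposE.
Qed.

End affine_integrable.

Lemma le_powR_interp (R : realType) (a C D m w : R) :
  0 < a < 1 -> 0 <= C -> 0 <= D -> 0 <= m -> 0 <= w ->
  w <= C * D -> w <= C * m -> w <= C * (D `^ a * m `^ (1 - a)).
Proof.
move=> /andP[a0 a1] C0 D0 m0 w0 wD wm.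
have powE (v : R) : 0 <= v -> v = v `^ a * v `^ (1 - a).
  move=> v0; have [->|vn0] := eqVneq v 0; first by rewrite powR0 ?mul0r ?gt_eqF.
  by rewrite -powRD ?vn0 ?implybT// addrC subrK powRr1.
rewrite (powE w w0) [X in _ <= X * _](powE C C0) mulrACA -!powRM//.
apply: ler_pM; rewrite ?powR_ge0//.
  by apply: ge0_ler_powR; rewrite ?nnegrE ?mulr_ge0 ?(ltW a0).
by apply: ge0_ler_powR; rewrite ?nnegrE ?mulr_ge0 ?subr_ge0 ?(ltW a1).
Qed.

Lemma lipschitz_continuous (R : realType) (W : normedModType R) (f : W -> R) M :
  (forall x y, `|f x - f y| <= M * `|x - y|) -> continuous f.
Proof.
move=> fM x; apply/cvgrPdist_le => e e0; near=> y.
apply: le_trans (fM _ _) _; apply: (@le_trans _ _ ((`|M| + 1) * `|x - y|)).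
  by rewrite ler_wpM2r// (le_trans (ler_norm _))// lerDl.
rewrite mulrC -ler_pdivlMr ?ltr_wpDl//; near: y.
by apply: cvgr_dist_le; [exact: cvg_id|rewrite divr_gt0// ltr_wpDl].
Unshelve. all: by end_near. Qed.

Lemma enorm_lipschitz_continuous (R : realType) N (f : 'rV[R]_N -> R) K :
  (forall x y, `|f x - f y| <= K * enorm (x - y)) -> continuous f.
Proof.
move=> fK; apply: (@lipschitz_continuous _ _ _ (`|K| * N%:R)) => x y.
apply: le_trans (fK x y) _; apply: (@le_trans _ _ (`|K| * enorm (x - y))).
  by rewrite ler_wpM2r ?enorm_ge0// ler_norm.
by rewrite -mulrA ler_wpM2l// enorm_le_norm.
Qed.

Lemma enorm_continuous (R : realType) N : continuous (@enorm R N).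
Proof.
apply: (@enorm_lipschitz_continuous _ _ _ 1) => x y; rewrite mul1r.
rewrite ler_norml; apply/andP; split.
  by rewrite lerNl opprB lerBlDr enormB -{1}(subrK x y) enormD.
by rewrite lerBlDr -{1}(subrK y x) enormD.
Qed.

Lemma compact_cball (R : realType) N (r : R) :
  compact [set x : 'rV[R]_N | enorm x <= r].
Proof.
apply: bounded_closed_compact.
  exists r; split; first exact: num_real.
  by move=> M rM x /= xr; rewrite (le_trans (norm_le_enorm x))// (le_trans xr)// ltW.
apply: (@preimage_closed _ _ _ [set t : R | t <= r]) => //.
by move=> x _; exact: enorm_continuous.
Qed.

Section second_difference.
Context {R : realType} {N : nat}.
Local Notation leb := (@lebesgue_rV R N).
Variable s : R.
Hypothesis hs : 0 < s < 1.
Implicit Types (C : R) (f g : 'rV[R]_N -> R) (x y z : 'rV[R]_N).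

Definition sdiff f x z : R := 2 * f x - f (x + z) - f (x - z).

(** Bounded, Lipschitz, with second differences of size |z|^2: a bounded C^{1,1}
    function, in the form in which the regularity is used. *)
Definition tame (C : R) f : Prop :=
  [/\ forall x, `|f x| <= C,
      forall x y, `|f x - f y| <= C * enorm (x - y) &
      forall x z, `|sdiff f x z| <= C * enorm z ^+ 2].

(** The fractional Laplacian without its normalizing constant, as an absolutely
    convergent integral of second differences. *)
Definition fracL f x : R := (\int[leb]_z (sdiff f x z * ker s z)) / 2.

(** Integrable majorant of second differences times the kernel. The exponent
    1 + s lies strictly between 2s and 2, which leaves room for the
    interpolation in fracL_holder. *)
Definition kmin z : R := Num.min 1 (enorm z `^ (1 + s)) * ker s z.

Definition kmass : R := \int[leb]_z kmin z.

Lemma kmin_ge0 z : 0 <= kmin z.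
Proof. by rewrite mulr_ge0 ?ker_ge0// le_min ler01 powR_ge0. Qed.

Lemma kmin_integrable : leb.-integrable setT (EFin \o kmin).
Proof. by apply: (ker_integrable hs); case/andP: hs => ? ?; lra. Qed.

Lemma kmass_ge0 : 0 <= kmass.
Proof. by apply: Rintegral_ge0 => z _; exact: kmin_ge0. Qed.

Lemma min_pow_le z : Num.min 1 (enorm z ^+ 2) <= Num.min 1 (enorm z `^ (1 + s)).
Proof.
rewrite -powR_mulrn ?enorm_ge0//.
have /andP[s0 s1] := hs.
have [z1|z1] := leP 1 (enorm z).
  have h : 1 <= enorm z `^ (1 + s).
    by rewrite -[leLHS](powRr0 (enorm z)); apply: ler_powR => //; lra.
  by rewrite [X in _ <= X]min_l// ge_min lexx.
have [z0|z0] := eqVneq (enorm z) 0.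
  by rewrite z0 !powR0// gt_eqF ?addr_gt0.
have zp : 0 < enorm z <= 1 by rewrite lt_neqAle eq_sym z0 enorm_ge0/= ltW.
rewrite le_min ge_min lexx/= ge_min; apply/orP; right.
by apply: ger_powR => //; lra.
Qed.

Lemma tame_ge0 C f : tame C f -> 0 <= C.
Proof. by case=> /(_ 0) H _ _; exact: le_trans (normr_ge0 _) H. Qed.

Lemma tame_continuous C f : tame C f -> continuous f.
Proof. by case=> _ fL _; exact: enorm_lipschitz_continuous fL. Qed.

Lemma tame_measurable C f : tame C f -> measurable_fun setT f.
Proof. by move=> /tame_continuous; exact: continuous_measurable_rV. Qed.

Lemma sdiff_le C f x z : tame C f ->
  `|sdiff f x z| <= 4 * C * Num.min 1 (enorm z `^ (1 + s)).
Proof.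
move=> ft; have C0 := tame_ge0 ft; case: ft => fC _ f2.
apply: (@le_trans _ _ (4 * C * Num.min 1 (enorm z ^+ 2))); last first.
  by rewrite ler_wpM2l ?min_pow_le// mulr_ge0.
rewrite minr_pMr ?mulr_ge0// mulr1 le_min; apply/andP; split.
  have := fC x; have := fC (x + z); have := fC (x - z).
  by rewrite /sdiff !ler_norml => /andP[? ?] /andP[? ?] /andP[? ?]; apply/andP; split; lra.
apply: le_trans (f2 _ _) _; rewrite ler_wpM2r ?sqr_ge0//; lra.
Qed.

Lemma sdiff_ker_le C f x z : tame C f ->
  `|sdiff f x z * ker s z| <= 4 * C * kmin z.
Proof.
move=> ft; rewrite normrM (ger0_norm (ker_ge0 _ _)) /kmin mulrA.
by rewrite ler_wpM2r ?ker_ge0//; exact: sdiff_le.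
Qed.

Lemma measurable_shift x : measurable_fun setT (fun z : 'rV[R]_N => x + z).
Proof. by apply: measurable_rVD. Qed.

Lemma measurable_shiftN x : measurable_fun setT (fun z : 'rV[R]_N => x - z).
Proof. by apply: measurable_rVB. Qed.

Lemma measurable_sdiff f x : measurable_fun setT f ->
  measurable_fun setT (sdiff f x).
Proof.
move=> mf; apply: measurable_funB.
  apply: measurable_funB => //.
  exact: measurableT_comp mf (measurable_shift x).
exact: measurableT_comp mf (measurable_shiftN x).
Qed.

Lemma sdiff_integrable C f x : tame C f ->
  leb.-integrable setT (EFin \o (fun z => sdiff f x z * ker s z)).
Proof.
move=> ft.
apply: (le_integrable measurableT (g := EFin \o (fun z => 4 * C * kmin z))).
- apply/measurable_EFinP/measurable_funM; last exact: measurable_ker.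
  by apply: measurable_sdiff; exact: tame_measurable ft.
- move=> z _ /=; rewrite lee_fin (le_trans (sdiff_ker_le _ _ ft))//.
  exact: ler_norm.
- rewrite (_ : EFin \o _ = fun z => ((4 * C)%:E * (EFin \o kmin) z)%E)//.
  exact: integrableZl kmin_integrable.
Qed.

Lemma fracL_bound C f x : tame C f -> `|fracL f x| <= 2 * C * kmass.
Proof.
move=> ft; rewrite /fracL normrM normfV (gtr0_norm (ltr0n _ 2)) ler_pdivrMr//.
apply: le_trans (le_normr_Rintegral _ (sdiff_integrable x ft)) _ => //.
rewrite -mulrA (mulrC _ 2) !mulrA -[2 * 2]/(2%:R * 2%:R) -natrM.
rewrite -RintegralZl//; last exact: kmin_integrable.
apply: le_Rintegral => //.
- exact: integrable_norm (sdiff_integrable x ft).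
- rewrite (_ : EFin \o _ = fun z => ((4 * C)%:E * (EFin \o kmin) z)%E)//.
  exact: integrableZl kmin_integrable.
- by move=> z _; exact: sdiff_ker_le.
Qed.

(** Interpolating between the two bounds |z|^2 and |x - y| for the variation of
    second differences keeps the integrability of |z|^{1+s} near the origin. *)
Lemma fracL_holder C f x y : tame C f ->
  `|fracL f x - fracL f y| <= 4 * C * kmass * enorm (x - y) `^ ((1 - s) / 2).
Proof.
move=> ft; have C0 := tame_ge0 ft.
set a : R := (1 - s) / 2; have a01 : 0 < a < 1 by rewrite /a; move: hs; lra.
have ia := sdiff_integrable x ft; have ib := sdiff_integrable y ft.
rewrite /fracL -mulrBl -RintegralB// normrM normfV (gtr0_norm (ltr0n _ 2)).
rewrite ler_pdivrMr//.
have iab := integrableB measurableT ia ib.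
apply: le_trans (le_normr_Rintegral _ iab) _ => //.
set K : R := 8 * C * enorm (x - y) `^ a.
rewrite (_ : _ * _ * _ * 2 = K * kmass); last by rewrite /K; ring.
rewrite -RintegralZl//; last exact: kmin_integrable.
apply: le_Rintegral => //.
- exact: integrable_norm iab.
- rewrite (_ : EFin \o _ = fun z => (K%:E * (EFin \o kmin) z)%E)//.
  exact: integrableZl kmin_integrable.
move=> z _; rewrite -mulrBl normrM (ger0_norm (ker_ge0 _ _)) /kmin mulrA.
rewrite ler_wpM2r ?ker_ge0//.
case: (ft) => fC fL f2.
set D : R := enorm (x - y); have D0 : 0 <= D := enorm_ge0 _.
set m : R := Num.min 1 (enorm z ^+ 2).
have m0 : 0 <= m by rewrite /m le_min ler01 sqr_ge0.
have H1 : `|sdiff f x z - sdiff f y z| <= 8 * C * D.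
  have := fL x y; have := fL (x + z) (y + z); have := fL (x - z) (y - z).
  rewrite (_ : x + z - (y + z) = x - y); last by rewrite opprD addrACA subrr addr0.
  rewrite (_ : x - z - (y - z) = x - y); last by rewrite opprB addrA subrK.
  rewrite -/D /sdiff !ler_norml => /andP[? ?] /andP[? ?] /andP[? ?].
  by have := mulr_ge0 C0 D0; move=> ?; apply/andP; split; lra.
have Hm u : `|sdiff f u z| <= 4 * C * m.
  rewrite minr_pMr ?mulr_ge0// mulr1 le_min; apply/andP; split.
    have := fC u; have := fC (u + z); have := fC (u - z).
    by rewrite /sdiff !ler_norml => /andP[? ?] /andP[? ?] /andP[? ?]; apply/andP; split; lra.
  apply: le_trans (f2 _ _) _; rewrite ler_wpM2r ?sqr_ge0//; lra.
have H2 : `|sdiff f x z - sdiff f y z| <= 8 * C * m.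
  by apply: le_trans (ler_normB _ _) _; have := Hm x; have := Hm y; lra.
have K0 : 0 <= 8 * C by rewrite mulr_ge0.
have := le_powR_interp a01 K0 D0 m0 (normr_ge0 _) H1 H2.
move=> /le_trans; apply.
rewrite /K mulrA ler_wpM2l ?mulr_ge0 ?powR_ge0//.
have z0 := enorm_ge0 z.
have -> : 1 - a = (1 + s) / 2 by rewrite /a; lra.
have s0 : 0 <= (1 + s) / 2 by move: hs; lra.
rewrite le_min; apply/andP; split.
  rewrite [leRHS](_ : 1 = 1 `^ ((1 + s) / 2)); last by rewrite powR1.
  by apply: ge0_ler_powR; rewrite ?nnegrE// /m ge_min lexx.
rewrite [leRHS](_ : _ = (enorm z ^+ 2) `^ ((1 + s) / 2)); last first.
  by rewrite -powR_mulrn// -powRrM; congr (_ `^ _); lra.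
by apply: ge0_ler_powR; rewrite ?nnegrE ?sqr_ge0// /m ge_min lexx orbT.
Qed.

End second_difference.

(** * Agreement with the principal value *)

Section principal_value.
Context {R : realType} {N : nat}.
Local Notation leb := (@lebesgue_rV R N).
Variable s : R.
Hypothesis hs : 0 < s < 1.
Implicit Types (C : R) (f g : 'rV[R]_N -> R) (x y z : 'rV[R]_N).

Let s0 : 0 < s. Proof. by case/andP: hs. Qed.
Let s1 : s < 1. Proof. by case/andP: hs. Qed.

Definition kfar (e : R) z : R := ker s z * (e < enorm z)%R%:R.

Lemma kfar_ge0 e z : 0 <= kfar e z.
Proof. by rewrite mulr_ge0 ?ker_ge0. Qed.

Lemma measurable_kfar e : measurable_fun setT (kfar e).
Proof.
apply: measurable_funM; first exact: measurable_ker.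
by apply: measurable_indic_bool; apply: measurable_ltr_set => //; exact: measurable_enorm.
Qed.

Lemma kfar_le e z : 0 < e < 1 -> kfar e z <= (e `^ (1 + s))^-1 * kmin s z.
Proof.
move=> /andP[e0 e1].
have p0 : 0 < e `^ (1 + s) by rewrite powR_gt0.
rewrite /kfar /kmin mulrA; case: ltP => [ez|_]; last first.
  by rewrite mulr0 !mulr_ge0 ?ker_ge0 ?invr_ge0 ?(ltW p0)// le_min ler01 powR_ge0.
rewrite mulr1 ler_peMl ?ker_ge0// mulrC ler_pdivlMr// mul1r le_min.
have es : 0 <= 1 + s by rewrite addr_ge0// ltW.
apply/andP; split.
  rewrite [leRHS](_ : 1 = 1 `^ (1 + s)); last by rewrite powR1.
  by apply: ge0_ler_powR; rewrite ?nnegrE ?(ltW e0) ?(ltW e1).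
by apply: ge0_ler_powR; rewrite ?nnegrE ?(ltW e0) ?(ltW ez) ?enorm_ge0.
Qed.

Lemma kfar_integrable e : 0 < e < 1 -> leb.-integrable setT (EFin \o kfar e).
Proof.
move=> e01.
apply: (le_integrable measurableT
  (g := EFin \o (fun z => (e `^ (1 + s))^-1 * kmin s z))).
- by apply/measurable_EFinP; exact: measurable_kfar.
- move=> z _ /=; rewrite lee_fin ger0_norm ?kfar_ge0//.
  by rewrite (le_trans (kfar_le _ e01))// ler_norm.
- rewrite (_ : EFin \o _ =
    fun z => (((e `^ (1 + s))^-1)%:E * (EFin \o kmin s) z)%E)//.
  by apply: integrableZl => //; exact: kmin_integrable.
Qed.

(** Averaging the truncated integral with its reflection about x produces the
    second difference. *)
Lemma frac_lap_truncE C f x e : tame C f -> 0 < e < 1 ->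
  frac_lap_trunc s f x e = (\int[leb]_z (sdiff f x z * kfar e z)) / 2.
Proof.
move=> ft e01; have C0 := tame_ge0 ft.
have half (a : R) : a = (a + a) / 2 by lra.
pose h y : R := (f x - f y) * kfar e (x - y).
have mf := tame_measurable ft.
have ih : leb.-integrable setT (EFin \o h).
  apply: (le_integrable measurableT
    (g := EFin \o (fun y => 2 * C * kfar e (-1 *: y + x)))).
  - apply/measurable_EFinP/measurable_funM; first exact: measurable_funB.
    by apply: (measurableT_comp (measurable_kfar e)); exact: measurable_rVB.
  - move=> y _ /=; rewrite lee_fin scaleN1r (addrC (- y)) !normrM.
    rewrite ler_wpM2r//; case: ft => fC _ _; have := fC x; have := fC y.
    rewrite (ger0_norm C0) normr_nat.
    by rewrite !ler_norml => /andP[? ?] /andP[? ?]; apply/andP; split; lra.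
  - rewrite (_ : EFin \o _ =
      fun y => ((2 * C)%:E * (EFin \o (fun y => kfar e (-1 *: y + x)%R)) y)%E)//.
    apply: integrableZl => //; apply: integrable_affine.
      by rewrite oppr_eq0 oner_eq0.
    exact: kfar_integrable.
have -> : frac_lap_trunc s f x e = \int[leb]_y h y.
  rewrite /frac_lap_trunc Rintegral_mkcond; apply: eq_Rintegral => y _.
  rewrite /patch /h /kfar /ker; case: ifPn => [|].
    by rewrite inE/= => ->; rewrite mulr1.
  by rewrite notin_setE/= => /negP/negbTE ->; rewrite !mulr0.
have n1 : (-1 : R) != 0 by rewrite oppr_eq0 oner_eq0.
have i1 := integrable_affine x (oner_neq0 R) ih.
have i2 := integrable_affine x n1 ih.
have H1 := Rintegral_affine x (oner_neq0 R) ih.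
have H2 := Rintegral_affine x n1 ih.
rewrite normr1 expr1n invr1 mul1r in H1.
rewrite normrN1 expr1n invr1 mul1r in H2.
transitivity ((\int[leb]_z h (1 *: z + x) + \int[leb]_z h (-1 *: z + x)) / 2).
  by rewrite H1 H2; exact: half.
rewrite -(RintegralD measurableT i1 i2); congr (_ / 2); apply: eq_Rintegral => z _; rewrite /h scaleN1r scale1r.
rewrite opprD addrCA subrr addr0 opprD opprK addrCA subrr addr0.
rewrite /kfar kerN enormN /sdiff (addrC z x) (addrC (- z) x); ring.
Qed.

Lemma frac_lap_trunc_dist C f x e : tame C f -> 0 < e < 1 ->
  `|fracL s f x - frac_lap_trunc s f x e| <= C * kmass (N := N) s * e `^ (1 - s).
Proof.
move=> ft e01; have /andP[e0 e1] := e01; have C0 := tame_ge0 ft.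
rewrite (frac_lap_truncE x ft e01) /fracL -mulrBl.
have ia := sdiff_integrable hs x ft.
have mf := tame_measurable ft.
have ib : leb.-integrable setT (EFin \o (fun z => sdiff f x z * kfar e z)).
  apply: (le_integrable measurableT _ _ ia).
    apply/measurable_EFinP/measurable_funM; last exact: measurable_kfar.
    exact: measurable_sdiff.
  move=> z _ /=; rewrite lee_fin /kfar !normrM ler_wpM2l//.
  by rewrite ler_piMr//; case: ltP => _; rewrite ?normr0 ?normr1.
rewrite -RintegralB// normrM normfV (gtr0_norm (ltr0n _ 2)) ler_pdivrMr//.
have iab := integrableB measurableT ia ib.
apply: le_trans (le_normr_Rintegral _ iab) _ => //.
have K0 : 0 <= C * e `^ (1 - s) by rewrite mulr_ge0 ?powR_ge0.
apply: (@le_trans _ _ (\int[leb]_z (C * e `^ (1 - s) * kmin s z))); last first.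
  rewrite RintegralZl//; last exact: kmin_integrable.
  rewrite mulrAC [leRHS]mulrC ler_peMl// ?ler1n//.
  by rewrite !mulr_ge0 ?powR_ge0 ?kmass_ge0.
apply: le_Rintegral => //.
- exact: integrable_norm iab.
- rewrite (_ : EFin \o _ =
    fun z => ((C * e `^ (1 - s))%:E * (EFin \o kmin s) z)%E)//.
  by apply: integrableZl => //; exact: kmin_integrable.
move=> z _; rewrite -mulrBr normrM /kfar.
case: ltP => [ez|ze].
  by rewrite mulr1 subrr normr0 mulr0 mulr_ge0 ?kmin_ge0.
rewrite mulr0 subr0 (ger0_norm (ker_ge0 _ _)) /kmin mulrA.
rewrite ler_wpM2r ?ker_ge0//.
case: ft => _ _ f2; apply: le_trans (f2 x z) _.
rewrite -mulrA ler_wpM2l//.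
have z0 := enorm_ge0 z.
rewrite min_r; last first.
  rewrite [leRHS](_ : 1 = 1 `^ (1 + s)); last by rewrite powR1.
  apply: ge0_ler_powR; rewrite ?nnegrE//; first by rewrite addr_ge0// ltW.
  by rewrite (le_trans ze)// ltW.
have -> : enorm z ^+ 2 = enorm z `^ (1 - s) * enorm z `^ (1 + s).
  have [->|zn0] := eqVneq (enorm z) 0.
    by rewrite expr0n/= [X in _ * X]powR0 ?mulr0// gt_eqF// addr_gt0.
  by rewrite -powRD ?zn0 ?implybT// -powR_mulrn//; congr (_ `^ _); ring.
rewrite ler_wpM2r ?powR_ge0//.
by apply: ge0_ler_powR; rewrite ?nnegrE ?subr_ge0// ltW.
Qed.

Lemma frac_lap_trunc_cvg C f x : tame C f ->
  frac_lap_trunc s f x e @[e --> 0^'+] --> fracL s f x.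
Proof.
move=> ft; apply/cvgrPdist_le => eps eps0.
have : (fun e : R => C * kmass (N := N) s * e `^ (1 - s)) @ 0^'+ --> (0 : R).
  rewrite -[X in _ --> X](mulr0 (C * kmass (N := N) s)).
  by apply: cvgMr; apply: powR_cvg0; rewrite subr_gt0.
move/cvgrPdist_le => /(_ _ eps0) H.
near=> e.
have e01 : 0 < e < 1.
  by apply/andP; split; near: e; [exact: nbhs_right_gt|exact: nbhs_right_lt].
apply: le_trans (frac_lap_trunc_dist x ft e01) _.
have : `|0 - C * kmass (N := N) s * e `^ (1 - s)| <= eps by near: e.
by rewrite sub0r normrN => /(le_trans (ler_norm _)).
Unshelve. all: by end_near. Qed.

Lemma tame_has_frac_lap C f x : tame C f -> has_frac_lap s f x.
Proof. by move=> /frac_lap_trunc_cvg H; apply/cvg_ex; exists (fracL s f x); exact: H. Qed.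

Lemma tame_frac_lapE C f x : tame C f ->
  frac_lap s f x = frac_lap_const (N := N) s * fracL s f x.
Proof.
by move=> ft; rewrite /frac_lap (cvg_lim _ (frac_lap_trunc_cvg ft)).
Qed.

Lemma tame_affine C f (a : R) x0 : 0 < a -> tame C f ->
  tame (C * (1 + a + a ^+ 2)) (fun x => f (a *: (x - x0))).
Proof.
move=> a0 ft; have C0 := tame_ge0 ft; case: ft => fC fL f2.
have a20 := sqr_ge0 a.
split=> [x|x y|x z].
- by rewrite (le_trans (fC _))// ler_peMr//; lra.
- rewrite (le_trans (fL _ _))// -scalerBr opprB addrA subrK enormZ gtr0_norm//.
  rewrite mulrA ler_wpM2r ?enorm_ge0// ler_wpM2l//; lra.
- rewrite /sdiff.
  rewrite (_ : a *: (x + z - x0) = a *: (x - x0) + a *: z); last first.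
    by rewrite -scalerDr addrAC.
  rewrite (_ : a *: (x - z - x0) = a *: (x - x0) - a *: z); last first.
    by rewrite -scalerBr addrAC.
  rewrite (le_trans (f2 _ _))// enormZ gtr0_norm// exprMn mulrA.
  rewrite ler_wpM2r ?sqr_ge0// ler_wpM2l//; lra.
Qed.

Lemma fracL_affine C f (a : R) x0 x : 0 < a -> tame C f ->
  fracL s (fun x => f (a *: (x - x0))) x = a `^ (2 * s) * fracL s f (a *: (x - x0)).
Proof.
move=> a0 ft; have i := sdiff_integrable hs (a *: (x - x0)) ft.
have an0 : a != 0 by rewrite gt_eqF.
have ai : a^-1 != 0 by rewrite invr_eq0.
rewrite /fracL mulrA; congr (_ / 2).
have i' := integrable_affine 0 an0 i.
have := Rintegral_affine 0 an0 i; rewrite gtr0_norm// => H.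
have aN : a ^+ N != 0 by rewrite expf_neq0.
have -> : \int[leb]_z (sdiff f (a *: (x - x0)) z * ker s z) =
   a ^+ N * \int[leb]_z (sdiff f (a *: (x - x0)) (a *: z + 0) * ker s (a *: z + 0)).
  by rewrite H; set I := Rintegral _ _ _; rewrite mulrA mulfV// mul1r.
rewrite mulrA -RintegralZl//.
apply: eq_Rintegral => z _; rewrite addr0 kerZ// gtr0_norm//.
have -> : sdiff (fun x => f (a *: (x - x0))) x z =
    sdiff f (a *: (x - x0)) (a *: z).
  rewrite /sdiff (addrAC x z) (addrAC x (- z)).
  by rewrite (scalerDr a (x - x0) z) (scalerBr a (x - x0) z).
set w := sdiff _ _ _; set k := ker _ _.
have e : a `^ (2 * s) * a ^+ N * a `^ (- (N%:R + 2 * s)) = 1.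
  rewrite -powR_mulrn ?ltW// -!powRD ?an0 ?implybT//.
  by rewrite (_ : _ + _ + _ = 0) ?powRr0//; ring.
transitivity (a `^ (2 * s) * a ^+ N * a `^ (- (N%:R + 2 * s)) * (w * k)).
  by rewrite e mul1r.
by ring.
Qed.

End principal_value.

(** * Order properties and cut-off functions *)

Section fracL_order.
Context {R : realType} {N : nat}.
Local Notation leb := (@lebesgue_rV R N).
Variable s : R.
Hypothesis hs : 0 < s < 1.
Implicit Types (C : R) (f g : 'rV[R]_N -> R) (x y z : 'rV[R]_N).

(** Stated with second differences because these are what a point of contact of
    two functions compares. *)
Lemma fracL_le C C' f g x : tame C f -> tame C' g ->
  (forall z, sdiff f x z <= sdiff g x z) -> fracL s f x <= fracL s g x.
Proof.
move=> ft gt fg; rewrite /fracL ler_pM2r ?invr_gt0//.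
apply: le_Rintegral => //; [exact: (sdiff_integrable hs x ft)|
  exact: (sdiff_integrable hs x gt)|].
by move=> z _; rewrite ler_wpM2r ?ker_ge0.
Qed.

Lemma tameZ C f (a : R) : 0 <= a -> tame C f -> tame (a * C) (fun x => a * f x).
Proof.
move=> a0 [fC fL f2]; split=> [x|x y|x z].
- by rewrite normrM ger0_norm// ler_wpM2l.
- by rewrite -mulrBr normrM ger0_norm// -mulrA ler_wpM2l.
- rewrite (_ : sdiff _ _ _ = a * sdiff f x z); last by rewrite /sdiff; ring.
  by rewrite normrM ger0_norm// -mulrA ler_wpM2l.
Qed.

Lemma tameD C C' f g : tame C f -> tame C' g ->
  tame (C + C') (fun x => f x + g x).
Proof.
move=> [fC fL f2] [gC gL g2]; split=> [x|x y|x z].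
- by rewrite (le_trans (ler_normD _ _))// lerD.
- rewrite (_ : _ - _ = (f x - f y) + (g x - g y)); last by ring.
  by rewrite (le_trans (ler_normD _ _))// mulrDl lerD.
- rewrite (_ : sdiff _ _ _ = sdiff f x z + sdiff g x z); last by rewrite /sdiff; ring.
  by rewrite (le_trans (ler_normD _ _))// mulrDl lerD.
Qed.

Lemma tame0 : tame 0 (fun _ : 'rV[R]_N => 0).
Proof.
by split=> *; rewrite ?subrr ?normr0 ?mul0r// /sdiff mulr0 !subr0 normr0.
Qed.

Lemma fracLZ C f (a : R) x : tame C f ->
  fracL s (fun x => a * f x) x = a * fracL s f x.
Proof.
move=> ft; rewrite /fracL mulrA -RintegralZl//; last exact: (sdiff_integrable hs x ft).
by congr (_ / 2); apply: eq_Rintegral => z _; rewrite /sdiff; ring.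
Qed.

Lemma fracLD C C' f g x : tame C f -> tame C' g ->
  fracL s (fun x => f x + g x) x = fracL s f x + fracL s g x.
Proof.
move=> ft gt; rewrite /fracL -mulrDl.
rewrite -(RintegralD measurableT (sdiff_integrable hs x ft) (sdiff_integrable hs x gt)).
by congr (_ / 2); apply: eq_Rintegral => z _; rewrite /sdiff; ring.
Qed.

Lemma fracL0 x : fracL s (fun _ : 'rV[R]_N => 0) x = 0.
Proof.
rewrite /fracL; apply/eqP; rewrite mulf_eq0; apply/orP; left; apply/eqP.
rewrite (_ : Rintegral _ _ _ = \int[leb]_z (0 : R)).
  by rewrite /Rintegral integral0.
by apply: eq_Rintegral => z _; rewrite /sdiff mulr0 !subr0 mul0r.
Qed.

(** At a zero of a nonnegative function the fractional Laplacian sees the whole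
    mass of the function: this is where nonlocality enters. *)
Lemma fracL_far C f x (D : R) : 0 < D -> tame C f -> (forall y, 0 <= f y) ->
  leb.-integrable setT (EFin \o f) -> f x = 0 ->
  (forall y, f y != 0 -> enorm (y - x) <= D) ->
  fracL s f x <= - (D `^ (- (N%:R + 2 * s)) * \int[leb]_y f y).
Proof.
move=> D0 ft f0 fi fx fD; set K := D `^ _.
have K0 : 0 <= K by rewrite powR_ge0.
have n1 : (-1 : R) != 0 by rewrite oppr_eq0 oner_eq0.
have i1 := integrable_affine x (oner_neq0 R) fi.
have i2 := integrable_affine x n1 fi.
have H1 := Rintegral_affine x (oner_neq0 R) fi.
have H2 := Rintegral_affine x n1 fi.
rewrite normr1 expr1n invr1 mul1r in H1.
rewrite normrN1 expr1n invr1 mul1r in H2.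
have i12 : leb.-integrable setT
    (EFin \o (fun z => f (1 *: z + x) + f (-1 *: z + x))).
  by apply: (integrableD measurableT i1 i2).
have i3 : leb.-integrable setT
    (EFin \o (fun z => - K * (f (1 *: z + x) + f (-1 *: z + x)))).
  exact: (integrableZl measurableT (- K) i12).
rewrite /fracL ler_pdivrMr//.
rewrite (_ : - (K * _) * 2 =
    \int[leb]_z (- K * (f (1 *: z + x) + f (-1 *: z + x)))); last first.
  rewrite (RintegralZl (- K) measurableT i12) (RintegralD measurableT i1 i2) H1 H2.
  by set I := Rintegral _ _ _; ring.
apply: le_Rintegral => //; first exact: (sdiff_integrable hs x ft).
move=> z _; rewrite /sdiff fx mulr0 sub0r scale1r scaleN1r (addrC z) (addrC (- z)).
rewrite -opprD !mulNr lerN2 mulrDr mulrDl !(mulrC K).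
have step w : (w = z \/ w = - z) -> f (x + w) * K <= f (x + w) * ker s z.
  move=> wz; have [->|fn0] := eqVneq (f (x + w)) 0; first by rewrite !mul0r.
  have wzn : enorm w = enorm z by case: wz => ->; rewrite ?enormN.
  rewrite ler_wpM2l//; apply: ker_ge => //.
    apply: contraNneq fn0 => z0.
    have -> : w = 0 by apply: enorm_eq0; rewrite wzn z0 enorm0.
    by rewrite addr0 fx.
  by rewrite -wzn; have := fD _ fn0; rewrite addrC addKr.
by apply: lerD; apply: step; [left|right].
Qed.

End fracL_order.

Section ebump.
Context {R : realType}.

(** The profile of all cut-offs below: ((1 - q)_+)^2, applied to q = |x|^2. *)
Definition cutoff (q : R) : R := (Num.max 0 (1 - q)) ^+ 2.

Lemma cutoff_ge0 q : 0 <= cutoff q.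
Proof. exact: sqr_ge0. Qed.

Lemma cutoff_eq0 q : 1 <= q -> cutoff q = 0.
Proof. by move=> q1; rewrite /cutoff max_l ?expr0n// subr_le0. Qed.

Lemma cutoff_gt0 q : q < 1 -> 0 < cutoff q.
Proof. by move=> q1; rewrite /cutoff exprn_gt0// lt_max subr_gt0 q1 orbT. Qed.

Lemma cutoff_le1 q : 0 <= q -> cutoff q <= 1.
Proof.
move=> q0; rewrite /cutoff.
have m0 : 0 <= Num.max 0 (1 - q) by rewrite le_max lexx.
have m1 : Num.max 0 (1 - q) <= 1 by rewrite ge_max ler01/= gerBl.
by rewrite expr_le1.
Qed.

(** The profile is C^{1,1}: its derivative -2 (1 - q)_+ is Lipschitz. *)
Lemma cutoff_taylor a b :
  `|cutoff a - cutoff b + 2 * Num.max 0 (1 - b) * (a - b)| <= (a - b) ^+ 2.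
Proof.
rewrite /cutoff (_ : a - b = (1 - b) - (1 - a)); last by ring.
move: (1 - a) (1 - b) => u v.
have := sqr_ge0 u; have := sqr_ge0 v; have := sqr_ge0 (v - u).
have [u0|u0] := leP 0 u; have [v0|v0] := leP 0 v => h1 h2 h3.
- have -> : u ^+ 2 - v ^+ 2 + 2 * v * (v - u) = (v - u) ^+ 2 by ring.
  by rewrite ger0_norm.
- rewrite expr0n/= subr0 mulr0 mul0r addr0 ger0_norm//; nra.
- rewrite expr0n/= sub0r.
  have -> : - v ^+ 2 + 2 * v * (v - u) = v * (v - 2 * u) by ring.
  have H : 0 <= v * (v - 2 * u) by apply: mulr_ge0 => //; lra.
  rewrite ger0_norm//; nra.
- by rewrite !expr0n/= subrr mulr0 mul0r addr0 normr0.
Qed.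

Definition bump1 (t : R) : R := cutoff (t ^+ 2).
Definition dbump1 (t : R) : R := - 4 * t * Num.max 0 (1 - t ^+ 2).

Lemma bump1_ge0 t : 0 <= bump1 t. Proof. exact: cutoff_ge0. Qed.

Lemma bump1_le1 t : bump1 t <= 1.
Proof. by rewrite cutoff_le1// sqr_ge0. Qed.

Lemma sqr_gt1 (t : R) : 1 <= `|t| -> 1 <= t ^+ 2.
Proof. by move=> t1; rewrite -real_normK ?num_real// exprn_ege1. Qed.

Lemma bump1_eq0 t : 1 <= `|t| -> bump1 t = 0.
Proof. by move=> /sqr_gt1; exact: cutoff_eq0. Qed.

Lemma dbump1_eq0 t : 1 <= `|t| -> dbump1 t = 0.
Proof. by move=> /sqr_gt1 t1; rewrite /dbump1 max_l ?mulr0// subr_le0. Qed.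

Lemma dbump1_bound t : `|dbump1 t| <= 4.
Proof.
have [t1|t1] := leP 1 `|t|; first by rewrite dbump1_eq0// normr0.
have t2 : t ^+ 2 < 1.
  by rewrite -real_normK ?num_real// expr_lt1.
rewrite /dbump1 max_r ?subr_ge0 ?(ltW t2)// !normrM normrN normr_nat.
rewrite (ger0_norm (x := 1 - _)) ?subr_ge0 ?(ltW t2)//.
have t0 := normr_ge0 t; have t3 := sqr_ge0 t.
have h : `|t| * (1 - t ^+ 2) <= 1.
  by apply: mulr_ile1; rewrite ?subr_ge0 ?gerBl ?(ltW t1) ?(ltW t2).
by have := ler_wpM2l (ler0n R 4) h; rewrite mulr1 mulrA.
Qed.

(** For |t| >= 2 or |k| >= 1 crude bounds do; otherwise the increment of t^2 is at
    most 5 |k|, and cutoff_taylor applies. *)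
Lemma bump1_taylor t k :
  `|bump1 (t + k) - bump1 t - k * dbump1 t| <= 30 * k ^+ 2.
Proof.
have [k1|k1] := leP 1 `|k|.
  have kk : `|k| <= k ^+ 2.
    by rewrite -real_normK ?num_real// expr2 ler_peMl.
  have k2 := sqr_gt1 k1.
  have H1 : `|bump1 (t + k) - bump1 t| <= 1.
    have := bump1_ge0 t; have := bump1_le1 t; have := bump1_ge0 (t + k).
    by have := bump1_le1 (t + k); rewrite ler_norml => *; apply/andP; split; lra.
  have H2 : `|k * dbump1 t| <= 4 * k ^+ 2.
    by rewrite normrM mulrC ler_pM// dbump1_bound.
  by apply: le_trans (ler_normB _ _) _; lra.
have [t2|t2] := leP 2 `|t|.
  have tk : 1 <= `|t + k|.
    have := ler_normB (t + k) k; rewrite addrK; lra.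
  rewrite !bump1_eq0 ?dbump1_eq0//; [|lra..].
  by rewrite mulr0 !subr0 normr0 mulr_ge0 ?sqr_ge0.
have := cutoff_taylor ((t + k) ^+ 2) (t ^+ 2).
rewrite -/(bump1 _) -/(bump1 t) /dbump1; set P := Num.max _ _ => H.
have P0 : 0 <= P by rewrite /P le_max lexx.
have P1 : P <= 1 by rewrite /P ge_max ler01/=; have := sqr_ge0 t; lra.
have -> : bump1 (t + k) - bump1 t - k * (- 4 * t * P) =
  (bump1 (t + k) - bump1 t + 2 * P * ((t + k) ^+ 2 - t ^+ 2)) - 2 * P * k ^+ 2.
  by ring.
apply: le_trans (ler_normB _ _) _.
have e : `|2 * P * k ^+ 2| <= 2 * k ^+ 2.
  rewrite ger0_norm; last first.
    by apply: mulr_ge0; [apply: mulr_ge0|exact: sqr_ge0].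
  by apply: ler_wpM2r; [exact: sqr_ge0|lra].
have e2 : ((t + k) ^+ 2 - t ^+ 2) ^+ 2 <= 25 * k ^+ 2.
  have -> : (t + k) ^+ 2 - t ^+ 2 = (2 * t + k) * k by ring.
  rewrite exprMn; apply: ler_wpM2r; first exact: sqr_ge0.
  have -> : 25 = 5 ^+ 2 :> R by ring.
  rewrite -[leLHS]real_normK ?num_real// ler_sqr ?nnegrE//.
  apply: le_trans (ler_normD _ _) _; rewrite normrM normr_nat; lra.
have := sqr_ge0 k; lra.
Qed.

Lemma dbump1_lip t t' : `|dbump1 t - dbump1 t'| <= 60 * `|t - t'|.
Proof.
have [->|tt] := eqVneq t t'; first by rewrite !subrr normr0 mulr0.
have k0 : 0 < `|t - t'| by rewrite normr_gt0 subr_eq0.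
have := bump1_taylor t' (t - t'); have := bump1_taylor t (t' - t).
rewrite !(addrC _ (_ - _)) !subrK => h1 h2.
rewrite -(ler_pM2r k0) -normrM.
rewrite (_ : (dbump1 t - dbump1 t') * (t - t') =
  (bump1 t' - bump1 t - (t' - t) * dbump1 t) + (bump1 t - bump1 t' - (t - t') * dbump1 t')); last by ring.
apply: le_trans (ler_normD _ _) _.
rewrite -mulrA -expr2 real_normK ?num_real//.
have -> : (t - t') ^+ 2 = (t' - t) ^+ 2 by ring.
move: h1 h2; have -> : (t - t') ^+ 2 = (t' - t) ^+ 2 by ring.
lra.
Qed.

Lemma bump1_lip t t' : `|bump1 t - bump1 t'| <= 64 * `|t - t'|.
Proof.
have [k1|k1] := leP 1 `|t - t'|.
  have := bump1_ge0 t; have := bump1_le1 t; have := bump1_ge0 t'.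
  by have := bump1_le1 t'; rewrite ler_norml => *; apply/andP; split; lra.
have := bump1_taylor t' (t - t'); rewrite (addrC t') subrK => h.
have h2 : `|(t - t') * dbump1 t'| <= 4 * `|t - t'|.
  by rewrite normrM mulrC ler_wpM2r// dbump1_bound.
have h3 : (t - t') ^+ 2 <= `|t - t'|.
  by rewrite -real_normK ?num_real// expr2 ler_piMl// ltW.
rewrite (_ : bump1 t - bump1 t' =
  (bump1 t - bump1 t' - (t - t') * dbump1 t') + (t - t') * dbump1 t'); last by ring.
apply: le_trans (ler_normD _ _) _; have := normr_ge0 (t - t'); lra.
Qed.

Context {N : nat}.

Definition ebump (x : 'rV[R]_N) : R := cutoff (enorm x ^+ 2).

Lemma ebump_ge0 x : 0 <= ebump x. Proof. exact: cutoff_ge0. Qed.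

Lemma ebump_le1 x : ebump x <= 1.
Proof. by rewrite cutoff_le1// sqr_ge0. Qed.

Lemma ebump_eq0 x : 1 <= enorm x -> ebump x = 0.
Proof. by move=> x1; rewrite /ebump cutoff_eq0// exprn_ege1. Qed.

Lemma ebump_gt0 x : enorm x < 1 -> 0 < ebump x.
Proof. by move=> x1; rewrite cutoff_gt0// expr_lt1 ?enorm_ge0. Qed.

Lemma ebump_ge_half x : enorm x <= 1 / 2 -> 1 / 2 <= ebump x.
Proof.
move=> x1; have x0 := enorm_ge0 x.
have x2 : enorm x ^+ 2 <= 1 / 4 by nra.
by rewrite /ebump /cutoff max_r; nra.
Qed.

Lemma ebump0 : ebump 0 = 1.
Proof.
by rewrite /ebump enorm0 expr0n/= /cutoff subr0 max_r ?expr1n// ler01.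
Qed.

Lemma cutoff_sqr_lip (a b d : R) : 0 <= a -> 0 <= b -> a <= b + d -> b <= a + d ->
  cutoff (a ^+ 2) - cutoff (b ^+ 2) <= 4 * d.
Proof.
move=> a0 b0 ab ba; have d0 : 0 <= d by lra.
have [a1|a1] := leP 1 a.
  rewrite (cutoff_eq0 (q := a ^+ 2)) ?exprn_ege1//.
  by have := cutoff_ge0 (b ^+ 2); lra.
have a2 : a ^+ 2 <= 1 by rewrite expr_le1// ltW.
have -> : cutoff (a ^+ 2) = (1 - a ^+ 2) ^+ 2.
  by rewrite /cutoff max_r// subr_ge0.
have [b1|b1] := leP 1 b.
  rewrite (cutoff_eq0 (q := b ^+ 2)) ?exprn_ege1// subr0.
  have h : (1 - a ^+ 2) ^+ 2 <= 1 - a ^+ 2.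
    by rewrite expr2 ler_piMl ?subr_ge0//; have := sqr_ge0 a; lra.
  have h' : 1 - a ^+ 2 <= 2 * (1 - a) by nra.
  lra.
have b2 : b ^+ 2 <= 1 by rewrite expr_le1// ltW.
have -> : cutoff (b ^+ 2) = (1 - b ^+ 2) ^+ 2.
  by rewrite /cutoff max_r// subr_ge0.
have -> : (1 - a ^+ 2) ^+ 2 - (1 - b ^+ 2) ^+ 2 =
  (b - a) * ((a + b) * (2 - a ^+ 2 - b ^+ 2)) by ring.
have h0 : 0 <= (a + b) * (2 - a ^+ 2 - b ^+ 2) by apply: mulr_ge0; lra.
have h4 : (a + b) * (2 - a ^+ 2 - b ^+ 2) <= 4.
  rewrite (_ : 4 = 2 * 2); last by ring.
  by apply: ler_pM; have := sqr_ge0 a; have := sqr_ge0 b; lra.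
apply: (@le_trans _ _ (d * ((a + b) * (2 - a ^+ 2 - b ^+ 2)))).
  by apply: ler_wpM2r => //; lra.
by rewrite mulrC; apply: ler_wpM2r.
Qed.

Lemma ebump_lip x y : `|ebump x - ebump y| <= 4 * enorm (x - y).
Proof.
have h1 : enorm x <= enorm y + enorm (x - y).
  by have := enormD y (x - y); rewrite addrC subrK.
have h2 : enorm y <= enorm x + enorm (x - y).
  by have := enormD x (y - x); rewrite addrC subrK enormB.
rewrite ler_norml; apply/andP; split.
  by rewrite lerNl opprB; apply: cutoff_sqr_lip => //; exact: enorm_ge0.
by apply: cutoff_sqr_lip => //; exact: enorm_ge0.
Qed.

(** The increments of |x|^2 in the directions z and -z are
    |z|^2 + 2 x.z and |z|^2 - 2 x.z: in the sum of the two Taylor expansions of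
    the profile the terms of first order in z cancel. *)
Lemma ebump_sdiff x z : `|sdiff ebump x z| <= 40 * enorm z ^+ 2.
Proof.
have v0 y := ebump_ge0 y; have v1 y := ebump_le1 y.
have z0 := enorm_ge0 z; have x0 := enorm_ge0 x.
have [z1|z1] := leP 1 (enorm z).
  have z2 : 1 <= enorm z ^+ 2 by rewrite exprn_ege1.
  have := v0 x; have := v0 (x + z); have := v0 (x - z).
  have := v1 x; have := v1 (x + z); have := v1 (x - z).
  by rewrite /sdiff ler_norml => *; apply/andP; split; lra.
have [x2|x2] := leP 2 (enorm x).
  have h1 : 1 <= enorm (x + z).
    by have := enormD (x + z) (- z); rewrite addrK enormN; lra.
  have h2 : 1 <= enorm (x - z).
    by have := enormD (x - z) z; rewrite subrK; lra.
  rewrite /sdiff !ebump_eq0//; last by lra.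
  by rewrite mulr0 !subr0 normr0 mulr_ge0 ?sqr_ge0.
have Ep : enorm (x + z) ^+ 2 - enorm x ^+ 2 = enorm z ^+ 2 + 2 * dot x z.
  by rewrite !enorm_sqr !(dotDl, dotDr) (dotC z x); ring.
have En : enorm (x - z) ^+ 2 - enorm x ^+ 2 = enorm z ^+ 2 - 2 * dot x z.
  by rewrite !enorm_sqr !(dotDl, dotDr, dotNl, dotNr) (dotC z x); ring.
have := cutoff_taylor (enorm (x + z) ^+ 2) (enorm x ^+ 2).
have := cutoff_taylor (enorm (x - z) ^+ 2) (enorm x ^+ 2).
rewrite Ep En -!/(ebump _) /sdiff; set P := Num.max _ _ => hn hp.
have P0 : 0 <= P by rewrite /P le_max lexx.
have P1 : P <= 1 by rewrite /P ge_max ler01/=; have := sqr_ge0 (enorm x); lra.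
have dxz : dot x z ^+ 2 <= 4 * enorm z ^+ 2.
  rewrite -[leLHS]real_normK ?num_real//.
  have := dot_le x z; have := normr_ge0 (dot x z); set w := `|_| => w0 wxz.
  apply: (@le_trans _ _ ((enorm x * enorm z) ^+ 2)).
    by rewrite ler_sqr ?nnegrE// mulr_ge0.
  rewrite exprMn ler_wpM2r ?sqr_ge0//.
  by rewrite (_ : 4 = 2 ^+ 2) ?ler_sqr ?nnegrE//; [exact: ltW|ring].
set Q := enorm z ^+ 2 in hn hp dxz *.
have Q0 : 0 <= Q by rewrite sqr_ge0.
have Q1 : Q <= 1 by rewrite /Q expr_le1// ltW.
rewrite (_ : 2 * ebump x - ebump (x + z) - ebump (x - z) =
  4 * P * Q - (ebump (x + z) - ebump x + 2 * P * (Q + 2 * dot x z))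
            - (ebump (x - z) - ebump x + 2 * P * (Q - 2 * dot x z))); last by ring.
apply: le_trans (ler_normB _ _) _.
have h4 : `|4 * P * Q| <= 4 * Q.
  rewrite ger0_norm; last first.
    by apply: mulr_ge0 => //; apply: mulr_ge0.
  by apply: ler_wpM2r => //; lra.
have h5 : `|4 * P * Q - (ebump (x + z) - ebump x + 2 * P * (Q + 2 * dot x z))| <=
   4 * Q + (Q + 2 * dot x z) ^+ 2.
  by apply: le_trans (ler_normB _ _) _; exact: lerD.
have QQ : Q ^+ 2 <= Q by rewrite expr2 ler_piMl.
apply: (@le_trans _ _ (4 * Q + (Q + 2 * dot x z) ^+ 2 + (Q - 2 * dot x z) ^+ 2)).
  exact: lerD.
rewrite (_ : _ + _ + _ = 4 * Q + 2 * Q ^+ 2 + 8 * dot x z ^+ 2); last by ring.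
lra.
Qed.

Lemma ebump_tame : tame 40 ebump.
Proof.
split=> [x|x y|x z].
- by rewrite ger0_norm ?ebump_ge0// (le_trans (ebump_le1 x))// ler1n.
- apply: le_trans (ebump_lip x y) _; rewrite ler_wpM2r ?enorm_ge0//.
  by rewrite ler_nat.
- exact: ebump_sdiff.
Qed.

Lemma scaled_bump_tame (l : R) : 0 < l ->
  tame (40 * (1 + l + l ^+ 2)) (fun x => ebump (l *: x)).
Proof.
move=> l0; have := tame_affine 0 l0 ebump_tame.
by under eq_fun do rewrite subr0.
Qed.

End ebump.

(** * The fractional Laplacian of a bump *)

Lemma integral_cst_indic d (T : measurableType d) (R : realType)
    (mu : {measure set T -> \bar R}) (c : R) (B : set T) :
  measurable B -> 0 <= c ->
  (\int[mu]_x (c%:E * (\1_B x)%:E) = c%:E * mu B)%E.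
Proof.
move=> mB c0; rewrite (ge0_integralZl mu measurableT).
- by rewrite integral_indic// setIT.
- exact/measurable_EFinP/measurable_indic.
- by move=> x _; rewrite lee_fin indicE.
- by rewrite lee_fin.
Qed.

Lemma holder_continuous (R : realType) (N : nat) (f : 'rV[R]_N -> R) (K al : R) :
  0 <= K -> 0 < al ->
  (forall x y, `|f x - f y| <= K * enorm (x - y) `^ al) -> continuous f.
Proof.
move=> K0 al0 fH x.
apply/(cvg_ballP (FF := nbhs_filter x)) => e e0; apply/nbhs_ballP.
have K1 : 0 < K + 1 by rewrite ltr_wpDl.
pose eta : R := (e / (K + 1)) `^ al^-1.
have eta0 : 0 < eta by rewrite powR_gt0// divr_gt0.
exists (eta / N.+1%:R) => /=; first by rewrite divr_gt0.
move=> y; rewrite -!ball_normE/= => xy.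
have xyeta : enorm (x - y) <= eta.
  apply: le_trans (enorm_le_norm _) _.
  move: xy; rewrite ltr_pdivlMr// mulrC => /ltW; apply: le_trans.
  by rewrite ler_wpM2r// ler_nat.
apply: le_lt_trans (fH _ _) _.
have h : enorm (x - y) `^ al <= e / (K + 1).
  rewrite [leRHS](_ : _ = eta `^ al); last first.
    by rewrite /eta -powRrM mulVf ?gt_eqF// powRr1// divr_ge0// ltW.
  by apply: ge0_ler_powR; rewrite ?nnegrE ?enorm_ge0// ltW.
apply: (@le_lt_trans _ _ (K * (e / (K + 1)))); first exact: ler_wpM2l.
by rewrite mulrCA gtr_pMr// ltr_pdivrMr// mul1r ltrDl.
Qed.

Section ebump_laplacian.
Context {R : realType} {N : nat}.
Local Notation leb := (@lebesgue_rV R N).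
Variable s : R.
Hypothesis hs : 0 < s < 1.
Implicit Types (C : R) (f g : 'rV[R]_N -> R) (x y z : 'rV[R]_N).

Lemma fracL_continuous C f : tame C f -> continuous (fracL s f).
Proof.
move=> ft; have /andP[s0 s1] := hs.
apply: (@holder_continuous _ _ _ (4 * C * kmass (N := N) s) ((1 - s) / 2)).
- by rewrite mulr_ge0 ?kmass_ge0// mulr_ge0// (tame_ge0 ft).
- by rewrite divr_gt0 ?subr_gt0.
- by move=> x y; exact: fracL_holder.
Qed.

Lemma measurable_fracL C f : tame C f -> measurable_fun setT (fracL s f).
Proof. by move=> ft; apply: continuous_measurable_rV; exact: fracL_continuous ft. Qed.

Lemma bounded_support_integrable C (D : R) f : measurable_fun setT f ->
  (forall x, `|f x| <= C) ->
  (forall x, D < enorm x -> f x = 0) -> leb.-integrable setT (EFin \o f).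
Proof.
move=> mf fC fD; have C0 := le_trans (normr_ge0 _) (fC 0).
pose B : set 'rV[R]_N := [set x | enorm x <= D].
have mB : measurable B := measurable_cball D.
apply/integrableP; split; first exact/measurable_EFinP.
apply: (@le_lt_trans _ _ (\int[leb]_x (C%:E * (\1_B x)%:E))%E).
  apply: ge0_le_integral => //.
  - by apply: measurableT_comp => //; exact/measurable_EFinP.
  - by apply: measurable_funeM; apply/measurable_EFinP/measurable_indic.
  - move=> x _ /=; rewrite indicE.
    have [xB|xB] := leP (enorm x) D.
      by rewrite mem_set// mule1 lee_fin.
    by rewrite fD// normr0 mule_ge0// lee_fin.
rewrite integral_cst_indic// lte_mul_pinfty//; exact: lebesgue_cball_lty.
Qed.

Lemma ebump_integrable : leb.-integrable setT (EFin \o (@ebump R N)).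
Proof.
have [bC _ _] := @ebump_tame R N.
apply: (bounded_support_integrable (D := 1) (tame_measurable (@ebump_tame R N)) bC).
by move=> x x1; rewrite ebump_eq0// ltW.
Qed.

Lemma ebump_mass_gt0 : 0 < \int[leb]_x ebump x.
Proof.
pose B : set 'rV[R]_N := [set x | enorm x <= 1 / 2].
have mB : measurable B := measurable_cball _.
have bfin := integrable_fin_num measurableT ebump_integrable.
rewrite -lte_fin /Rintegral fineK//.
have B0 : (0 < leb B)%E by apply: lebesgue_cball_gt0; lra.
apply: (@lt_le_trans _ _ (\int[leb]_x ((1 / 2)%:E * (\1_B x)%:E))%E).
  by rewrite integral_cst_indic ?divr_ge0// mule_gt0// lte_fin divr_gt0.
apply: ge0_le_integral => //.
- by apply: measurable_funeM; apply/measurable_EFinP/measurable_indic.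
- by apply/measurable_EFinP; exact: tame_measurable (@ebump_tame R N).
- move=> x _; rewrite indicE; have [xB|xB] := leP (enorm x) (1 / 2).
    by rewrite mem_set// mule1 lee_fin ebump_ge_half.
  by rewrite memNset ?mule0 ?lee_fin ?ebump_ge0//= ; apply/negP; rewrite -ltNge.
Qed.

Lemma fracL_bump_lt0 x : 1 <= enorm x -> fracL s ebump x < 0.
Proof.
move=> x1; have D0 : 0 < enorm x + 1 by rewrite ltr_wpDl// enorm_ge0.
apply: le_lt_trans (fracL_far hs D0 (@ebump_tame R N) (@ebump_ge0 R N)
  ebump_integrable (ebump_eq0 x1) _) _.
  move=> y yn0; have y1 : enorm y < 1.
    by rewrite ltNge; apply: contra yn0 => /ebump_eq0 ->.
  by rewrite (le_trans (enormD _ _))// enormN addrC lerD2l ltW.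
by rewrite oppr_lt0 mulr_gt0 ?powR_gt0 ?ebump_mass_gt0.
Qed.

(** The set S where the fractional Laplacian of the bump is nonnegative is
    compact and, by fracL_bump_lt0, contained in the open ball, so the bump is
    bounded below on S. The inequality passes to translates, dilates and
    averages, and so bounds the diffusion of an average by the average itself. *)
Lemma fracL_bump_le : exists2 C0 : R, 0 <= C0 &
  forall x : 'rV[R]_N, fracL s ebump x <= C0 * ebump x.
Proof.
pose S : set 'rV[R]_N := [set x | enorm x <= 1 /\ 0 <= fracL s ebump x].
have [S0|Sn0] := pselect (S !=set0); last first.
  exists 0 => // x; rewrite mul0r; have [x1|x1] := leP 1 (enorm x).
    exact/ltW/fracL_bump_lt0.
  rewrite leNgt; apply/negP => Lx; apply: Sn0; exists x; split; exact: ltW.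
have cb : continuous (@ebump R N) by apply: tame_continuous (@ebump_tame R N).
have cL : continuous (fracL s (@ebump R N)) by apply: fracL_continuous (@ebump_tame R N).
have cS : compact S.
  rewrite (_ : S = [set x | enorm x <= 1] `&` [set x | 0 <= fracL s ebump x])//.
  apply: compact_closedI; first exact: compact_cball.
  by apply: (@preimage_closed _ _ _ [set t : R | 0 <= t]) => //; exact: closed_ge.
have [x1] := compact_EVT_min S0 cS (continuous_subspaceT cb).
rewrite inE => -[x11 Lx1] minb.
have x1lt : enorm x1 < 1.
  rewrite lt_neqAle x11 andbT; apply/eqP => e1.
  by have := @fracL_bump_lt0 x1; rewrite e1 lexx ltNge Lx1 => /(_ isT).
have b1 := ebump_gt0 x1lt.
pose B : R := 2 * 40 * kmass (N := N) s.
have B0 : 0 <= B by rewrite mulr_ge0 ?kmass_ge0.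
exists (B / ebump x1); first by rewrite divr_ge0// ltW.
move=> x; have [Lx|Lx] := ltP (fracL s ebump x) 0.
  by rewrite (le_trans (ltW Lx))// mulr_ge0 ?ebump_ge0// divr_ge0// ltW.
have [xx|xx] := leP 1 (enorm x).
  by have := fracL_bump_lt0 xx; rewrite ltNge Lx.
have xS : x \in S by rewrite inE; split => //; exact: ltW.
apply: (@le_trans _ _ B).
  by apply: le_trans (ler_norm _) _; apply: (fracL_bound hs); exact: ebump_tame.
by rewrite mulrAC ler_pdivlMr// ler_wpM2l// minb.
Qed.

Lemma fracL_scaled_bump (l : R) x : 0 < l ->
  fracL s (fun x => ebump (l *: x)) x = l `^ (2 * s) * fracL s ebump (l *: x).
Proof.
move=> l0; have := fracL_affine hs 0 x l0 (@ebump_tame R N); rewrite subr0.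
by under [in X in X -> _]eq_fun do rewrite subr0.
Qed.

End ebump_laplacian.

(** * Integration on products *)

Section bounded_multiplier.
Context {d : measure_display} {T : measurableType d} {R : realType}.
Variables (m : {measure set T -> \bar R}) (D : set T) (M : R) (W h : T -> R).
Hypothesis mD : measurable D.
Hypothesis Wi : m.-integrable D (EFin \o W).
Hypothesis mh : measurable_fun setT h.
Hypothesis hM : forall z, `|h z| <= M.

Lemma integrable_mul_boundedD : m.-integrable D (EFin \o (fun z => W z * h z)).
Proof.
apply: (le_integrable mD (g := EFin \o (fun z => M * W z))).
- apply/measurable_EFinP; apply: measurable_funM; last exact: measurable_funTS.
  by have /measurable_int/measurable_EFinP := Wi.
- move=> z _ /=; rewrite lee_fin normrM [leRHS]normrM mulrC ler_wpM2r//.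
  by apply: le_trans (ler_norm _).
- exact: (integrableZl mD M Wi).
Qed.

Lemma integrable_bounded_mulD : m.-integrable D (EFin \o (fun z => h z * W z)).
Proof.
by apply: eq_integrable integrable_mul_boundedD => //= z _; rewrite mulrC.
Qed.

End bounded_multiplier.

Section product_integrals.
Context d1 d2 (T1 : measurableType d1) (T2 : measurableType d2) (R : realType).
Variables (m1 : {sigma_finite_measure set T1 -> \bar R})
          (m2 : {sigma_finite_measure set T2 -> \bar R}).

Lemma measurable_fst_comp (f : T1 -> R) : measurable_fun setT f ->
  measurable_fun setT (fun z : T1 * T2 => f z.1).
Proof. by move=> mf; apply: measurableT_comp mf _; exact: measurable_fst. Qed.

Lemma measurable_snd_comp (f : T2 -> R) : measurable_fun setT f ->
  measurable_fun setT (fun z : T1 * T2 => f z.2).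
Proof. by move=> mf; apply: measurableT_comp mf _; exact: measurable_snd. Qed.

Lemma integrable_prod (f : T1 -> R) (g : T2 -> R) :
  m1.-integrable setT (EFin \o f) -> m2.-integrable setT (EFin \o g) ->
  (m1 \x m2)%E.-integrable setT (EFin \o (fun z => f z.1 * g z.2)).
Proof.
move=> fi gi; have /integrableP[/measurable_EFinP mf foo] := fi.
have /integrableP[/measurable_EFinP mg goo] := gi.
have mfg : measurable_fun setT (fun z : T1 * T2 => f z.1 * g z.2).
  by apply: measurable_funM; [exact: measurable_fst_comp|exact: measurable_snd_comp].
apply/(integrable12ltyP m1 m2); first exact/measurable_EFinP.
pose c := (\int[m2]_y `|(g y)%:E|)%E.
have c0 : (0 <= c)%E by apply: integral_ge0.
have cfin : c \is a fin_num by rewrite ge0_fin_numE.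
rewrite (eq_integral (fun x => (fine c)%:E * `|(f x)%:E|)%E); last first.
  move=> x _ /=; rewrite fineK// muleC -(ge0_integralZl m2 measurableT)//.
  - by apply: eq_integral => y _; rewrite normrM EFinM.
  - by apply/measurable_EFinP; exact: measurableT_comp.
rewrite (ge0_integralZl m1 measurableT)//.
- by rewrite lte_mul_pinfty// ?lee_fin ?fine_ge0.
- by apply/measurable_EFinP; exact: measurableT_comp.
- by rewrite lee_fin fine_ge0.
Qed.

Lemma fubini12 (h : T1 * T2 -> R) :
  (m1 \x m2)%E.-integrable setT (EFin \o h) ->
  (forall x, m2.-integrable setT (EFin \o (fun y => h (x, y)))) ->
  \int[(m1 \x m2)%E]_z h z = \int[m1]_x \int[m2]_y h (x, y).
Proof.
move=> hi hix; rewrite {1}/Rintegral -integral12_prod_meas1//.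
congr fine; apply: eq_integral => x _; rewrite /fubini_F /Rintegral fineK//.
exact: integrable_fin_num (hix x).
Qed.

Lemma fubini21 (h : T1 * T2 -> R) :
  (m1 \x m2)%E.-integrable setT (EFin \o h) ->
  (forall y, m1.-integrable setT (EFin \o (fun x => h (x, y)))) ->
  \int[(m1 \x m2)%E]_z h z = \int[m2]_y \int[m1]_x h (x, y).
Proof.
move=> hi hiy; rewrite {1}/Rintegral -integral21_prod_meas1//.
congr fine; apply: eq_integral => y _; rewrite /fubini_G /Rintegral fineK//.
exact: integrable_fin_num (hiy y).
Qed.

Lemma Rintegral_prod (f : T1 -> R) (g : T2 -> R) :
  m1.-integrable setT (EFin \o f) -> m2.-integrable setT (EFin \o g) ->
  \int[(m1 \x m2)%E]_z (f z.1 * g z.2) = (\int[m1]_x f x) * (\int[m2]_y g y).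
Proof.
move=> fi gi; rewrite fubini12.
- rewrite mulrC -RintegralZl//; apply: eq_Rintegral => x _ /=.
  by rewrite RintegralZl// mulrC.
- exact: integrable_prod.
- by move=> x; exact: (integrableZl measurableT (f x) gi).
Qed.

Lemma integrable_patch d (T : measurableType d)
    (m : {measure set T -> \bar R}) (A : set T) (f : T -> R) :
  measurable A -> m.-integrable A (EFin \o f) ->
  m.-integrable setT (EFin \o (f \_ A)).
Proof.
move=> mA; rewrite (integrable_mkcond _ mA); apply: eq_integrable => //= x _.
by rewrite /patch /=; case: ifP.
Qed.

Lemma patch_prod (A : set T1) (B : set T2) (f : T1 -> R) (g : T2 -> R) :
  (fun z => f z.1 * g z.2) \_ (A `*` B) =
  (fun z => (f \_ A) z.1 * (g \_ B) z.2).
Proof.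
apply/funext => -[x y]; rewrite /patch in_setX /=.
by case: (x \in A); case: (y \in B); rewrite /= ?mul0r ?mulr0.
Qed.

Lemma integrable_prodX (A : set T1) (B : set T2) (f : T1 -> R) (g : T2 -> R) :
  measurable A -> measurable B ->
  m1.-integrable A (EFin \o f) -> m2.-integrable B (EFin \o g) ->
  (m1 \x m2)%E.-integrable (A `*` B) (EFin \o (fun z => f z.1 * g z.2)).
Proof.
move=> mA mB fi gi; apply/(integrable_mkcond _ (measurableX mA mB)).
have H := integrable_prod (integrable_patch mA fi) (integrable_patch mB gi).
apply: eq_integrable H => //= z _; rewrite -/(_ z) /=.
by rewrite /patch in_setX /=; case: (z.1 \in A); case: (z.2 \in B);
  rewrite /= ?mul0r ?mulr0.
Qed.

Lemma Rintegral_prodX (A : set T1) (B : set T2) (f : T1 -> R) (g : T2 -> R) :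
  measurable A -> measurable B ->
  m1.-integrable A (EFin \o f) -> m2.-integrable B (EFin \o g) ->
  \int[(m1 \x m2)%E]_(z in A `*` B) (f z.1 * g z.2) =
  (\int[m1]_(x in A) f x) * (\int[m2]_(y in B) g y).
Proof.
move=> mA mB fi gi; rewrite Rintegral_mkcond patch_prod.
rewrite (Rintegral_prod (integrable_patch mA fi) (integrable_patch mB gi)).
by rewrite -!Rintegral_mkcond.
Qed.

End product_integrals.

Section shear.
Context {R : realType} {N : nat}.
Local Notation leb := (@lebesgue_rV R N).
Local Notation V := ('rV[R]_N * 'rV[R]_N)%type.

Definition shear (z : V) : V := (z.1, z.1 + z.2).

Lemma measurable_shear : measurable_fun setT shear.
Proof.
apply: measurable_fun_pair; first exact: measurable_fst.
by apply: measurable_rVD; [exact: measurable_fst|exact: measurable_snd].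
Qed.

(** The shear translates the second variable by the first, so Tonelli's theorem
    reduces the claim to the invariance of the measure. *)
Lemma ge0_integral_shear (F : V -> \bar R) : measurable_fun setT F ->
  (forall z, (0 <= F z)%E) ->
  (\int[(leb \x leb)%E]_z F z = \int[(leb \x leb)%E]_z F (shear z))%E.
Proof.
move=> mF F0; rewrite fubini_tonelli1// fubini_tonelli1//; last first.
  exact: measurableT_comp mF measurable_shear.
apply: eq_integral => x _; rewrite /fubini_F.
have mFx : measurable_fun setT (fun y => F (x, y)).
  exact: measurableT_comp mF (measurable_pair1 x).
have := ge0_integral_affine x (oner_neq0 R) mFx (fun y => F0 (x, y)).
rewrite normr1 expr1n invr1 mul1e => <-.
by apply: eq_integral => y _; rewrite /shear scale1r addrC.
Qed.

Lemma integrable_shear (h : V -> R) :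
  (leb \x leb)%E.-integrable setT (EFin \o h) ->
  (leb \x leb)%E.-integrable setT (EFin \o (h \o shear)).
Proof.
move=> /integrableP[mh hoo]; apply/integrableP; split.
  exact: measurableT_comp mh measurable_shear.
rewrite -(ge0_integral_shear (F := fun z => `|(EFin \o h) z|%E)) //.
exact: measurableT_comp.
Qed.

Lemma Rintegral_shear (h : V -> R) :
  (leb \x leb)%E.-integrable setT (EFin \o h) ->
  \int[(leb \x leb)%E]_z h z = \int[(leb \x leb)%E]_z h (shear z).
Proof.
move=> /measurable_int mh; rewrite /Rintegral integralE [in RHS]integralE.
rewrite (ge0_integral_shear (measurable_funepos mh)); last first.
  by move=> z; exact: funepos_ge0.
rewrite (ge0_integral_shear (measurable_funeneg mh)); last first.
  by move=> z; exact: funeneg_ge0.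
by congr (fine (_ - _)%E); apply: eq_integral => z _; rewrite ?funeposE ?funenegE.
Qed.

End shear.

(** * The energy form *)

Section energy.
Context {R : realType} {N : nat}.
Local Notation leb := (@lebesgue_rV R N).
Local Notation V := ('rV[R]_N * 'rV[R]_N)%type.
Variable s : R.
Hypothesis hs : 0 < s < 1.
Implicit Types (C D : R) (f g v w : 'rV[R]_N -> R) (x y z : 'rV[R]_N).

Local Notation a := (@frac_lap_const R N s).

Lemma energy_densityE v w (z : V) : energy_density s v w z =
  a / 2 * ((v z.1 - v z.2) * (w z.1 - w z.2)) * ker s (z.1 - z.2).
Proof. by []. Qed.

Lemma measurable_energy v w : measurable_fun setT v -> measurable_fun setT w ->
  measurable_fun setT (energy_density s v w).
Proof.
move=> mv mw; apply: measurable_funM.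
  apply: measurable_funM => //; apply: measurable_funM; apply: measurable_funB;
    by [exact: measurable_fst_comp|exact: measurable_snd_comp].
apply: (measurableT_comp (measurable_ker s)).
by apply: measurable_rVB; [exact: measurable_fst|exact: measurable_snd].
Qed.

Lemma integrable_indic_cball D :
  leb.-integrable setT (EFin \o (\1_[set x : 'rV[R]_N | enorm x <= D] : _ -> R)).
Proof.
apply: (@bounded_support_integrable _ _ 1 D).
- by apply: measurable_indic; exact: measurable_cball.
- by move=> x; rewrite indicE; case: (_ \in _); rewrite ?normr1 ?normr0.
- by move=> x xD; rewrite indicE memNset//=; apply/negP; rewrite -ltNge.
Qed.

Lemma integrable_kmin_shift D : (leb \x leb)%E.-integrable setT
  (EFin \o (fun z : V => kmin s z.2 * \1_[set x | enorm x <= D] (z.1 + z.2))).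
Proof.
pose B : set 'rV[R]_N := [set x | enorm x <= D].
have mB : measurable B := measurable_cball D.
have /measurable_int mk := kmin_integrable (N := N) hs.
have mh : measurable_fun setT (fun z : V => kmin s z.2 * \1_B (z.1 + z.2)).
  apply: measurable_funM.
    by apply: measurable_snd_comp; exact/measurable_EFinP.
  apply: (measurableT_comp (measurable_indic mB)).
  by apply: measurable_rVD; [exact: measurable_fst|exact: measurable_snd].
apply/(integrable21ltyP leb leb); first exact/measurable_EFinP.
have cB : (leb B < +oo)%E := lebesgue_cball_lty D.
rewrite (eq_integral (fun z => (fine (leb B))%:E * (EFin \o kmin s) z)%E); last first.
  move=> z _ /=.
  rewrite (eq_integral (fun x => (kmin s z)%:E * (\1_B (1 *: x + z))%:E)%E); last first.
    by move=> x _; rewrite scale1r -EFinM ger0_norm// mulr_ge0 ?kmin_ge0// indicE.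
  have mi : measurable_fun setT (fun x : 'rV[R]_N => (\1_B x : R)%:E).
    exact/measurable_EFinP/measurable_indic.
  have i0 x : (0 <= (\1_B x : R)%:E)%E by rewrite lee_fin indicE.
  rewrite (ge0_integralZl leb measurableT).
  - rewrite (ge0_integral_affine z (oner_neq0 R) mi i0).
    rewrite normr1 expr1n invr1 mul1e integral_indic// setIT muleC fineK//.
    by rewrite ge0_fin_numE.
  - exact: measurableT_comp mi (measurable_affine 1 z).
  - by move=> x _; exact: i0.
  - by rewrite lee_fin kmin_ge0.
rewrite (ge0_integralZl leb measurableT)//.
- apply: lte_mul_pinfty; rewrite ?lee_fin ?fine_ge0//.
  have /integrableP[_] := kmin_integrable (N := N) hs.
  rewrite (eq_integral (EFin \o kmin s))// => z _ /=.
  by rewrite ger0_norm ?kmin_ge0.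
- by move=> z _ /=; rewrite lee_fin kmin_ge0.
- by rewrite lee_fin fine_ge0.
Qed.

(** After the shear (x, z) |-> (x, x + z) the density is,
    up to a constant, at most min (1, |z|^2) ker z, and it is supported where x or x + z lies in the support. *)
Lemma tame_energy_integrable C D f : tame C f ->
  (forall x, D < enorm x -> f x = 0) ->
  (leb \x leb)%E.-integrable setT (EFin \o energy_density s f f).
Proof.
move=> ft fD; have C0 := tame_ge0 ft; have mf := tame_measurable ft.
pose B : set 'rV[R]_N := [set x | enorm x <= D].
pose c : R := `|a / 2| * (4 * C ^+ 2).
have c0 : 0 <= c by rewrite mulr_ge0// mulr_ge0// sqr_ge0.
pose h (z : V) : R := c * (\1_B z.1 * kmin s z.2 + kmin s z.2 * \1_B (z.1 + z.2)).
have hi : (leb \x leb)%E.-integrable setT (EFin \o h).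
  have h1 := integrable_prod (integrable_indic_cball D) (kmin_integrable (N := N) hs).
  have := integrableZl measurableT c (integrableD measurableT h1
    (integrable_kmin_shift D)).
  by apply: eq_integrable.
have mE := measurable_energy mf mf.
apply/integrableP; split; first exact/measurable_EFinP.
rewrite (ge0_integral_shear (F := fun z : V => `|(EFin \o energy_density s f f) z|%E)) //; last first.
  by apply: measurableT_comp => //; exact/measurable_EFinP.
have /integrableP[mh] := hi; apply: le_lt_trans.
apply: ge0_le_integral => //.
- have mES : measurable_fun setT (EFin \o (energy_density s f f \o @shear R N)).
    by apply/measurable_EFinP; exact: measurableT_comp mE (@measurable_shear R N).
  by have := measurableT_comp (@abse_measurable R setT) mES.
- exact: measurableT_comp.
move=> [x z] _ /=; rewrite lee_fin energy_densityE /shear /= /h /=.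
rewrite opprD addNKr kerN -expr2.
have sq : (f x - f (x + z)) ^+ 2 <= 4 * C ^+ 2 * (Num.min 1 (enorm z `^ (1 + s))).
  apply: (@le_trans _ _ (4 * C ^+ 2 * Num.min 1 (enorm z ^+ 2))); last first.
    by rewrite ler_wpM2l ?min_pow_le// mulr_ge0// sqr_ge0.
  case: ft => fC fL _.
  rewrite minr_pMr ?mulr_ge0 ?sqr_ge0// mulr1 le_min; apply/andP; split.
    rewrite -[leLHS]real_normK ?num_real// (_ : 4 * C ^+ 2 = (2 * C) ^+ 2); last by ring.
    rewrite ler_sqr ?nnegrE ?mulr_ge0//.
    by apply: le_trans (ler_normB _ _) _; have := fC x; have := fC (x + z); lra.
  apply: (@le_trans _ _ ((C * enorm z) ^+ 2)).
    rewrite -[leLHS]real_normK ?num_real// ler_sqr ?nnegrE ?mulr_ge0 ?enorm_ge0//.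
    by have := fL x (x + z); rewrite opprD addNKr enormN.
  by rewrite exprMn; have := mulr_ge0 (sqr_ge0 C) (sqr_ge0 (enorm z)); lra.
rewrite (normrM (_ * _) (ker s z)) (normrM (a / 2)) (ger0_norm (ker_ge0 _ _)).
rewrite (ger0_norm (sqr_ge0 (f x - f (x + z)))).
rewrite [X in _ <= X]ger0_norm; last first.
  by rewrite mulr_ge0// addr_ge0// mulr_ge0 ?kmin_ge0 ?indicE.
have I1 : (\1_B x : R) = 1 \/ f x = 0.
  have [xB|xB] := leP (enorm x) D; last by right; exact: fD.
  by left; rewrite indicE mem_set.
have I2 : (\1_B (x + z) : R) = 1 \/ f (x + z) = 0.
  have [xB|xB] := leP (enorm (x + z)) D; last by right; exact: fD.
  by left; rewrite indicE mem_set.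
have j1 : 0 <= (\1_B x : R) by rewrite indicE.
have j2 : 0 <= (\1_B (x + z) : R) by rewrite indicE.
have k0 := kmin_ge0 s z.
have big : `|a / 2| * (f x - f (x + z)) ^+ 2 * ker s z <= c * kmin s z.
  rewrite /c /kmin [leRHS](_ : _ =
    `|a / 2| * (4 * C ^+ 2 * Num.min 1 (enorm z `^ (1 + s))) * ker s z).
    by apply: ler_wpM2r; [exact: ker_ge0|exact: ler_wpM2l].
  by ring.
case: I1 => [e1|e1]; last first.
  case: I2 => [e2|e2].
    apply: le_trans big _; rewrite ler_wpM2l// e2 mulr1 lerDr mulr_ge0//.
  rewrite e1 e2 subrr expr0n/= mulr0 mul0r.
  by rewrite mulr_ge0// addr_ge0// mulr_ge0.
by apply: le_trans big _; rewrite ler_wpM2l// e1 mul1r lerDl mulr_ge0.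
Qed.

(** Both differences are moved onto f by translating in x for each fixed
    increment z; the second difference of f then makes the double integral
    absolutely convergent, and no truncation is needed. *)
Lemma energy_fracL C D f v : tame C f -> (forall x, D < enorm x -> f x = 0) ->
  measurable_fun setT v -> leb.-integrable setT (EFin \o v) ->
  (leb \x leb)%E.-integrable setT (EFin \o energy_density s v v) ->
  (leb \x leb)%E.-integrable setT (EFin \o energy_density s f v) /\
  \int[(leb \x leb)%E]_z energy_density s f v z =
    \int[leb]_x (a * fracL s f x * v x).
Proof.
move=> ft fD mv vi vE; have C0 := tame_ge0 ft; have mf := tame_measurable ft.
have fE := tame_energy_integrable ft fD.
have iE : (leb \x leb)%E.-integrable setT (EFin \o energy_density s f v).
  have := integrableD measurableT (integrable_norm fE) (integrable_norm vE).
  apply: (le_integrable measurableT).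
    by apply/measurable_EFinP; exact: measurable_energy.
  move=> [x y] _ /=; rewrite lee_fin !energy_densityE /=.
  rewrite !normrM [X in _ <= X]ger0_norm; last by rewrite addr_ge0// mulr_ge0.
  rewrite -!mulrDl ler_wpM2r// -mulrDr ler_wpM2l//.
  set p := `|f x - f y|; set q := `|v x - v y|.
  have := sqr_ge0 (p - q); have := sqr_ge0 p; have := sqr_ge0 q; nra.
split=> //.
rewrite (Rintegral_shear iE).
have iS := integrable_shear iE.
have bf g : measurable_fun setT g -> (forall x, `|g x| <= 2 * C) ->
    leb.-integrable setT (EFin \o (fun x => g x * v x)).
  by move=> mg gC; exact: (integrable_bounded_mulD measurableT vi mg gC).
have mshift z : measurable_fun setT (fun x : 'rV[R]_N => f (x + z)).
  by apply: (measurableT_comp mf); exact: measurable_rVD.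
have fC x : `|f x| <= C by case: ft.
have mvz z : leb.-integrable setT (EFin \o (fun x => (f x - f (x + z)) * v x)).
  apply: bf; first exact: measurable_funB.
  by move=> x; apply: le_trans (ler_normB _ _) _; have := fC x; have := fC (x + z); lra.
have mvz2 z : leb.-integrable setT (EFin \o (fun x => (f (x - z) - f x) * v x)).
  apply: bf; first exact: measurable_funB.
  by move=> x; apply: le_trans (ler_normB _ _) _; have := fC x; have := fC (x - z); lra.
have mvz3 z : leb.-integrable setT
    (EFin \o (fun x => (f x - f (x + z)) * v (x + z))).
  have := integrable_affine z (oner_neq0 R) (mvz2 z).
  apply: eq_integrable => //= x _.
  by rewrite scale1r addrK.
have inner z : \int[leb]_x ((f x - f (x + z)) * (v x - v (x + z))) =
    \int[leb]_x (sdiff f x z * v x).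
  transitivity (\int[leb]_x ((f x - f (x + z)) * v x) -
                \int[leb]_x ((f x - f (x + z)) * v (x + z))).
    rewrite -(RintegralB measurableT (mvz z) (mvz3 z)).
    by apply: eq_Rintegral => x _; rewrite mulrBr.
  have -> : \int[leb]_x ((f x - f (x + z)) * v (x + z)) =
            \int[leb]_x ((f (x - z) - f x) * v x).
    have := Rintegral_affine z (oner_neq0 R) (mvz2 z).
    rewrite normr1 expr1n invr1 mul1r => <-.
    by apply: eq_Rintegral => x _; rewrite scale1r addrK.
  rewrite -(RintegralB measurableT (mvz z) (mvz2 z)).
  by apply: eq_Rintegral => x _; rewrite /sdiff; ring.
have inner_i z : leb.-integrable setT
    (EFin \o (fun x => (f x - f (x + z)) * (v x - v (x + z)))).
  have := integrableB measurableT (mvz z) (mvz3 z).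
  by apply: eq_integrable => //= x _; rewrite mulrBr.
have SE (x z : 'rV[R]_N) : energy_density s f v (shear (x, z)) =
    a / 2 * ker s z * ((f x - f (x + z)) * (v x - v (x + z))).
  by rewrite energy_densityE /shear /= opprD addNKr kerN; ring.
rewrite (fubini21 iS); last first.
  move=> z; have := integrableZl measurableT (a / 2 * ker s z) (inner_i z).
  by apply: eq_integrable => //= x _; rewrite SE.
pose H (z : V) : R := a / 2 * (sdiff f z.1 z.2 * ker s z.2 * v z.1).
have iH : (leb \x leb)%E.-integrable setT (EFin \o H).
  have := integrableZl measurableT (`|a / 2| * (4 * C))
    (integrable_prod (integrable_norm vi) (kmin_integrable (N := N) hs)).
  apply: (le_integrable measurableT).
    apply/measurable_EFinP; apply: measurable_funM => //; apply: measurable_funM.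
      apply: measurable_funM; last by apply: measurable_snd_comp; exact: measurable_ker.
      apply: measurable_funB; first apply: measurable_funB.
      + by apply: measurable_funM => //; exact: measurable_fst_comp.
      + apply: (measurableT_comp mf).
        by apply: measurable_rVD; [exact: measurable_fst|exact: measurable_snd].
      + apply: (measurableT_comp mf).
        by apply: measurable_rVB; [exact: measurable_fst|exact: measurable_snd].
    exact: measurable_fst_comp.
  move=> [x z] _ /=; rewrite lee_fin /H /=.
  apply: le_trans (ler_norm _).
  have -> : `|a / 2| * (4 * C) * (`|v x| * kmin s z) =
    `|a / 2| * (4 * C * kmin s z * `|v x|) by ring.
  rewrite (normrM (a / 2)) (normrM _ (v x)) ler_wpM2l// ler_wpM2r//.
  exact: sdiff_ker_le.
transitivity (\int[leb]_z \int[leb]_x H (x, z)).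
  apply: eq_Rintegral => z _.
  transitivity (a / 2 * ker s z * \int[leb]_x (sdiff f x z * v x)).
    rewrite -inner -(RintegralZl _ measurableT (inner_i z)).
    by apply: eq_Rintegral => x _; exact: SE.
  rewrite -RintegralZl//.
    by apply: eq_Rintegral => x _; rewrite /H /=; ring.
  have := integrableB measurableT (mvz z) (mvz2 z).
  by apply: eq_integrable => //= x _; rewrite -EFinB; congr EFin; rewrite /sdiff; ring.
have Hx z : leb.-integrable setT (EFin \o (fun x => H (x, z))).
  have := integrableZl measurableT (a / 2 * ker s z)
    (integrableB measurableT (mvz z) (mvz2 z)).
  apply: eq_integrable => //= x _; rewrite -EFinB -EFinM; congr EFin.
  by rewrite /H /= /sdiff; ring.
have Hz x : leb.-integrable setT (EFin \o (fun z => H (x, z))).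
  have := integrableZl measurableT (a / 2 * v x) (sdiff_integrable hs x ft).
  by apply: eq_integrable => //= z _; rewrite -EFinM; congr EFin; rewrite /H /=; ring.
rewrite -(fubini21 iH Hx) (fubini12 iH Hz).
apply: eq_Rintegral => x _.
rewrite /fracL (_ : a * _ * v x =
  a / 2 * v x * \int[leb]_z (sdiff f x z * ker s z)); last first.
  by set I := Rintegral _ _ _; field.
rewrite -(RintegralZl _ measurableT (sdiff_integrable hs x ft)).
by apply: eq_Rintegral => z _; rewrite /H /=; ring.
Qed.

End energy.

(** * Time factors *)

Section time_cutoff.
Context {R : realType}.
Implicit Types (K t k : R) (eta deta : R -> R).

(** Time factors: nonnegative C^{1,1} functions, with derivative deta. *)
Definition tame1 K eta deta : Prop :=
  [/\ forall t, 0 <= eta t <= K,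
      forall t, `|deta t| <= K,
      forall t t', `|eta t - eta t'| <= K * `|t - t'|,
      forall t t', `|deta t - deta t'| <= K * `|t - t'| &
      forall t k, `|eta (t + k) - eta t - k * deta t| <= K * k ^+ 2].

Lemma lip_continuous1 K (f : R -> R) :
  (forall t t', `|f t - f t'| <= K * `|t - t'|) -> continuous f.
Proof. exact: (@lipschitz_continuous R R^o f K). Qed.

Lemma tame1_cvg K eta deta t : tame1 K eta deta ->
  (fun h => h^-1 *: ((eta \o shift t) (h *: 1) - eta t)) @ 0^' --> deta t.
Proof.
move=> [eK _ _ _ tay]; have K0 : 0 <= K.
  by have /andP[] := eK 0; exact: le_trans.
apply/cvgrPdist_le => e e0; near=> h.
have h0 : h != 0 by near: h; exact: nbhs_dnbhs_neq.
rewrite /= [h *: 1]mulr1 (addrC h t) distrC.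
have hp : 0 < `|h| by rewrite normr_gt0.
have -> : h^-1 *: (eta (t + h) - eta t) - deta t =
  h^-1 * (eta (t + h) - eta t - h * deta t).
  by rewrite /GRing.scale/= !mulrBr mulKf.
rewrite normrM normfV mulrC ler_pdivrMr//.
apply: le_trans (tay _ _) _; rewrite -real_normK ?num_real// expr2 mulrA.
rewrite ler_wpM2r//; apply: (@le_trans _ _ ((K + 1) * `|h|)).
  by rewrite ler_wpM2r// lerDl.
rewrite mulrC -ler_pdivlMr ?ltr_wpDl//; near: h.
by apply: dnbhs0_le; rewrite divr_gt0// ltr_wpDl.
Unshelve. all: by end_near. Qed.

Lemma tame1_derivable K eta deta t : tame1 K eta deta -> derivable eta t 1.
Proof. by move=> /tame1_cvg H; apply/cvg_ex; exists (deta t); exact: H. Qed.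

Lemma tame1_derive1 K eta deta t : tame1 K eta deta -> derive1 eta t = deta t.
Proof.
move=> et; rewrite derive1E; apply: cvg_lim; first exact: Rhausdorff.
exact: tame1_cvg et.
Qed.

Lemma tame1_bump1 (tau t0 : R) : 0 < tau ->
  tame1 (64 * (1 + tau^-1 + tau^-1 ^+ 2))
    (fun t => bump1 ((t - t0) / tau)) (fun t => dbump1 ((t - t0) / tau) / tau).
Proof.
move=> tau0; have i0 : 0 < tau^-1 by rewrite invr_gt0.
move: (tau^-1) i0 => {tau tau0} a a0; have a2 := sqr_ge0 a.
split=> [t|t|t t'|t t'|t k].
- rewrite bump1_ge0/= (le_trans (bump1_le1 _))//; lra.
- rewrite normrM (gtr0_norm a0) (@le_trans _ _ (4 * a))//; last by lra.
  by rewrite ler_wpM2r ?dbump1_bound// ltW.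
- apply: le_trans (bump1_lip _ _) _.
  rewrite -mulrBl opprB addrA subrK normrM (gtr0_norm a0) -mulrA ler_wpM2l//.
  by rewrite mulrC ler_wpM2r//; lra.
- rewrite -mulrBl normrM (gtr0_norm a0).
  apply: (@le_trans _ _ (60 * `|(t - t0) * a - (t' - t0) * a| * a)).
    by rewrite ler_wpM2r ?dbump1_lip// ltW.
  rewrite -mulrBl opprB addrA subrK normrM (gtr0_norm a0).
  have -> : 60 * (`|t - t'| * a) * a = 60 * a ^+ 2 * `|t - t'| by ring.
  by rewrite ler_wpM2r//; lra.
- have := bump1_taylor ((t - t0) * a) (k * a).
  have -> : (t - t0) * a + k * a = (t + k - t0) * a by ring.
  rewrite exprMn => h.
  rewrite [X in _ - X](_ : _ = k * a * dbump1 ((t - t0) * a)); last by ring.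
  apply: le_trans h _; have -> : 30 * (k ^+ 2 * a ^+ 2) = 30 * a ^+ 2 * k ^+ 2 by ring.
  by rewrite ler_wpM2r ?sqr_ge0//; lra.
Qed.

(** The fundamental theorem of calculus for a time factor vanishing at T. *)
Lemma tame1_integral K eta deta (t T : R) : tame1 K eta deta -> t <= T ->
  eta T = 0 -> \int[@lebesgue_measure R]_(u in `]t, T[) deta u = - eta t.
Proof.
move=> et tT eT; have [_ _ eL dL _] := et.
have ce := lip_continuous1 eL; have cd := lip_continuous1 dL.
move: tT; rewrite le_eqVlt => /predU1P[->|tT].
  by rewrite set_itvoo0 Rintegral_set0 eT oppr0.
have H : (\int[@lebesgue_measure R]_(u in `[t, T]) (deta u)%:E =
    (eta T)%:E - (eta t)%:E)%E.
  apply: continuous_FTC2 => //.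
  - exact: continuous_subspaceT.
  - split=> [u _||]; first exact: tame1_derivable et.
      by apply: cvg_at_right_filter; exact: ce.
    by apply: cvg_at_left_filter; exact: ce.
  - by move=> u _; exact: tame1_derive1 et.
move: H; rewrite integral_itv_bndoo => [H|]; last first.
  by apply/measurable_EFinP/measurable_funTS; exact: continuous_measurable_fun.
by rewrite /Rintegral H eT -EFinB /= sub0r.
Qed.

Lemma tame1_integrable K eta deta (t T : R) : tame1 K eta deta ->
  (@lebesgue_measure R).-integrable `]t, T[ (EFin \o eta) /\
  (@lebesgue_measure R).-integrable `]t, T[ (EFin \o deta).
Proof.
move=> et; have [_ _ eL dL _] := et.
have I (f : R -> R) : continuous f ->
    (@lebesgue_measure R).-integrable `]t, T[ (EFin \o f).
  move=> cf; have H : (@lebesgue_measure R).-integrable `[t, T] (EFin \o f).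
    apply: continuous_compact_integrable; first exact: segment_compact.
    exact: continuous_subspaceT.
  apply: (integrableS _ _ _ H) => //; exact: subset_itv_oo_cc.
by split; apply: I; [exact: lip_continuous1 eL|exact: lip_continuous1 dL].
Qed.

End time_cutoff.

(** * Products of time and space factors as test functions *)

Lemma min1_le_powR (R : realType) (d al : R) : 0 <= d -> 0 < al < 1 ->
  Num.min 1 d <= d `^ al.
Proof.
move=> d0 /andP[a0 a1]; have [d1|d1] := leP 1 d.
  by rewrite -[leLHS](powRr0 d); apply: ler_powR => //; exact: ltW.
have [->|dn0] := eqVneq d 0; first by rewrite powR_ge0.
rewrite -[leLHS](powRr1 d0); apply: ger_powR; last exact: ltW.
by rewrite lt_neqAle eq_sym dn0 d0/= ltW.
Qed.

Section sigma_finite_product.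
Context d1 d2 (T1 : measurableType d1) (T2 : measurableType d2) (R : realType).
Variables (m1 : {sigma_finite_measure set T1 -> \bar R})
          (m2 : {sigma_finite_measure set T2 -> \bar R}).

Lemma sigma_finite_product : sigma_finite setT (m1 \x m2)%E.
Proof.
have /sigma_finiteP[F [TF ndF Foo]] := sigma_finiteT m1.
have /sigma_finiteP[G [TG ndG Goo]] := sigma_finiteT m2.
exists (fun n => F n `*` G n).
  rewrite -setXTT TF TG predeqE => -[x y]; split => [[/= [n _ Fnx] [k _ Gky]]|].
    exists (maxn n k) => //; split.
    - by move: x Fnx; exact/subsetPset/ndF/leq_maxl.
    - by move: y Gky; exact/subsetPset/ndG/leq_maxr.
  by move=> [n _ []/= ? ?]; split; exists n.
move=> k; have [mF Fk] := Foo k; have [mG Gk] := Goo k.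
split; first exact: measurableX.
by rewrite product_measure1E// lte_mul_pinfty// ge0_fin_numE.
Qed.

(** The product measure with its sigma-finite structure made explicit. *)
Definition product_sigma_finite :
    {sigma_finite_measure set (T1 * T2)%type -> \bar R} :=
  HB.pack (m1 \x m2)%E (Measure_isSigmaFinite.Build _ _ _ _ sigma_finite_product).

End sigma_finite_product.

Definition lebesgue_rV2 (R : realType) (N : nat) :
    {sigma_finite_measure set ('rV[R]_N * 'rV[R]_N)%type -> \bar R} :=
  product_sigma_finite (@lebesgue_rV R N) (@lebesgue_rV R N).

Section product_tests.
Context {R : realType} {N : nat}.
Local Notation leb := (@lebesgue_rV R N).
Local Notation lebt := (@lebesgue_measure R).
Local Notation leb2 := (lebesgue_rV2 R N).
Variables (s T : R) (Omega : set 'rV[R]_N) (D : R).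
Hypothesis hs : 0 < s < 1.
Hypothesis mO : measurable Omega.
Hypothesis OD : forall x, Omega x -> enorm x <= D.
Hypothesis ha : 0 <= @frac_lap_const R N s.
Variables (K C : R) (eta deta : R -> R) (psi : 'rV[R]_N -> R).
Hypothesis et : tame1 K eta deta.
Hypothesis eT : eta T = 0.
Hypothesis pt : tame C psi.
Hypothesis pO : forall x, ~ Omega x -> psi x = 0.

Let phi (x : 'rV[R]_N) (t : R) : R := eta t * psi x.
Let rhs (x : 'rV[R]_N) (t : R) : R :=
  - deta t * psi x + eta t * (@frac_lap_const R N s * fracL s psi x).

Lemma frac_lap_product t x :
  frac_lap s (phi ^~ t) x = eta t * (@frac_lap_const R N s * fracL s psi x).
Proof.
have e0 : 0 <= eta t by case: et => /(_ t) /andP[].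
rewrite (tame_frac_lapE hs x (tameZ e0 pt)) (fracLZ hs (eta t) x pt); ring.
Qed.

Lemma derive1_product x t : derive1 (phi x) t = deta t * psi x.
Proof.
rewrite derive1E /phi; have dt : derivable eta t 1 by exact: tame1_derivable et.
rewrite (_ : (fun t => _) = psi x \*: eta); last first.
  by apply/funext => u; rewrite /= mulrC.
by rewrite deriveZ// -derive1E (tame1_derive1 t et) /GRing.scale/= mulrC.
Qed.

Let K0 : 0 <= K.
Proof. by case: et => _ /(_ 0) H _ _ _; exact: le_trans (normr_ge0 _) H. Qed.

Let Linf : exists2 B : R, 0 <= B & forall x,
  `|@frac_lap_const R N s * fracL s psi x| <= B.
Proof.
exists (@frac_lap_const R N s * (2 * C * kmass (N := N) s)).
  by rewrite mulr_ge0// mulr_ge0 ?kmass_ge0// mulr_ge0// (tame_ge0 pt).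
move=> x; rewrite normrM ger0_norm// ler_wpM2l//.
by apply: (fracL_bound hs); exact: pt.
Qed.

Lemma rhs_bounded : bounded_xt Omega T rhs.
Proof.
have [B B0 LB] := Linf; have [pC _ _] := pt; have [eK dK _ _ _] := et.
exists (K * C + K * B) => x t _ _; apply: le_trans (ler_normD _ _) _.
rewrite (normrM (- deta t)) (normrM (eta t)) normrN.
apply: lerD; apply: ler_pM => //.
by rewrite ger0_norm; have /andP[] := eK t.
Qed.

(** In t, and for psi in x, a bounded Lipschitz function is Hoelder with any
    exponent; (1 - s) / 2 is the one that fracL_holder provides. *)
Lemma rhs_holder : holder_xt Omega T rhs.
Proof.
have [B B0 LB] := Linf; have [pC pL _] := pt; have [eK dK eL dL _] := et.
have C0 := tame_ge0 pt; have /andP[s0 s1] := hs.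
pose al : R := (1 - s) / 2.
have al01 : 0 < al < 1 by rewrite /al; apply/andP; split; lra.
pose H : R := @frac_lap_const R N s * (4 * C * kmass (N := N) s).
have H0 : 0 <= H.
  by rewrite mulr_ge0// mulr_ge0 ?kmass_ge0// mulr_ge0.
exists al, al, (2 * K * C + K * H + (2 * K * C + 2 * K * B)); split => //.
move=> x y t t' _ _ _ _.
set X : R := enorm (x - y) `^ al; set U : R := `|t - t'| `^ al.
have X0 : 0 <= X := powR_ge0 _ _; have U0 : 0 <= U := powR_ge0 _ _.
have hx : `|psi x - psi y| <= 2 * C * X.
  apply: (@le_trans _ _ (2 * C * Num.min 1 (enorm (x - y)))).
    rewrite minr_pMr ?mulr_ge0// mulr1 le_min; apply/andP; split.
      by apply: le_trans (ler_normB _ _) _; have := pC x; have := pC y; lra.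
    apply: le_trans (pL _ _) _; apply: ler_wpM2r; first exact: enorm_ge0.
    by rewrite ler_peMl// ler1n.
  by rewrite ler_wpM2l ?mulr_ge0// min1_le_powR// enorm_ge0.
have ht (f : R -> R) : (forall t, `|f t| <= K) ->
    (forall t t', `|f t - f t'| <= K * `|t - t'|) -> `|f t - f t'| <= 2 * K * U.
  move=> fK fL; apply: (@le_trans _ _ (2 * K * Num.min 1 `|t - t'|)).
    rewrite minr_pMr ?mulr_ge0// mulr1 le_min; apply/andP; split.
      by apply: le_trans (ler_normB _ _) _; have := fK t; have := fK t'; lra.
    apply: le_trans (fL _ _) _; apply: ler_wpM2r => //.
    by rewrite ler_peMl// ler1n.
  by rewrite ler_wpM2l ?mulr_ge0// min1_le_powR.
have eK' u : `|eta u| <= K by rewrite ger0_norm; have /andP[] := eK u.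
have he := ht _ eK' eL; have hd := ht _ dK dL.
set L := fun x => @frac_lap_const R N s * fracL s psi x.
have hL : `|L x - L y| <= H * X.
  rewrite /L -mulrBr normrM (ger0_norm ha) /H -mulrA ler_wpM2l//.
  exact: fracL_holder.
have -> : rhs x t - rhs y t' = - deta t * (psi x - psi y)
   - (deta t - deta t') * psi y + eta t * (L x - L y) + (eta t - eta t') * L y.
  by rewrite /rhs -/(L x) -/(L y); ring.
apply: le_trans (ler_normD _ _) _; apply: (@le_trans _ _ (K * (2 * C * X) +
   2 * K * U * C + K * (H * X) + 2 * K * U * B)).
  apply: lerD; last by rewrite normrM; apply: ler_pM => //; exact: LB.
  apply: le_trans (ler_normD _ _) _; apply: lerD.
    apply: le_trans (ler_normB _ _) _; apply: lerD.
      by rewrite normrM normrN; apply: ler_pM.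
    by rewrite normrM; apply: ler_pM.
  by rewrite normrM; apply: ler_pM.
have e1 := mulr_ge0 (mulr_ge0 K0 C0) U0; have e2 := mulr_ge0 (mulr_ge0 K0 C0) X0.
have e3 := mulr_ge0 (mulr_ge0 K0 H0) U0; have e4 := mulr_ge0 (mulr_ge0 K0 B0) X0.
lra.
Qed.

Lemma product_strong_solution : strong_solution s Omega T rhs phi.
Proof.
move=> x t Ox tT; split.
- rewrite /phi (_ : (fun t => _) = psi x \*: eta); last first.
    by apply/funext => u; rewrite /= mulrC.
  by apply: derivableZ; exact: tame1_derivable et.
- have e0 : 0 <= eta t by case: et => /(_ t) /andP[].
  exact: tame_has_frac_lap (tameZ e0 pt).
- by rewrite derive1_product frac_lap_product /rhs mulNr.
Qed.

Let mI (u v : R) : measurable (`]u, v[%classic : set (measurableTypeR R)).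
Proof. exact: measurable_itv. Qed.

Lemma measurable_eta : measurable_fun [set: measurableTypeR R] eta.
Proof.
by apply: continuous_measurable_fun; case: et => _ _ eL _ _; exact: lip_continuous1 eL.
Qed.

Let mpsi := tame_measurable pt.

Let psiD x : D < enorm x -> psi x = 0.
Proof. by move=> xD; apply: pO => /OD; rewrite leNgt xD. Qed.

Let mphi : measurable_fun setT (fun z : 'rV[R]_N * measurableTypeR R => phi z.1 z.2).
Proof.
apply: measurable_funM.
  exact: (measurable_snd_comp measurable_eta).
exact: measurable_fst_comp.
Qed.

Lemma Hs0_integrable v : Hs0 s Omega v ->
  [/\ measurable_fun setT v, leb.-integrable setT (EFin \o v) &
   (leb \x leb)%E.-integrable setT (EFin \o energy_density s v v)].
Proof.
move=> [mv v0 v2 vE]; split=> //.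
  pose B : set 'rV[R]_N := [set x | enorm x <= D].
  apply: (le_integrable measurableT (g := EFin \o (fun x => \1_B x + v x ^+ 2))).
  - exact/measurable_EFinP.
  - move=> x _ /=; rewrite lee_fin; apply: le_trans (ler_norm _).
    have [xB|xB] := leP (enorm x) D.
      rewrite indicE mem_set//=.
      have := sqr_ge0 (`|v x| - 1); rewrite sqrrB1 real_normK ?num_real//.
      by have := sqr_ge0 (v x); lra.
    rewrite v0 ?normr0 ?expr0n/= ?addr0 ?indicE// => /OD.
    by rewrite leNgt xB.
  - have h1 := integrable_indic_cball (N := N) D.
    have h2 : leb.-integrable setT (EFin \o (fun x => v x ^+ 2)).
      apply/integrableP; split; first by apply/measurable_EFinP/measurable_funX.
      rewrite (eq_integral (fun x => (v x ^+ 2)%:E))// => x _ /=.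
      by rewrite ger0_norm ?sqr_ge0.
    exact: (integrableD measurableT h1 h2).
apply/integrableP; split; first by apply/measurable_EFinP; exact: measurable_energy.
rewrite (eq_integral (fun z => (energy_density s v v z)%:E))// => z _ /=.
rewrite ger0_norm// energy_densityE mulr_ge0 ?ker_ge0// mulr_ge0 ?divr_ge0//.
by rewrite -expr2 sqr_ge0.
Qed.

Lemma Rintegral_support (g : 'rV[R]_N -> R) : (forall x, ~ Omega x -> g x = 0) ->
  \int[leb]_(x in Omega) g x = \int[leb]_x g x.
Proof.
move=> gO; rewrite Rintegral_mkcond; apply: eq_Rintegral => x _.
by rewrite /patch; case: ifPn => //; rewrite notin_setE => /gO ->.
Qed.

(** All the integrals factor. In the weak formulation the energy form becomes
    fracL psi by energy_fracL, and the integral of -deta over (t, T) is eta t as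
    eta vanishes at T. *)
Lemma product_finite_energy : finite_energy_solution s Omega T rhs phi.
Proof.
have [eK dK eL dL _] := et; have [pC _ _] := pt; have C0 := tame_ge0 pt.
have psi2i : leb.-integrable Omega (EFin \o (fun x => psi x ^+ 2)).
  apply: (integrableS measurableT) => //.
  apply: (@bounded_support_integrable _ _ (C ^+ 2) D).
  - exact: measurable_funX.
  - move=> x; rewrite ger0_norm ?sqr_ge0// -real_normK ?num_real//.
    by rewrite ler_sqr ?nnegrE.
  - by move=> x /psiD ->; rewrite expr0n.
pose c2 := (\int[leb]_(x in Omega) (psi x ^+ 2)%:E)%E.
have c2fin : c2 \is a fin_num by exact: integrable_fin_num.
have sqE (b : R) : (\int[leb]_(x in Omega) ((b * psi x) ^+ 2)%:E =
    (b ^+ 2 * fine c2)%:E)%E.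
  rewrite EFinM fineK// -(integralZl mO psi2i).
  by apply: eq_integral => x _; rewrite exprMn EFinM.
split.
- exact: measurable_funTS.
- move=> t0 _; split.
  + apply: measurable_funTS; exact: measurable_funM.
  + rewrite (eq_integral (fun x => ((eta t0 * psi x) ^+ 2)%:E)); last first.
      by move=> x _; rewrite real_normK ?num_real.
    by rewrite sqE ltry.
  + rewrite [X in X @ _ --> _](_ : _ =
        fun t => ((eta t - eta t0) ^+ 2 * fine c2)%:E); last first.
      apply/funext => t; rewrite -sqE; apply: eq_integral => x _.
      by rewrite real_normK ?num_real// /phi mulrBl.
    apply: cvg_within_filter; apply: cvg_EFin; first exact: nearW.
    rewrite [X in _ --> X](_ : 0 = (eta t0 - eta t0) ^+ 2 * fine c2); last first.
      by rewrite subrr expr0n/= mul0r.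
    apply: cvgMl; apply: (@cvg_comp _ _ _ _ (fun y : R => y ^+ 2) _ (nbhs (eta t0 - eta t0))).
      by apply: cvgB; [exact: (lip_continuous1 eL)|exact: cvg_cst].
    exact: exprn_continuous.
- have e2i : lebt.-integrable `]0, T[ (EFin \o (fun t => eta t * eta t)).
    have [ei _] := tame1_integrable 0 T et.
    have H : lebt.-integrable `]0, T[ (EFin \o (fun t => K * eta t)).
      by have := integrableZl (mI 0 T) K ei; apply: eq_integrable.
    apply: (le_integrable _ _ _ H) => //.
    + apply/measurable_EFinP/measurable_funTS.
      by apply: measurable_funM; exact: measurable_eta.
    + move=> t _ /=; rewrite lee_fin !normrM ler_wpM2r//.
      by have /andP[? ?] := eK t; rewrite !ger0_norm.
  have H := integrable_prodX (m1 := leb2) measurableT (mI 0 T)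
    (tame_energy_integrable hs pt psiD) e2i.
  have := integrable_lty (measurableX measurableT (mI 0 T)) H.
  congr (_ < _)%E; apply: eq_integral => z _ /=; congr EFin.
  by rewrite !energy_densityE /phi; ring.
- move=> v t vH /andP[t0 tT].
  have [mv vi vE] := Hs0_integrable vH; have [_ v0 _ _] := vH.
  have [iE EE] := energy_fracL hs pt psiD mv vi vE.
  have [ei di] := tame1_integrable t T et.
  have dni : lebt.-integrable `]t, T[ (EFin \o (fun u => - deta u)).
    exact: (integrableN di).
  have ipv : leb.-integrable setT (EFin \o (fun x => psi x * v x)).
    exact: (integrable_bounded_mulD measurableT vi mpsi pC).
  have [B B0 LB] := Linf.
  have mL : measurable_fun setT (fun x => @frac_lap_const R N s * fracL s psi x).
    by apply: measurable_funM => //; exact: measurable_fracL hs _ _ pt.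
  have iLv := integrable_bounded_mulD measurableT vi mL LB.
  have sub1 (g : 'rV[R]_N -> R) : leb.-integrable setT (EFin \o g) ->
      leb.-integrable Omega (EFin \o g) by exact: integrableS.
  have I1 : \int[leb]_(x in Omega) (phi x t * v x) =
      eta t * \int[leb]_(x in Omega) (psi x * v x).
    rewrite -(RintegralZl _ mO (sub1 _ ipv)); apply: eq_Rintegral => x _.
    by rewrite /phi mulrA.
  have I2 : \int[((leb \x leb) \x lebt)%E]_(z in setT `*` `]t, T[)
      energy_density s (phi ^~ z.2) v z.1 =
      (\int[leb]_(x in Omega) (@frac_lap_const R N s * fracL s psi x * v x)) *
      \int[lebt]_(u in `]t, T[) eta u.
    rewrite (Rintegral_support (g := fun x => _ * v x)); last first.
      by move=> x /v0 ->; rewrite mulr0.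
    rewrite -EE -(Rintegral_prodX (m1 := leb2) measurableT (mI t T) iE ei).
    by apply: eq_Rintegral => z _; rewrite !energy_densityE /phi; ring.
  have J1 := integrable_prodX mO (mI t T) (sub1 _ ipv) dni.
  have J2 := integrable_prodX mO (mI t T) (sub1 _ iLv) ei.
  have I3 : \int[lebesgue_xt R N]_(z in Omega `*` `]t, T[) (rhs z.1 z.2 * v z.1) =
      (\int[leb]_(x in Omega) (psi x * v x)) *
      (\int[lebt]_(u in `]t, T[) (- deta u)) +
      (\int[leb]_(x in Omega) (@frac_lap_const R N s * fracL s psi x * v x)) *
      \int[lebt]_(u in `]t, T[) eta u.
    rewrite -(Rintegral_prodX mO (mI t T) (sub1 _ ipv) dni).
    rewrite -(Rintegral_prodX mO (mI t T) (sub1 _ iLv) ei).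
    rewrite -(RintegralD (measurableX mO (mI t T)) J1 J2).
    by apply: eq_Rintegral => z _; rewrite /rhs; ring.
  have I4 : \int[lebt]_(u in `]t, T[) (- deta u) = eta t.
    have := tame1_integral et tT eT.
    rewrite (_ : (fun u => - deta u) = (fun u => -1 * deta u)); last first.
      by apply/funext => u; rewrite mulN1r.
    by rewrite RintegralZl// => ->; rewrite mulN1r opprK.
  by rewrite I1 I2 I3 I4 (mulrC (eta t)).
Qed.

Lemma product_test_class : test_class s Omega T phi.
Proof.
have [eK _ _ _ _] := et; have [pC _ _] := pt.
split.
  exists rhs; split; [exact: rhs_bounded|exact: rhs_holder|
    exact: product_strong_solution|exact: product_finite_energy].
split.
- by move=> x t /pO px _; rewrite /phi px mulr0.
- by move=> x _; rewrite /phi eT mul0r.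
- exists (K * C) => x t _ _; rewrite /phi normrM; apply: ler_pM => //.
  by rewrite ger0_norm; have /andP[] := eK t.
Qed.

End product_tests.

(** * Positivity of the normalizing constant *)

Section gamma.
Context {R : realType}.
Local Notation mu := (@lebesgue_measure R).

Let mI (i : interval R) : measurable ([set` i] : set (measurableTypeR R)).
Proof. exact: measurable_itv. Qed.

Lemma pow_le_expR (m : nat) (t : R) : 0 <= t -> t ^+ m.+1 <= m.+1%:R ^+ m.+1 * expR t.
Proof.
move=> t0; have -> : t = m.+1%:R * (t / m.+1%:R) by rewrite mulrC divfK.
rewrite exprMn ler_wpM2l ?exprn_ge0// expRM_natl.
rewrite lerXn2r ?nnegrE ?expR_ge0 ?divr_ge0//.
by apply: le_trans (expR_ge1Dx _); rewrite lerDr.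
Qed.

Definition gamma_density (c t : R) : R :=
  (t `^ c * expR (- t)) * (0 < t)%R%:R.

Lemma measurable_gamma_density c :
  measurable_fun [set: measurableTypeR R] (gamma_density c).
Proof.
apply: measurable_funM.
  apply: measurable_funM; first exact: measurable_powR.
  by apply: measurableT_comp => //; exact: measurable_expR.
by apply: (@measurable_indic_bool _ (measurableTypeR R)); rewrite -set_itvoy; exact: mI.
Qed.

Lemma gamma_density_ge0 c t : 0 <= gamma_density c t.
Proof. by rewrite !mulr_ge0 ?powR_ge0 ?expR_ge0. Qed.

Let pow2_ge0 (b : R) : 0 <= (2 : R) `^ b. Proof. exact: powR_ge0. Qed.

Let itv0 (i : bool) (r : R) : 0 < r ->
  mu [set` Interval (BSide i 0) (BRight r)] = r%:E.
Proof.
by move=> r0; rewrite lebesgue_measure_itv/= lte_fin r0 -EFinB subr0.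
Qed.

(** On the interval (0, 2^-j] the density is compared with t^(-b), b < 1. *)
Lemma gamma_near c : -1 < c ->
  (\int[mu]_t (gamma_density c t * (t < 1)%R%:R)%:E < +oo)%E.
Proof.
move=> c1; pose b : R := Num.max 0 (- c).
have b0 : 0 <= b by rewrite le_max lexx.
have b1 : b < 1 by rewrite gt_max ltr01 ltrNl.
have bc : - b <= c by rewrite lerNl le_max lexx orbT.
apply: (@dyadic_integral_lty _ (measurableTypeR R) R mu _ (fun j => `]0, 2 ^- j]%classic)
  (fun j => 2 `^ b * (2 `^ b) ^+ j) (2 `^ b) (2 `^ (- (1 - b)))).
- apply: measurable_funM; first exact: measurable_gamma_density.
  by apply: (@measurable_indic_bool _ (measurableTypeR R)); rewrite -set_itvNyo; exact: mI.
- by move=> t; rewrite mulr_ge0 ?gamma_density_ge0.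
- by move=> j; exact: mI.
- by move=> j; rewrite mulr_ge0 ?exprn_ge0.
- by [].
- by rewrite pow2_ge0/= pow2N_lt1// subr_gt0.
- move=> j; rewrite [X in (_ * X)%E](@itv0 _ (2 ^- j)) ?invr_gt0 ?exprn_gt0//.
  rewrite -EFinM lee_fin -mulrA ler_wpM2l// le_eqVlt.
  apply/orP; left; apply/eqP.
  rewrite -!powR_mulrn ?pow2_ge0// -!powRN -!powRrM.
  by rewrite -powRD ?pnatr_eq0 ?implybT//; congr (_ `^ _); ring.
move=> t; rewrite /gamma_density; have [t1|t1] := ltP t 1; last by rewrite mulr0 eqxx.
have [t0|t0] := ltP 0 t; last by rewrite mulr0 mul0r eqxx.
rewrite !mulr1 => _.
have /dyadic_floor[j /andP[jt tj]] : 1 <= t^-1 by rewrite invf_ge1// ltW.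
have t2 : t <= 2 ^- j by rewrite -[leLHS]invrK lef_pV2 ?posrE ?invr_gt0 ?exprn_gt0.
exists j; first by rewrite /= in_itv/= t0.
have jt2 : 2 ^- j.+1 <= t.
  by rewrite -[leRHS]invrK lef_pV2 ?posrE ?invr_gt0 ?exprn_gt0// ltW.
apply: (@le_trans _ _ (t `^ (- b))).
  rewrite (@le_trans _ _ (t `^ c))//.
    by rewrite ler_piMr ?powR_ge0// expR_le1 oppr_le0 ltW.
  by apply: ger_powR => //; rewrite t0 ltW.
rewrite powRN; apply: (@le_trans _ _ ((2 ^- j.+1) `^ b)^-1).
  rewrite lef_pV2 ?posrE ?powR_gt0 ?invr_gt0 ?exprn_gt0//.
  by apply: ge0_ler_powR; rewrite ?nnegrE ?invr_ge0 ?exprn_ge0// ltW.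
rewrite -exprS -!powR_mulrn ?pow2_ge0// -!powRN -!powRrM.
by rewrite le_eqVlt; apply/orP; left; apply/eqP; congr (_ `^ _); ring.
Qed.

Lemma gamma_far c :
  (\int[mu]_t (gamma_density c t * (1 <= t)%R%:R)%:E < +oo)%E.
Proof.
pose m := (Num.truncn (c + 2)).
have cm : c + 2 <= m.+1%:R by rewrite ltW// truncnS_gt.
pose M : R := m.+1%:R ^+ m.+1.
have M0 : 0 <= M by rewrite exprn_ge0.
apply: (@dyadic_integral_lty _ (measurableTypeR R) R mu _ (fun j => `[0, 2 ^+ j.+1]%classic)
  (fun j => M * 4 ^- j) (2 * M) (2^-1)).
- apply: measurable_funM; first exact: measurable_gamma_density.
  by apply: (@measurable_indic_bool _ (measurableTypeR R)); rewrite -set_itvcy; exact: mI.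
- by move=> t; rewrite mulr_ge0 ?gamma_density_ge0.
- by move=> j; exact: mI.
- by move=> j; rewrite mulr_ge0 ?invr_ge0 ?exprn_ge0.
- by rewrite mulr_ge0.
- by rewrite invr_ge0 ler0n/= invf_lt1 ?ltr1n.
- move=> j; rewrite [X in (_ * X)%E](@itv0 _ (2 ^+ j.+1)) ?exprn_gt0//.
  rewrite -EFinM lee_fin le_eqVlt; apply/orP; left; apply/eqP.
  have -> : 4 = 2 * 2 :> R by ring.
  rewrite exprMn exprS invfM exprVn.
  have h : (2 : R) ^+ j != 0 by rewrite expf_neq0.
  by field.
move=> t; rewrite /gamma_density; have [t1|t1] := leP 1 t; last by rewrite mulr0 eqxx.
have t0 : 0 < t by exact: lt_le_trans ltr01 t1.
rewrite t0 !mulr1 => _; have [j /andP[jt tj]] := dyadic_floor t1.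
exists j; first by rewrite /= in_itv/= !ltW.
have h : t `^ c * expR (- t) * t ^+ 2 <= M.
  rewrite mulrAC -powR_mulrn ?(ltW t0)// -powRD ?(gt_eqF t0) ?implybT// expRN.
  rewrite ler_pdivrMr ?expR_gt0//; apply: le_trans (pow_le_expR m (ltW t0)).
  by rewrite -powR_mulrn ?(ltW t0)//; apply: ler_powR.
apply: (@le_trans _ _ (M / t ^+ 2)); first by rewrite ler_pdivlMr ?exprn_gt0.
rewrite ler_wpM2l// lef_pV2 ?posrE ?exprn_gt0//.
have -> : 4 = 2 ^+ 2 :> R by ring.
by rewrite -exprM mulnC exprM lerXn2r ?nnegrE ?exprn_ge0// ltW.
Qed.

(** Finiteness matters as much as positivity: the real-valued integral of a
    function that is not integrable would be 0. *)
Lemma gamma_integral_gt0 c : -1 < c ->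
  0 < \int[mu]_(t in `]0%R, +oo[) (t `^ c * expR (- t)).
Proof.
move=> c1; have mg := measurable_gamma_density c.
have -> : \int[mu]_(t in `]0%R, +oo[) (t `^ c * expR (- t)) =
    \int[mu]_t gamma_density c t.
  rewrite Rintegral_mkcond; apply: eq_Rintegral => t _.
  rewrite /patch /gamma_density; case: ifPn.
    by rewrite inE/= in_itv/= andbT => ->; rewrite mulr1.
  by rewrite notin_setE/= in_itv/= andbT => /negP/negbTE ->; rewrite mulr0.
have g0 (P : pred R) t : (0 <= (gamma_density c t * (P t)%:R)%:E)%E.
  by rewrite lee_fin mulr_ge0 ?gamma_density_ge0.
have mgP (P : pred R) : measurable ([set t | P t] : set (measurableTypeR R)) ->
    measurable_fun [set: measurableTypeR R]
      (fun t => (gamma_density c t * (P t)%:R)%:E).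
  move=> mP; apply/measurable_EFinP/measurable_funM => //.
  exact: (@measurable_indic_bool _ (measurableTypeR R)).
have gi : (\int[mu]_t (gamma_density c t)%:E < +oo)%E.
  rewrite (eq_integral (fun t : measurableTypeR R => (gamma_density c t * (t < 1)%R%:R)%:E +
     (gamma_density c t * (1 <= t)%R%:R)%:E)%E); last first.
    by move=> t _; rewrite -EFinD; congr EFin; case: ltP => _; rewrite mulr1 mulr0 ?addr0 ?add0r.
  rewrite (ge0_integralD mu measurableT).
  - by rewrite lte_add_pinfty//; [exact: gamma_near|exact: gamma_far].
  - by move=> t _; exact: (g0 (fun t => t < 1)).
  - by apply: mgP; rewrite -set_itvNyo; exact: mI.
  - by move=> t _; exact: (g0 (fun t => 1 <= t)).
  - by apply: mgP; rewrite -set_itvcy; exact: mI.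
have gfin : (\int[mu]_t (gamma_density c t)%:E)%E \is a fin_num.
  rewrite ge0_fin_numE//; apply: integral_ge0 => t _.
  by rewrite lee_fin gamma_density_ge0.
rewrite -lte_fin /Rintegral fineK//.
pose B : set R := `[1, 2]%classic.
have BE : mu B = 1%:E.
  by rewrite /B lebesgue_measure_itv/= lte_fin ltr1n/= -EFinB; congr EFin; ring.
pose b : R := 2^-1 * expR (- 2).
have b0 : 0 < b by rewrite mulr_gt0 ?expR_gt0.
apply: (@lt_le_trans _ _ (\int[mu]_t (b%:E * (\1_B t)%:E))%E).
  rewrite integral_cst_indic ?ltW//; last exact: mI.
  by rewrite [X in (_ * X)%E]BE -EFinM lte_fin mulr1.
apply: ge0_le_integral => //.
- by move=> t _; rewrite mule_ge0// lee_fin ?indicE// ltW.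
- by apply: measurable_funeM; apply/measurable_EFinP/measurable_indic; exact: mI.
- exact/measurable_EFinP.
move=> t _; rewrite indicE; case: (boolP (t \in B)) => [|_]; last first.
  by rewrite mule0 lee_fin gamma_density_ge0.
rewrite inE /B/= in_itv/= => /andP[t1 t2].
rewrite mule1 lee_fin /gamma_density.
have t0 : 0 < t by exact: lt_le_trans ltr01 t1.
rewrite t0 mulr1 /b; apply: ler_pM; rewrite ?invr_ge0 ?expR_ge0//.
  apply: (@le_trans _ _ (t `^ (-1))).
    by rewrite powR_inv1 ?(ltW t0)// lef_pV2 ?posrE.
  by apply: ler_powR => //; exact: ltW.
by rewrite ler_expR lerN2.
Qed.

Lemma Gamma_gt0 (z : R) : 0 < z -> 0 < Gamma z.
Proof.
move=> z0; rewrite /Gamma min_r ?(ltW z0)// floor0 /= big_ord0 divr1 addr0.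
by apply: gamma_integral_gt0; lra.
Qed.

(** Here Gamma is defined through Gamma (1 - s) = - s Gamma (- s). *)
Lemma Gamma_neg_neq0 (s : R) : 0 < s < 1 -> Gamma (- s) != 0.
Proof.
move=> /andP[s0 s1]; rewrite /Gamma min_l ?oppr_le0 ?(ltW s0)//.
have -> : Num.floor (- s) = -1.
  apply: floor_def; rewrite (_ : (-1 + 1)%:~R = 0)// (_ : (-1)%:~R = -1)//.
  by apply/andP; split; lra.
rewrite /= big_ord1 addr0.
have /gt_eqF I0 : 0 < \int[mu]_(t in `]0%R, +oo[) (t `^ (- s + 1 - 1) * expR (- t)).
  by apply: gamma_integral_gt0; lra.
by rewrite mulf_neq0 ?I0// invr_eq0 oppr_eq0 gt_eqF.
Qed.

Lemma frac_lap_const_gt0 (N : nat) (s : R) : 0 < s < 1 ->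
  0 < @frac_lap_const R N s.
Proof.
move=> hs; have /andP[s0 s1] := hs; rewrite /frac_lap_const mulr_gt0//.
  by rewrite mulr_gt0// powR_gt0// pi_gt0.
rewrite divr_gt0// ?normr_gt0 ?Gamma_neg_neq0//.
by apply: Gamma_gt0; rewrite divr_gt0// ltr_wpDl// mulr_gt0.
Qed.

End gamma.

(** * The weak inequality for products *)

Lemma integral_le_restrict d (T : measurableType d) (R : realType)
    (mu : {measure set T -> \bar R}) (A B : set T) (f : T -> \bar R) :
  measurable A -> measurable B -> A `<=` B -> measurable_fun B f ->
  (forall x, B x -> ~ A x -> f x <= 0)%E ->
  (\int[mu]_(x in B) f x <= \int[mu]_(x in A) f x)%E.
Proof.
move=> mA mB AB mf f0; rewrite integralE [leRHS]integralE.
apply: leeB; last first.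
  apply: ge0_subset_integral => //; exact: measurable_funeneg.
rewrite integral_mkcond [leRHS]integral_mkcond.
rewrite (eq_integral (f^\+%E \_ A))// => x _.
rewrite /patch; case: ifPn => [|xB].
  rewrite inE => xB; case: ifPn => // /negP xA.
  rewrite funeposE max_r//; apply: f0 => // Ax; apply: xA; exact/mem_set.
by case: ifPn => // xA; case/negP: xB; rewrite inE; apply: AB; rewrite inE in xA.
Qed.

Section supersolution.
Context {R : realType} {N : nat}.
Local Notation leb := (@lebesgue_rV R N).
Local Notation lebt := (@lebesgue_measure R).
Local Notation V := ('rV[R]_N * measurableTypeR R)%type.
Variables (s T p D : R) (Omega : set 'rV[R]_N) (u : 'rV[R]_N -> R -> R).
Hypothesis hs : 0 < s < 1.
Hypothesis N0 : (0 < N)%N.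
Hypothesis hT : 0 < T.
Hypothesis hp : 1 < p.
Hypothesis mO : measurable Omega.
Hypothesis D0 : 0 < D.
Hypothesis OD : forall x, Omega x -> enorm x <= D.
Hypothesis hu : forall x (t : R), 0 <= t < T -> 0 <= u x t.
Hypothesis hsup : weak_supersolution s Omega T
       (fun x t => u x t `^ p / enorm x `^ (2 * s)) u.

Local Notation a := (@frac_lap_const R N s).
Definition Qcyl : set V := Omega `*` (`]0, T[%classic : set (measurableTypeR R)).
Local Notation Q := Qcyl.
Let F (z : V) : R := u z.1 z.2 `^ p / enorm z.1 `^ (2 * s).

Let mI : measurable (`]0, T[%classic : set (measurableTypeR R)).
Proof. exact: measurable_itv. Qed.

Lemma measurable_Q : measurable Q.
Proof. exact: measurableX. Qed.

Lemma Q_fin : ((leb \x lebt)%E Q < +oo)%E.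
Proof.
rewrite /Q product_measure1E// lte_mul_pinfty//.
- rewrite ge0_fin_numE//; apply: le_lt_trans (lebesgue_cball_lty D).
  by apply: le_measure; rewrite ?inE//; exact: measurable_cball.
- have E : lebt (`]0, T[%classic : set (measurableTypeR R)) = T%:E.
    by rewrite lebesgue_measure_itv/= lte_fin hT -EFinB subr0.
  by rewrite [X in (X < _)%E]E ltry.
Qed.

Lemma measurable_uT : measurable_fun
  (setT `*` (`]0, T[%classic : set (measurableTypeR R)))
  (fun z : V => u z.1 z.2).
Proof.
have [mu _ _ _] := hsup; apply: measurable_funS mu.
  by apply: measurableX => //; exact: measurable_itv.
move=> [x t] [_] /=; rewrite in_itv/= => /andP[t0 tT]; split => //=.
by rewrite in_itv/= (ltW t0).
Qed.

Lemma measurable_uQ : measurable_fun Q (fun z : V => u z.1 z.2).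
Proof.
by apply: measurable_funS measurable_uT; [exact: measurableX|move=> [x t] /= []].
Qed.

Lemma F_integrable : (leb \x lebt)%E.-integrable Q (EFin \o F).
Proof.
have [_ _ Fi _] := hsup; apply: integrableS Fi.
- by apply: measurableX => //; exact: measurable_itv.
- exact: measurable_Q.
- move=> [x t] [Ox] /=; rewrite in_itv/= => /andP[t0 tT]; split => //=.
  by rewrite in_itv/= (ltW t0).
Qed.

Lemma uQ_ge0 z : Q z -> 0 <= u z.1 z.2.
Proof.
by move=> [_] /=; rewrite in_itv/= => /andP[t0 tT]; rewrite hu// (ltW t0).
Qed.

(** Since p > 1 and Omega is bounded, u is dominated by 1 + C F, except at the
    origin, where the quotient defining F is 0. *)
Lemma u_integrable : (leb \x lebt)%E.-integrable Q (fun z => (u z.1 z.2)%:E).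
Proof.
pose Z : set V := [set x | enorm x <= 0] `*` (`]0, T[%classic : set (measurableTypeR R)).
have mZ : measurable Z by apply: measurableX => //; exact: measurable_cball.
have Z0 : (leb \x lebt)%E Z = 0%E.
  rewrite /Z product_measure1E//; last exact: measurable_cball.
  have E : leb [set x | enorm x <= 0] = 0%E.
    rewrite -(@lebesgue_rV_set0 R N N0); congr (leb _).
    apply/seteqP; split => x /=; last by move=> ->; rewrite enorm0.
    by move=> x0; apply: enorm_eq0; apply/eqP; rewrite eq_le x0 enorm_ge0.
  by rewrite [X in (X * _)%E]E mul0e.
have mQ := measurable_Q.
apply/(negligible_integrable mZ mQ) => //.
  by apply/measurable_EFinP; exact: measurable_uQ.
have mQZ : measurable (Q `\` Z) by exact: measurableD.
have i1 : (leb \x lebt)%E.-integrable (Q `\` Z) (EFin \o (fun=> 1 : R)).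
  apply: (@measurable_bounded_integrable _ _ _ (leb \x lebt)%E) => //.
    by apply: le_lt_trans Q_fin; apply: le_measure; rewrite ?inE.
  by exists 1; split => // x x1 z _; rewrite normr1 ltW.
have i2 : (leb \x lebt)%E.-integrable (Q `\` Z) (EFin \o (fun z => D `^ (2 * s) * F z)).
  apply: (integrableS mQ mQZ (@subDsetl _ _ _)).
  exact: (integrableZl mQ _ F_integrable).
apply: (le_integrable mQZ _ _ (integrableD mQZ i1 i2)).
  by apply/measurable_EFinP; exact: (measurable_funS mQ (@subDsetl _ _ _) measurable_uQ).
move=> z [Qz Zz]; rewrite /= lee_fin.
have u0 := uQ_ge0 Qz; rewrite ger0_norm// /F.
have z0 : 0 < enorm z.1.
  rewrite ltNge; apply/negP => z0; apply: Zz; split => //; by case: Qz.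
have zs : 0 < enorm z.1 `^ (2 * s) by rewrite powR_gt0.
apply: le_trans (ler_norm _).
have [u1|u1] := leP (u z.1 z.2) 1.
  by rewrite (le_trans u1)// lerDl mulr_ge0 ?powR_ge0// divr_ge0 ?powR_ge0.
apply: (@le_trans _ _ (u z.1 z.2 `^ p)); first by apply: le1r_powR; exact: ltW.
apply: (@le_trans _ _ (D `^ (2 * s) * (u z.1 z.2 `^ p / enorm z.1 `^ (2 * s)))).
  rewrite mulrCA ler_peMr ?powR_ge0// ler_pdivlMr// mul1r.
  have /andP[s0 _] := hs; case: Qz => /OD zD _.
  apply: ge0_ler_powR; rewrite ?nnegrE ?enorm_ge0 ?(ltW D0)//.
  by rewrite mulr_ge0// ltW.
by rewrite lerDr.
Qed.

Lemma u_mul_integrable (h : V -> R) (M : R) : measurable_fun setT h ->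
  (forall z, `|h z| <= M) ->
  (leb \x lebt)%E.-integrable Q (EFin \o (fun z => u z.1 z.2 * h z)).
Proof.
move=> mh hM; exact: (integrable_mul_boundedD measurable_Q u_integrable mh hM).
Qed.

Lemma fracL_le0 C (psi : 'rV[R]_N -> R) x : tame C psi ->
  (forall y, 0 <= psi y) -> psi x = 0 -> fracL s psi x <= 0.
Proof.
move=> pt p0 px; rewrite -(fracL0 s x); apply: (fracL_le hs pt tame0) => z.
rewrite /sdiff px mulr0 !subr0 sub0r.
by have := p0 (x + z); have := p0 (x - z); lra.
Qed.

(** Off Omega the fractional Laplacian of the test function is nonpositive, so
    the values of u there can be dropped. *)
Lemma weak_inequality K C eta deta (psi : 'rV[R]_N -> R) :
  tame1 K eta deta -> eta T = 0 -> tame C psi -> (forall x, 0 <= psi x) ->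
  (forall x, ~ Omega x -> psi x = 0) ->
  let lhs z := F z * (eta z.2 * psi z.1) in
  let rhs z :=
    u z.1 z.2 * (- deta z.2 * psi z.1 + eta z.2 * (a * fracL s psi z.1)) in
  [/\ (leb \x lebt)%E.-integrable Q (EFin \o lhs),
      (leb \x lebt)%E.-integrable Q (EFin \o rhs) &
      \int[(leb \x lebt)%E]_(z in Q) lhs z <= \int[(leb \x lebt)%E]_(z in Q) rhs z].
Proof.
move=> et eT pt p0 pO lhs rhs.
have a0 : 0 <= a by rewrite ltW// frac_lap_const_gt0.
have tc := product_test_class hs mO OD a0 et eT pt pO.
have [eK dK eL dL _] := et; have [pC _ _] := pt.
have e0 t : 0 <= eta t by have /andP[] := eK t.
have mQ := measurable_Q.
have mpsi : measurable_fun setT (fun z : V => psi z.1).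
  by apply: measurable_fst_comp; exact: tame_measurable pt.
have meta : measurable_fun setT (fun z : V => eta z.2).
  exact: measurable_snd_comp (measurable_eta et).
have mdeta : measurable_fun setT (fun z : V => deta z.2).
  apply: (@measurable_snd_comp _ _ _ (measurableTypeR R)).
  by apply: continuous_measurable_fun; exact: lip_continuous1 dL.
have mL : measurable_fun setT (fun z : V => fracL s psi z.1).
  by apply: measurable_fst_comp; exact: measurable_fracL pt.
have LB x : `|fracL s psi x| <= 2 * C * kmass (N := N) s.
  by apply: (fracL_bound hs); exact: pt.
have ebound t : `|eta t| <= K by rewrite ger0_norm; have /andP[] := eK t.
pose h1 (z : V) : R := - deta z.2 * psi z.1.
pose h2 (z : V) : R := eta z.2 * (a * fracL s psi z.1).
have i1 : (leb \x lebt)%E.-integrable Q (EFin \o (fun z => u z.1 z.2 * h1 z)).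
  apply: (@u_mul_integrable _ (K * C)).
    by apply: measurable_funM => //; exact: measurable_funN.
  by move=> z; rewrite normrM normrN; apply: ler_pM.
have i2 : (leb \x lebt)%E.-integrable Q (EFin \o (fun z => u z.1 z.2 * h2 z)).
  apply: (@u_mul_integrable _ (K * (a * (2 * C * kmass (N := N) s)))).
    by apply: measurable_funM => //; exact: measurable_funM.
  move=> z; rewrite normrM; apply: ler_pM => //.
  by rewrite normrM (ger0_norm a0) ler_wpM2l.
have i3 : (leb \x lebt)%E.-integrable Q (EFin \o (fun z => F z * (eta z.2 * psi z.1))).
  apply: (le_integrable mQ _ _ (integrableZl mQ (K * C) F_integrable)).
    apply/measurable_EFinP; apply: measurable_funM.
      by have /measurable_int/measurable_EFinP := F_integrable.
    by apply: measurable_funTS; exact: measurable_funM.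
  move=> z _ /=; rewrite lee_fin normrM [leRHS]normrM mulrC ler_wpM2r//.
  by apply: le_trans (ler_norm _); rewrite normrM; apply: ler_pM.
have := hsup => -[_ _ _ /(_ _ tc)].
move=> /(_ (fun x t _ => mulr_ge0 (e0 t) (p0 x))) H.
have E1 : (\int[(leb \x lebt)%E]_(z in Q)
    (- derive1 (fun t => eta t * psi z.1)%R z.2 * u z.1 z.2)%:E =
    \int[(leb \x lebt)%E]_(z in Q) (u z.1 z.2 * h1 z)%:E)%E.
  apply: eq_integral => z _; congr EFin.
  by rewrite (derive1_product psi et) /h1; ring.
pose QT : set V := setT `*` (`]0, T[%classic : set (measurableTypeR R)).
have E2 : (\int[(leb \x lebt)%E]_(z in QT)
      (u z.1 z.2 * frac_lap s (fun x => eta z.2 * psi x)%R z.1)%:E <=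
    \int[(leb \x lebt)%E]_(z in Q) (u z.1 z.2 * h2 z)%:E)%E.
  rewrite (eq_integral (fun z : V => (u z.1 z.2 * h2 z)%:E)); last first.
    by move=> z _; congr EFin; rewrite (frac_lap_product hs et pt).
  apply: integral_le_restrict => //.
  - exact: measurableX.
  - by move=> [x t] [].
  - apply/measurable_EFinP; apply: measurable_funM; first exact: measurable_uT.
    by apply: measurable_funTS; apply: measurable_funM => //; exact: measurable_funM.
  - move=> [x t] [_] /=; rewrite in_itv/= => /andP[t0 tT] nQ.
    have nO : ~ Omega x.
      by move=> Ox; apply: nQ; split => //=; rewrite in_itv/= t0.
    rewrite lee_fin /h2 /=; apply: mulr_ge0_le0; first by rewrite hu// (ltW t0).
    apply: mulr_ge0_le0 => //; apply: mulr_ge0_le0 => //.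
    by apply: fracL_le0 pt p0 _; exact: pO.
have E3 : (0 <= \int[leb]_(x in Omega) (u x 0 * (eta 0 * psi x))%:E)%E.
  apply: integral_ge0 => x _; rewrite lee_fin !mulr_ge0//.
  by rewrite hu// lexx.
have {H} H : (\int[(leb \x lebt)%E]_(z in Q) (F z * (eta z.2 * psi z.1))%:E <=
    \int[(leb \x lebt)%E]_(z in Q) (u z.1 z.2 * h1 z)%:E +
    \int[(leb \x lebt)%E]_(z in Q) (u z.1 z.2 * h2 z)%:E)%E.
  rewrite -E1; apply: le_trans (leeD2l _ E2).
  by apply: le_trans H; rewrite leeDl.
have ir : (leb \x lebt)%E.-integrable Q (EFin \o rhs).
  apply: eq_integrable (integrableD mQ i1 i2) => // z _.
  by rewrite /= -EFinD; congr EFin; rewrite /h1 /h2 /rhs; ring.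
split=> //; rewrite -lee_fin /Rintegral !fineK; [|exact: integrable_fin_num..].
apply: le_trans H _; rewrite -(integralD mQ i1 i2).
rewrite le_eqVlt; apply/orP; left; apply/eqP; apply: eq_integral => z _.
by rewrite -EFinD; congr EFin; rewrite /h1 /h2 /rhs; ring.
Qed.

Definition Qpunct : set V :=
  (Omega `\ 0) `*` (`]0, T[%classic : set (measurableTypeR R)).

Lemma measurable_set1_rV (x : 'rV[R]_N) : measurable [set x].
Proof.
rewrite (_ : [set x] = [set y | forall i, y ord0 i \in `[x ord0 i, x ord0 i]]).
  exact: measurable_box.
apply/seteqP; split => [y /= -> i|y /= H]; first by rewrite in_itv/= lexx.
apply/rowP => i; apply/eqP; rewrite eq_le; have := H i; rewrite in_itv/=.
by move=> /andP[-> ->].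
Qed.

Lemma measurable_Qpunct : measurable Qpunct.
Proof. by apply: measurableX => //; apply: measurableD => //; exact: measurable_set1_rV. Qed.

(** The null set where the potential is singular is removed, and u is extended
    by zero. *)
Definition punctured (z : V) : R := ((fun z => u z.1 z.2) \_ Qpunct) z.
Local Notation U := punctured.

Lemma punctured_ge0 z : 0 <= U z.
Proof.
rewrite /U /patch; case: ifPn => // /[!inE] -[[Ox _] I].
exact: (@uQ_ge0 (z.1, z.2)).
Qed.

Lemma punctured_neq0 z : U z != 0 -> [/\ z.1 != 0, Omega z.1 & 0 < z.2 < T].
Proof.
rewrite /U /patch; case: ifPn => [/[!inE] -[[Ox /eqP x0]]|]; last by rewrite eqxx.
by rewrite /= in_itv.
Qed.

Let punct (h : V -> R) :
  (leb \x lebt)%E.-integrable Q (EFin \o h) ->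
  (leb \x lebt)%E.-integrable setT (EFin \o (h \_ Qpunct)) /\
  \int[(leb \x lebt)%E]_(z in Q) h z = \int[(leb \x lebt)%E]_z (h \_ Qpunct) z.
Proof.
move=> hi; have mQ := measurable_Q; have mP := measurable_Qpunct.
have PQ : Qpunct `<=` Q by move=> z [[? _] ?].
split.
  by apply: (integrable_patch mP); exact: (integrableS mQ mP PQ hi).
rewrite -Rintegral_mkcond /Rintegral; congr fine.
pose Z : set V := [set 0] `*` (`]0, T[%classic : set (measurableTypeR R)).
have mZ : measurable Z by apply: measurableX => //; exact: measurable_set1_rV.
have Z0 : (leb \x lebt)%E Z = 0%E.
  rewrite /Z product_measure1E//; last exact: measurable_set1_rV.
  by rewrite [X in (X * _)%E](@lebesgue_rV_set0 R N N0) mul0e.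
rewrite (negligible_integral mZ mQ hi Z0); congr (integral _ _ _).
apply/seteqP; split => z.
  move=> [[Ox I] Zz]; split=> //; split=> // z0; apply: Zz; split=> //.
by move=> Pz; split; [exact: PQ|move=> [/= z0 _]; case: Pz => -[_]].
Qed.

Lemma weak_inequality_punctured K C eta deta (psi : 'rV[R]_N -> R) :
  tame1 K eta deta -> eta T = 0 -> tame C psi -> (forall x, 0 <= psi x) ->
  (forall x, ~ Omega x -> psi x = 0) ->
  \int[(leb \x lebt)%E]_z
    (U z `^ p / enorm z.1 `^ (2 * s) * (eta z.2 * psi z.1)) <=
  \int[(leb \x lebt)%E]_z
    (U z * (- deta z.2 * psi z.1 + eta z.2 * (a * fracL s psi z.1))).
Proof.
move=> et eT pt p0 pO; have [il ir le] := weak_inequality et eT pt p0 pO.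
have [_ El] := punct il; have [_ Er] := punct ir; move: le; rewrite El Er.
have pn0 : p != 0 by rewrite gt_eqF// (lt_trans ltr01).
rewrite (_ : _ \_ Qpunct = fun z => U z `^ p / enorm z.1 `^ (2 * s) * (eta z.2 * psi z.1)).
  rewrite (_ : _ \_ Qpunct = fun z => U z * (- deta z.2 * psi z.1 + eta z.2 * (a * fracL s psi z.1)))//.
  by apply/funext => z; rewrite /U /patch; case: ifP => //; rewrite mul0r.
by apply/funext => z; rewrite /U /patch; case: ifP => //; rewrite powR0// !mul0r.
Qed.

Lemma punctured_integrable : (leb \x lebt)%E.-integrable setT (EFin \o U).
Proof. by have [] := punct u_integrable. Qed.

Lemma punctured_F_integrable : (leb \x lebt)%E.-integrable setT
  (EFin \o (fun z => U z `^ p / enorm z.1 `^ (2 * s))).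
Proof.
have [H _] := punct F_integrable; apply: eq_integrable H => // z _ /=.
have pn0 : p != 0 by rewrite gt_eqF// (lt_trans ltr01).
by rewrite /U /patch; case: ifP => // _; rewrite powR0// mul0r.
Qed.

End supersolution.

(** * Mollification *)

Section mollification.
Context {R : realType} {N : nat} {d : measure_display} {T : measurableType d}.
Local Notation leb := (@lebesgue_rV R N).
Variables (s : R) (m : {sigma_finite_measure set T -> \bar R}).
Variables (X : T -> 'rV[R]_N) (Y : T -> R).
Hypothesis hs : 0 < s < 1.
Hypothesis mX : measurable_fun setT X.
Hypothesis mY : measurable_fun setT (Y : T -> measurableTypeR R).
Implicit Types (C K M : R) (W : T -> R) (g : 'rV[R]_N -> R).

Lemma integrable_mul_bounded M W (h : T -> R) :
  m.-integrable setT (EFin \o W) -> measurable_fun setT h ->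
  (forall z, `|h z| <= M) -> m.-integrable setT (EFin \o (fun z => W z * h z)).
Proof. exact: integrable_mul_boundedD. Qed.

Lemma Rintegral_mul_bounded M W (h : T -> R) :
  m.-integrable setT (EFin \o W) -> measurable_fun setT h ->
  (forall z, `|h z| <= M) ->
  `|\int[m]_z (W z * h z)| <= M * \int[m]_z `|W z|.
Proof.
move=> Wi mh hM; have Wh := integrable_mul_bounded Wi mh hM.
have Wn : m.-integrable setT (EFin \o (fun z => `|W z|)).
  by apply: eq_integrable (integrable_abse Wi).
apply: le_trans (le_normr_Rintegral _ Wh) _ => //.
rewrite -(RintegralZl M measurableT Wn).
apply: le_Rintegral => //.
- by apply: eq_integrable (integrable_abse Wh).
- exact: (integrableZl measurableT M Wn).
- by move=> z _; rewrite normrM mulrC ler_wpM2r.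
Qed.

Lemma measurable_translate g x : measurable_fun setT g ->
  measurable_fun setT (fun z => g (X z - x)).
Proof.
move=> mg; apply: (measurableT_comp mg).
exact: measurable_rVB.
Qed.

Lemma measurable_sdiff2 d' (T' : measurableType d') g (a b : T' -> 'rV[R]_N) :
  measurable_fun setT g -> measurable_fun setT a -> measurable_fun setT b ->
  measurable_fun setT (fun q => sdiff g (a q) (b q)).
Proof.
move=> mg ma mb; apply: measurable_funB; first apply: measurable_funB.
- by apply: measurable_funM => //; exact: (measurableT_comp mg ma).
- by apply: (measurableT_comp mg); exact: measurable_rVD.
- by apply: (measurableT_comp mg); exact: measurable_rVB.
Qed.

(** An average of translates of g: X z is the position of the point z, and W is
    the density of the average. *)
Definition mollify W g x : R := \int[m]_z (W z * g (X z - x)).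

Lemma mollify_integrable C W g x : m.-integrable setT (EFin \o W) -> tame C g ->
  m.-integrable setT (EFin \o (fun z => W z * g (X z - x))).
Proof.
move=> Wi gt; have [gC _ _] := gt.
apply: (integrable_mul_bounded (M := C)) => //.
by apply: measurable_translate; exact: tame_measurable gt.
Qed.

Lemma sdiff_mollify C W g x z : m.-integrable setT (EFin \o W) -> tame C g ->
  sdiff (mollify W g) x z = \int[m]_y (W y * sdiff g (X y - x) z).
Proof.
move=> Wi gt; have i x' := mollify_integrable x' Wi gt.
rewrite /sdiff /mollify -(RintegralZl 2 measurableT (i x)).
have i2 := integrableZl measurableT 2 (i x).
rewrite -(RintegralB measurableT i2 (i _)).
rewrite -(RintegralB measurableT (integrableB measurableT i2 (i (x + z))) (i _)).
apply: eq_Rintegral => y _; rewrite opprD addrA opprB (addrA (X y) z).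
by rewrite (addrAC (X y) z); ring.
Qed.

Lemma mollify_tame C W g : m.-integrable setT (EFin \o W) -> tame C g ->
  tame (C * \int[m]_z `|W z|) (mollify W g).
Proof.
move=> Wi gt; have [gC gL g2] := gt; have mg := tame_measurable gt.
split=> [x|x y|x z].
- by apply: Rintegral_mul_bounded => //; exact: measurable_translate.
- have i x' := mollify_integrable x' Wi gt.
  rewrite /mollify -(RintegralB measurableT (i x) (i y)).
  rewrite (_ : Rintegral _ _ _ = \int[m]_z (W z * (g (X z - x) - g (X z - y)))).
    rewrite mulrAC; apply: Rintegral_mul_bounded => //.
      by apply: measurable_funB; exact: measurable_translate.
    move=> z; apply: le_trans (gL _ _) _; rewrite (_ : X z - x - _ = y - x).
      by rewrite enormB.
    by rewrite opprB addrC addrA subrK.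
  by apply: eq_Rintegral => z _; rewrite mulrBr.
- rewrite (sdiff_mollify _ _ Wi gt) mulrAC.
  apply: Rintegral_mul_bounded => //.
  by apply: measurable_sdiff2 => //; exact: measurable_rVB.
Qed.

(** Fubini's theorem applies since second differences of g times the kernel are
    bounded by 4 C kmin, uniformly in the translation. *)
Lemma fracL_mollify C W g x : m.-integrable setT (EFin \o W) -> tame C g ->
  fracL s (mollify W g) x = \int[m]_z (W z * fracL s g (X z - x)).
Proof.
move=> Wi gt; have mg := tame_measurable gt.
have C0 := tame_ge0 gt.
have ki : leb.-integrable setT (EFin \o kmin (N := N) s) by exact: kmin_integrable.
have iy y : leb.-integrable setT
    (EFin \o (fun z => W y * (sdiff g (X y - x) z * ker s z))).
  exact: (integrableZl measurableT (W y) (sdiff_integrable hs _ gt)).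
have msd : measurable_fun setT
    (fun q : T * 'rV[R]_N => sdiff g (X q.1 - x) q.2).
  have mXx : measurable_fun setT (fun q : T * 'rV[R]_N => X q.1 - x).
    by apply: measurable_rVB => //; exact: measurableT_comp mX _.
  exact: measurable_sdiff2.
have Wm : measurable_fun setT W by have /measurable_int/measurable_EFinP := Wi.
have hi : (m \x leb)%E.-integrable setT
    (EFin \o (fun q => W q.1 * (sdiff g (X q.1 - x) q.2 * ker s q.2))).
  have := integrableZl measurableT (4 * C) (integrable_prod Wi ki).
  apply: le_integrable => //.
    apply/measurable_EFinP; apply: measurable_funM; first exact: measurable_fst_comp.
    by apply: measurable_funM => //; apply: measurable_snd_comp; exact: measurable_ker.
  move=> [y z] _ /=; rewrite lee_fin normrM.
  apply: (@le_trans _ _ (`|W y| * (4 * C * kmin s z))).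
    by rewrite ler_wpM2l//; exact: sdiff_ker_le gt.
  rewrite [leRHS]normrM [`|W y * _|]normrM !(ger0_norm (kmin_ge0 _ _)).
  by rewrite (ger0_norm (_ : 0 <= 4 * C)) ?mulr_ge0// mulrCA.
have iz z : m.-integrable setT
    (EFin \o (fun y => W y * (sdiff g (X y - x) z * ker s z))).
  have [gC _ _] := gt.
  apply: (integrable_mul_bounded (M := 4 * C * kmin s z)) => //.
    apply: measurable_funM => //.
    by apply: measurable_sdiff2 => //; exact: measurable_rVB.
  by move=> y; exact: sdiff_ker_le gt.
have E := fubini12 hi iy; rewrite (fubini21 hi iz) in E.
rewrite /fracL (_ : Rintegral _ _ _ =
    \int[leb]_z \int[m]_y (W y * (sdiff g (X y - x) z * ker s z))).
  rewrite E /=.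
  under [in RHS]eq_Rintegral => y _ do rewrite mulrA.
  have gW := fracL_bound hs _ gt.
  have ii : m.-integrable setT
     (EFin \o (fun y => W y * \int[leb]_z (sdiff g (X y - x) z * ker s z))).
    have M0 : m.-integrable setT (EFin \o (fun y => W y * fracL s g (X y - x))).
      apply: (integrable_mul_bounded (M := 2 * C * kmass (N := N) s)) => //.
      by apply: measurable_translate; exact: measurable_fracL gt.
    have := integrableZl measurableT 2 M0; apply: eq_integrable => //= y _.
    by congr EFin; rewrite /fracL; set I := Rintegral _ _ _; field.
  rewrite RintegralZr//; congr (_ / 2); apply: eq_Rintegral => y _.
  by rewrite (RintegralZl (W y) measurableT (sdiff_integrable hs _ gt)).
apply: eq_Rintegral => z _; rewrite (sdiff_mollify _ _ Wi gt).
have i1 : m.-integrable setT (EFin \o (fun y => W y * sdiff g (X y - x) z)).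
  apply: (integrable_mul_bounded (M := C * enorm z ^+ 2)) => //.
    by apply: measurable_sdiff2 => //; exact: measurable_rVB.
  by move=> y; have [_ _ ->] := gt.
rewrite -RintegralZr//; apply: eq_Rintegral => y _; by rewrite mulrA.
Qed.

Lemma mollify_time K W eta deta : m.-integrable setT (EFin \o W) ->
  (forall z, 0 <= W z) -> tame1 K eta deta ->
  tame1 (K * \int[m]_z W z) (fun t => \int[m]_z (W z * eta (Y z - t)))
    (fun t => \int[m]_z (W z * - deta (Y z - t))).
Proof.
move=> Wi W0 [eK dK eL dL tay].
have nW : \int[m]_z `|W z| = \int[m]_z W z.
  by apply: eq_Rintegral => z _; rewrite ger0_norm.
have mt t : measurable_fun setT (fun z : T => Y z - t : measurableTypeR R).
  by apply: measurable_funB.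
have me t : measurable_fun setT (fun z => eta (Y z - t)).
  apply: measurableT_comp (mt t).
  by apply: continuous_measurable_fun; exact: lip_continuous1 eL.
have md t : measurable_fun setT (fun z => - deta (Y z - t)).
  apply: measurable_funN; apply: measurableT_comp (mt t).
  by apply: continuous_measurable_fun; exact: lip_continuous1 dL.
have eN t : `|eta t| <= K by have /andP[e0 eK'] := eK t; rewrite ger0_norm.
have dN t : `|- deta t| <= K by rewrite normrN.
have ie t := integrable_mul_bounded Wi (me t) (fun z => eN _).
have id t := integrable_mul_bounded Wi (md t) (fun z => dN _).
rewrite -nW; split=> [t|t|t t'|t t'|t k].
- apply/andP; split.
    by apply: Rintegral_ge0 => z _; rewrite mulr_ge0//; have /andP[] := eK (Y z - t).
  by apply: le_trans (ler_norm _) _; apply: Rintegral_mul_bounded.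
- exact: Rintegral_mul_bounded.
- rewrite -(RintegralB measurableT (ie t) (ie t')).
  rewrite (_ : Rintegral _ _ _ =
    \int[m]_z (W z * (eta (Y z - t) - eta (Y z - t')))); last first.
    by apply: eq_Rintegral => z _; rewrite mulrBr.
  rewrite mulrAC; apply: Rintegral_mul_bounded => //; first exact: measurable_funB.
  move=> z; apply: le_trans (eL _ _) _; rewrite (_ : _ - _ - _ = - (t - t')); last by ring.
  by rewrite normrN.
- rewrite -(RintegralB measurableT (id t) (id t')).
  rewrite (_ : Rintegral _ _ _ =
    \int[m]_z (W z * (- deta (Y z - t) - - deta (Y z - t')))); last first.
    by apply: eq_Rintegral => z _; rewrite mulrBr.
  rewrite mulrAC; apply: Rintegral_mul_bounded => //; first exact: measurable_funB.
  move=> z; rewrite opprK addrC; apply: le_trans (dL _ _) _.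
  rewrite (_ : _ - _ - _ = t - t'); last by ring.
  exact: lexx.
- rewrite -(RintegralZl k measurableT (id t)).
  have ik := integrableZl measurableT k (id t).
  rewrite -(RintegralB measurableT (ie (t + k)) (ie t)).
  rewrite -(RintegralB measurableT (integrableB measurableT (ie (t + k)) (ie t)) ik).
  rewrite (_ : Rintegral _ _ _ = \int[m]_z (W z *
     (eta (Y z - (t + k)) - eta (Y z - t) - k * - deta (Y z - t)))); last first.
    by apply: eq_Rintegral => z _; ring.
  rewrite mulrAC; apply: Rintegral_mul_bounded => //.
    by apply: measurable_funB; [exact: measurable_funB|exact: measurable_funM].
  move=> z; apply: le_trans (_ : `|eta (Y z - t - k) - eta (Y z - t) - - k * deta (Y z - t)| <= _).
    by rewrite mulrN mulNr opprD addrA.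
  by rewrite -(sqrrN k); exact: tay.
Qed.

End mollification.

(** * A parabolic comparison principle *)

Section comparison.
Context {R : realType} {N : nat}.
Variables (s a r t1 t2 C K Cb : R) (v vt : 'rV[R]_N -> R -> R) (b : 'rV[R]_N -> R).
Hypothesis hs : 0 < s < 1.
Hypothesis a0 : 0 <= a.
Hypothesis vx : forall t, tame C (v ^~ t).
Hypothesis vT : forall x, tame1 K (v x) (vt x).
Hypothesis bt : tame Cb b.
Hypothesis b0 : forall x, 0 <= b x.
Hypothesis br : forall x, r <= enorm x -> b x = 0.

Let f (z : 'rV[R]_N * R) : R := v z.1 z.2 - (z.2 - t1) * b z.1.
Let Kc : set ('rV[R]_N * R) := [set x | enorm x <= r] `*` `[t1, t2]%classic.

Let vc : continuous (fun z : 'rV[R]_N * R => v z.1 z.2).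
Proof.
have C0 := tame_ge0 (vx 0).
have K0 : 0 <= K by have [/(_ 0)/andP[e1 e2] _ _ _ _] := vT 0; exact: le_trans e1 e2.
apply: (@lipschitz_continuous _ _ _ (C * N%:R + K)) => -[x t] [y t'] /=.
have xy : `|x - y| <= `|(x, t) - (y, t')| by rewrite prod_normE le_max lexx.
have tt' : `|t - t'| <= `|(x, t) - (y, t')| by rewrite prod_normE le_max lexx orbT.
have [_ + _] := vx t => /(_ x y) H1; have [_ _ /(_ t t') H2 _ _] := vT y.
rewrite (_ : _ - _ = (v x t - v y t) + (v y t - v y t')); last by ring.
apply: le_trans (ler_normD _ _) _; rewrite mulrDl; apply: lerD.
  apply: le_trans H1 _; rewrite -mulrA ler_wpM2l//.
  by apply: le_trans (enorm_le_norm _) _; rewrite ler_wpM2l.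
by apply: le_trans H2 _; rewrite ler_wpM2l.
Qed.

Let fc : continuous f.
Proof.
move=> z; apply: cvgB; first exact: vc.
apply: cvgM; first by apply: cvgB; [exact: cvg_snd|exact: cvg_cst].
by apply: continuous_comp; [exact: cvg_fst|exact: tame_continuous bt _].
Qed.

(** At a negative minimum of v - (t - t1) b over the cylinder the barrier
    (t - t1) b touches v from below, up to a constant, on the whole space (off
    the ball b vanishes and v is nonnegative), so fracL v lies below its
    fractional Laplacian, while the derivative in time of the difference is
    nonpositive. *)
Lemma parabolic_comparison :
  (forall x t, enorm x < r -> t1 < t <= t2 -> 0 < b x ->
     v x t < (t - t1) * b x ->
     b x + (t - t1) * (a * fracL s b x) < vt x t + a * fracL s (v ^~ t) x) ->
  forall x t, t1 <= t <= t2 -> (t - t1) * b x <= v x t.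
Proof.
move=> H x t t12'; have v0 y u : 0 <= v y u.
  by have [/(_ u)/andP[e1 e2] _ _ _ _] := vT y.
have [xr|xr] := leP r (enorm x); first by rewrite br// mulr0.
have cK : compact Kc.
  by apply: compact_setX; [exact: compact_cball|exact: segment_compact].
have K_n0 : Kc !=set0 by exists (x, t); split => /=; [exact: ltW|rewrite in_itv].
have [[x0 t0]] := compact_EVT_min K_n0 cK (continuous_subspaceT fc).
rewrite inE => -[/= x0r]; rewrite in_itv/= => /andP[t10 t02] fmin.
have [f0|f0] := leP 0 (f (x0, t0)).
  rewrite -subr_ge0; apply: le_trans f0 _; apply: (fmin (x, t)).
  by rewrite inE; split => /=; [exact: ltW|rewrite in_itv].
exfalso; pose c : R := t0 - t1; have c0 : 0 <= c by rewrite subr_ge0.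
have fx y : f (x0, t0) <= f (y, t0).
  have [yr|yr] := leP (enorm y) r.
    by apply: fmin; rewrite inE; split => //=; rewrite in_itv/= t10.
  by rewrite (le_trans (ltW f0))// /f/= br ?(ltW yr)// mulr0 subr0.
have bx0 : 0 < c * b x0.
  by apply: le_lt_trans (v0 x0 t0) _; move: f0; rewrite /f/= subr_lt0.
have bp : 0 < b x0.
  by rewrite lt_neqAle b0 andbT eq_sym; apply: contraTneq bx0 => ->; rewrite mulr0 ltxx.
have cp : 0 < c.
  by rewrite lt_neqAle c0 andbT eq_sym; apply: contraTneq bx0 => ->; rewrite mul0r ltxx.
have x0r' : enorm x0 < r.
  by rewrite ltNge; apply: contraTN bp => /br ->; rewrite ltxx.
have L : fracL s (v ^~ t0) x0 <= c * fracL s b x0.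
  rewrite -(fracLZ hs c x0 bt).
  apply: (fracL_le hs (vx t0) (tameZ c0 bt)) => z; rewrite /sdiff.
  have := fx (x0 + z); have := fx (x0 - z); rewrite /f/= -/c.
  by move: (c * b _) (c * b _) (c * b _) => p q p'; lra.
have VT : vt x0 t0 <= b x0.
  apply/ler_addgt0Pr => e e0.
  have K0 : 0 <= K by have [/(_ 0)/andP[e1 e2] _ _ _ _] := vT 0; exact: le_trans e1 e2.
  have K1 : 0 < K + 1 by rewrite ltr_wpDl.
  pose h : R := Num.min c (e / (K + 1)).
  have h0 : 0 < h by rewrite lt_min cp divr_gt0.
  have hc : h <= c by rewrite ge_min lexx.
  have he : K * h <= e.
    apply: (@le_trans _ _ ((K + 1) * h)); first by rewrite ler_wpM2r ?(ltW h0)// lerDl.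
    by rewrite mulrC -ler_pdivlMr// ge_min lexx orbT.
  have [_ _ _ _ /(_ t0 (- h))] := vT x0; rewrite ler_norml => /andP[_ tay].
  have : f (x0, t0) <= f (x0, t0 - h).
    apply: fmin; rewrite inE; split => //=; rewrite in_itv/=.
    by apply/andP; split; move: hc h0 t02; rewrite /c; lra.
  rewrite /f/=; set B := b x0 in tay *; set w := v x0 t0 in tay *.
  set w' := v x0 (t0 - h) in tay *; set d := vt x0 t0 in tay *.
  move=> ff; have : h * d <= h * (B + K * h).
    by move: ff tay; rewrite sqrrN; nra.
  by rewrite ler_pM2l//; lra.
have t0p : t1 < t0 by rewrite -subr_gt0.
have := H x0 t0 x0r'; rewrite t0p t02 => /(_ erefl bp).
move: f0; rewrite /f/= subr_lt0 => f0 /(_ f0); rewrite -/c.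
have : a * fracL s (v ^~ t0) x0 <= c * (a * fracL s b x0).
  by rewrite (_ : c * _ = a * (c * fracL s b x0)) ?ler_wpM2l// mulrCA.
move: (a * fracL s _ _) (c * _) => p q; lra.
Qed.

End comparison.

(** * Blow-up of concentrated supersolutions *)

Section growth.
Context {R : realType}.

Lemma exp_growth (y dy : R -> R) (K lam u1 u2 : R) : tame1 K y dy -> u1 <= u2 ->
  (forall t, u1 < t < u2 -> lam * y t <= dy t) ->
  y u1 * expR (lam * (u2 - u1)) <= y u2.
Proof.
move=> yt u12 H.
pose g (t : R) : R := expR (- lam * t) * y t.
have gd t : is_derive t (1 : R) g (expR (- lam * t) * (dy t - lam * y t)).
  have dyt : is_derive t (1 : R) y (dy t).
    by split; [exact: tame1_derivable yt|rewrite -derive1E (tame1_derive1 t yt)].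
  rewrite /g; apply: is_derive_eq.
  rewrite /GRing.scale/=; ring.
have yL : {within `[u1, u2], continuous g}.
  apply: derivable_within_continuous => t _; exact: ex_derive.
have mono : g u1 <= g u2.
  apply: (@ger0_derive1_le_cc _ g u1 u2) => //.
  - move=> t; rewrite in_itv/= => t12; rewrite derive1E; have [_ ->] := gd t.
    by rewrite mulr_ge0 ?expR_ge0// subr_ge0 H.
  - by rewrite in_itv/= lexx u12.
  - by rewrite in_itv/= lexx u12.
have e0 : 0 < expR (lam * u2) by exact: expR_gt0.
move: mono; rewrite /g -(ler_pM2l e0) !mulrA -!expRD !mulNr subrr expR0 mul1r.
by rewrite mulrC -mulrBr.
Qed.

Lemma exprn_powR (x y : R) (j : nat) : 0 <= x -> (x ^+ j) `^ y = (x `^ y) ^+ j.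
Proof. by move=> x0; rewrite -powR_mulrn// powRAC powR_mulrn// powR_ge0. Qed.

(** When 2^J < M all the terms are present and the sum is geometric; otherwise
    the last one vanishes. *)
Lemma dyadic_sum_le (q M e : R) (J : nat) : 1 < q -> 0 <= M ->
  (forall j : nat, 2 ^+ j < M -> q ^+ j <= e) -> 0 <= e ->
  \sum_(j < J) ((2 ^+ j < M)%R%:R * q ^+ j) <= q / (q - 1) * e.
Proof.
move=> q1 M0 qe e0; have q10 : 0 < q - 1 by rewrite subr_gt0.
have qq : 0 <= q / (q - 1) by rewrite divr_ge0 ?(ltW q10)// (le_trans ler01)// ltW.
elim: J => [|J IH]; first by rewrite big_ord0 mulr_ge0.
have [JM|JM] := ltP (2 ^+ J) M; last first.
  by rewrite big_ord_recr/= ltNge JM mul0r addr0.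
have q0 : 0 <= q by rewrite (le_trans ler01)// ltW.
apply: (@le_trans _ _ (\sum_(j < J.+1) q ^+ j)).
  by apply: ler_sum => j _; rewrite ler_piMl ?exprn_ge0//; case: ltP.
have := subrX1 q J.+1; move: (\sum_(j < J.+1) _) => S E.
have -> : S = (q ^+ J.+1 - 1) / (q - 1) by rewrite E mulrC mulKf// gt_eqF.
rewrite mulrAC ler_pM2r ?invr_gt0//; apply: (@le_trans _ _ (q ^+ J.+1)).
  by rewrite lerBlDr lerDl.
by rewrite exprS ler_wpM2l// qe.
Qed.

End growth.

Section barriers.
Context {R : realType} {N : nat}.
Local Notation leb := (@lebesgue_rV R N).
Variable s : R.
Hypothesis hs : 0 < s < 1.
Implicit Types (x : 'rV[R]_N) (l : nat -> R).

Lemma bump_sum_tame l J : (forall j, 0 < l j) ->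
  exists C, tame C (fun x => \sum_(j < J) ebump (l j *: x)).
Proof.
move=> l0; elim: J => [|J [C IH]].
  by exists 0; under eq_fun do rewrite big_ord0; exact: tame0.
exists (C + 40 * (1 + l J + l J ^+ 2)); under eq_fun do rewrite big_ord_recr/=.
exact: tameD IH (scaled_bump_tame (l0 J)).
Qed.

Lemma fracL_bump_sum l J x : (forall j, 0 < l j) ->
  fracL s (fun x => \sum_(j < J) ebump (l j *: x)) x =
  \sum_(j < J) (l j `^ (2 * s) * fracL s ebump (l j *: x)).
Proof.
move=> l0; elim: J => [|J IH].
  by rewrite [RHS]big_ord0 -[RHS](fracL0 s x); congr (fracL s _ x); apply/funext => y; rewrite big_ord0.
have [C Ct] := bump_sum_tame J l0.
rewrite big_ord_recr/= -IH -(fracL_scaled_bump hs x (l0 J)).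
rewrite -(fracLD hs x Ct (scaled_bump_tame (l0 J))); congr (fracL s _ x).
by apply/funext => y; rewrite big_ord_recr.
Qed.

End barriers.

Section blow_up.
Context {R : realType} {N : nat}.
Variables (s a p r t1 t2 m A B : R).
Hypothesis hs : 0 < s < 1.
Hypothesis a0 : 0 <= a.
Hypothesis p1 : 1 < p.
Hypothesis r0 : 0 < r.
Hypothesis t12 : t1 < t2.
Hypothesis m0 : 0 < m.
Hypothesis A0 : 0 <= A.
Hypothesis B0 : 0 <= B.
Implicit Types (x : 'rV[R]_N) (v : 'rV[R]_N -> R -> R).

(** The properties that a supersolution inherits after mollification at the
    scale dl: the source m comes from the mass far away, the second bound is the
    potential times the tangent at k of the convex function v ^ p, and the last
    two bounds hold because v is an average at the scale dl of an integrable
    function. *)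
Definition concentrated (dl : R) v vt : Prop :=
  [/\ exists C K, (forall t, tame C (v ^~ t)) /\ (forall x, tame1 K (v x) (vt x)),
      forall x t, enorm x < r -> t1 <= t <= t2 ->
        m <= vt x t + a * fracL s (v ^~ t) x,
      forall x t k, enorm x < r -> t1 <= t <= t2 -> 0 < k ->
        (enorm x + dl) `^ (- (2 * s)) *
          (k `^ (p - 1) * (p * v x t - (p - 1) * k)) <=
        vt x t + a * fracL s (v ^~ t) x,
      forall t, t1 <= t <= t2 ->
        a * fracL s (v ^~ t) 0 <= A * dl `^ (- (2 * s)) * v 0 t &
      forall t, t1 <= t <= t2 -> v 0 t <= B / dl ^+ N].

Let tm : R := (t1 + t2) / 2.
Let r' : R := r / 2.
Let s0 : 0 < s. Proof. by case/andP: hs. Qed.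
Let s20 : 0 < 2 * s. Proof. exact: mulr_gt0. Qed.
Let r'0 : 0 < r'. Proof. exact: divr_gt0. Qed.
Let tm12 : t1 < tm < t2. Proof. by move: t12; rewrite /tm; lra. Qed.

(** Comparison with (t - t1) c ebump (x / r), against the source m, which does
    not depend on dl. *)
Lemma uniform_lower_bound : exists2 c0 : R, 0 < c0 &
  forall dl v vt, concentrated dl v vt ->
  forall x t, enorm x <= r' -> tm <= t <= t2 -> c0 <= v x t.
Proof.
have ri : 0 < r^-1 by rewrite invr_gt0.
have km : 0 <= kmass (N := N) s by exact: kmass_ge0.
pose M1 : R := r^-1 `^ (2 * s) * (2 * 40 * kmass (N := N) s).
have M10 : 0 <= M1 by rewrite mulr_ge0 ?powR_ge0// mulr_ge0.
have tt0 : 0 <= t2 - t1 by rewrite subr_ge0 ltW.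
have Z0 : 0 <= (t2 - t1) * (a * M1) by exact: (mulr_ge0 tt0 (mulr_ge0 a0 M10)).
set Z : R := _ * (a * M1) in Z0.
(* The barrier (t - t1) c ebump (x / r) takes at most half of the source m. *)
pose c : R := m / (2 * (1 + Z)).
have Zp : 0 < 1 + Z by apply: ltr_pwDl.
have c0 : 0 < c by rewrite divr_gt0// mulr_gt0.
have cm : c * (1 + Z) = m / 2.
  by rewrite /c; move: (gt_eqF Zp) => /negbT nz; field; rewrite nz.
exists ((tm - t1) * (c * 2^-1)).
  apply: mulr_gt0; first by rewrite subr_gt0; case/andP: tm12.
  by apply: mulr_gt0 => //; rewrite invr_gt0.
move=> dl v vt [[C [K [vx vT]]] vm _ _ _] x t xr /andP[t1' t2'].
pose b x : R := c * ebump (r^-1 *: x).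
have bt : tame (c * (40 * (1 + r^-1 + r^-1 ^+ 2))) b.
  exact: (tameZ (ltW c0) (scaled_bump_tame ri)).
have /andP[tm1 tm2] := tm12.
have xr1 : enorm (r^-1 *: x) <= 1 / 2.
  by rewrite enormZ gtr0_norm// mulrC ler_pdivrMr// mul1r mulrC.
have bx : c * 2^-1 <= b x by rewrite ler_pM2l// -[leLHS]mul1r ebump_ge_half.
apply: (@le_trans _ _ ((t - t1) * b x)).
  by apply: ler_pM => //; rewrite ?subr_ge0 ?(ltW tm1)// ?lerB//; apply: mulr_ge0 => //; exact: ltW.
apply: (parabolic_comparison (t2 := t2) hs a0 vx vT bt (r := r)).
- by move=> y; rewrite mulr_ge0 ?(ltW c0)// ebump_ge0.
- move=> y yr; rewrite /b ebump_eq0 ?mulr0// enormZ gtr0_norm//.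
  by rewrite mulrC ler_pdivlMr// mul1r.
- move=> y u yr /andP[u1 u2] _ _; have u1' : t1 <= u <= t2 by rewrite (ltW u1).
  apply: lt_le_trans (vm _ _ yr u1').
  apply: (@le_lt_trans _ _ (c * (1 + Z))); last by rewrite cm; move: m0; lra.
  rewrite mulrDr mulr1; apply: lerD.
    by rewrite /b -[leRHS]mulr1 ler_wpM2l ?(ltW c0)// ebump_le1.
  rewrite [fracL _ _ _](fracLZ hs c y (scaled_bump_tame ri)).
  have LM : fracL s (fun x => ebump (r^-1 *: x)) y <= M1.
    rewrite (fracL_scaled_bump hs _ ri) ler_wpM2l ?powR_ge0//.
    exact: le_trans (ler_norm _) (fracL_bound hs _ (@ebump_tame R N)).
  rewrite (_ : _ * _ = c * ((u - t1) * (a * fracL s (fun x => ebump (r^-1 *: x)) y))); last by ring.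
  rewrite ler_wpM2l ?(ltW c0)// /Z.
  apply: (@le_trans _ _ ((u - t1) * (a * M1))).
    by rewrite ler_wpM2l ?subr_ge0 ?(ltW u1)// ler_wpM2l.
  by rewrite ler_wpM2r ?(mulr_ge0 a0 M10)// lerB.
- by rewrite t2' (le_trans (ltW tm1)).
Qed.

(** Against the singular potential |x|^(-2s), a sum of bumps on the dyadic
    scales down to dl is an admissible barrier, since its fractional Laplacian
    is also of size (|x| + dl)^(-2s); it forces v to be large at the origin. *)
Lemma logarithmic_lower_bound : exists2 k0 : R, 0 < k0 &
  forall J v vt, concentrated (r' / 2 ^+ J) v vt ->
  forall t, tm <= t <= t2 -> (t - tm) * (k0 * J%:R) <= v 0 t.
Proof.
have [c0 c0p low] := uniform_lower_bound.
have [C0 C00 bumpL] := fracL_bump_le (N := N) hs.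
have /andP[tm1 tm2] := tm12.
have tt0 : 0 <= t2 - tm by rewrite subr_ge0 ltW.
have ri0 : 0 <= r'^-1 by rewrite invr_ge0 ltW.
pose q : R := 2 `^ (2 * s).
have q1 : 1 < q.
  have := @gt0_ltr_powR R (2 * s) s20 1 2; rewrite !nnegrE powR1 => H.
  by apply: H; rewrite ?ltr1n.
have q0 : 0 < q by apply: lt_trans q1.
pose Cr : R := r'^-1 `^ (2 * s).
have Cr0 : 0 <= Cr by exact: powR_ge0.
pose E : R := 1 + (t2 - tm) * (a * (Cr * C0)).
have E1 : 1 <= E.
  by rewrite lerDl; exact: (mulr_ge0 tt0 (mulr_ge0 a0 (mulr_ge0 Cr0 C00))).
pose G : R := E * (q / (q - 1) * (2 * r') `^ (2 * s)).
have G0 : 0 < G.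
  apply: mulr_gt0; first exact: lt_le_trans ltr01 E1.
  apply: mulr_gt0; first by rewrite divr_gt0// subr_gt0.
  by rewrite powR_gt0// mulr_gt0.
have c0P : 0 < c0 `^ p by rewrite powR_gt0.
pose k0 : R := c0 `^ p / (2 * G).
have k00 : 0 < k0 by rewrite divr_gt0// mulr_gt0.
exists k0 => // J v vt vc t t12'.
have [[C [K [vx vT]]] _ vk _ _] := vc.
set dl : R := r' / 2 ^+ J in vc vk.
have dl0 : 0 < dl by rewrite divr_gt0// exprn_gt0.
pose l (j : nat) : R := 2 ^+ j / r'.
have l0 j : 0 < l j by rewrite divr_gt0// exprn_gt0.
have lq j : l j `^ (2 * s) = q ^+ j * Cr.
  rewrite /l powRM ?exprn_ge0//; congr (_ * _).
  by rewrite exprn_powR.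
pose S (x : 'rV[R]_N) : R := \sum_(j < J) ebump (l j *: x).
have [CS St] := bump_sum_tame (N := N) J l0.
have -> : k0 * J%:R = k0 * S 0.
  congr (_ * _); rewrite /S (eq_bigr (fun=> 1)) ?sumr_const ?card_ord//.
  by move=> j _; rewrite scaler0 ebump0.
have S0 x : 0 <= S x by apply: sumr_ge0 => j _; exact: ebump_ge0.
apply: (parabolic_comparison (t2 := t2) hs a0 vx vT (tameZ (ltW k00) St) (r := r')) t12'; last first.
- move=> x u xr /andP[u1 u2] _ _.
  have u12 : t1 <= u <= t2 by rewrite u2 (le_trans (ltW tm1))// ltW.
  have vxu : c0 <= v x u by apply: (low _ _ _ vc); rewrite ?(ltW xr)// u2 ltW.
  have xr2 : enorm x < r by apply: lt_trans xr _; rewrite /r' ltr_pdivrMr// ltr_pMr ?ltr1n.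
  apply: lt_le_trans (vk x u c0 xr2 u12 c0p).
  have xd : 0 < enorm x + dl by rewrite ltr_wpDl// enorm_ge0.
  set w : R := (enorm x + dl) `^ _.
  have w0 : 0 < w by rewrite powR_gt0.
  have vk' : c0 `^ p <= c0 `^ (p - 1) * (p * v x u - (p - 1) * c0).
    have -> : c0 `^ p = c0 `^ (p - 1) * c0.
      rewrite -[X in _ = _ * X](powRr1 (ltW c0p)) -powRD ?subrK//.
      by rewrite (gt_eqF c0p) implybT.
    by rewrite ler_wpM2l ?powR_ge0//; move: p1 vxu; move: (v x u) => y; nra.
  apply: (@lt_le_trans _ _ (w * c0 `^ p)); last by rewrite ler_wpM2l// ltW.
  rewrite [fracL _ _ _](fracLZ hs k0 x St) (fracL_bump_sum hs _ _ l0).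
  (* On the support of the j-th bump 2^j |x| < r', and 2^j dl <= r' as j < J. *)
  pose M : R := 2 * r' / (enorm x + dl).
  have M0 : 0 <= M by rewrite divr_ge0 ?(ltW xd)// mulr_ge0// ltW.
  have Mw : M `^ (2 * s) = (2 * r') `^ (2 * s) * w.
    rewrite /M (powRM _ (mulr_ge0 (ler0n _ 2) (ltW r'0))) ?invr_ge0 ?(ltW xd)//; congr (_ * _).
    by rewrite /w powRN -powR_inv1 ?(ltW xd)// -powRrM mulN1r powRN.
  have sumE : \sum_(j < J) (ebump (l j *: x) +
      (u - tm) * (a * (l j `^ (2 * s) * fracL s ebump (l j *: x)))) <= G * w.
    apply: (@le_trans _ _ (\sum_(j < J) (E * ((2 ^+ j < M)%R%:R * q ^+ j)))).
      apply: ler_sum => j _; set e := ebump _.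
      have e0 : 0 <= e by exact: ebump_ge0.
      have qj1 : 1 <= q ^+ j by rewrite exprn_ege1// ltW.
      have qj0 : 0 <= q ^+ j := le_trans ler01 qj1.
      have e1 : e <= (2 ^+ j < M)%R%:R.
        have [jM|jM] := ltP (2 ^+ j) M; first exact: ebump_le1.
        rewrite /e ebump_eq0// enormZ gtr0_norm// /l mulrAC ler_pdivlMr// mul1r.
        move: jM; rewrite /M ler_pdivrMr// mulrDr.
        have : 2 ^+ j * dl <= r'.
          rewrite /dl mulrCA ler_piMr ?(ltW r'0)// ler_pdivrMr ?exprn_gt0// mul1r.
          by rewrite ler_eXn2l ?ltr1n// ltnW.
        lra.
      have h1 : (u - tm) * (a * (l j `^ (2 * s) * fracL s ebump (l j *: x))) <=
          (t2 - tm) * (a * (q ^+ j * Cr * (C0 * e))).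
        rewrite lq; apply: (@le_trans _ _ ((u - tm) * (a * (q ^+ j * Cr * (C0 * e))))).
          apply: ler_wpM2l; first by rewrite subr_ge0 ltW.
          apply: ler_wpM2l => //; apply: ler_wpM2l; last exact: bumpL.
          exact: mulr_ge0 qj0 Cr0.
        apply: ler_wpM2r; last by rewrite lerB.
        exact: (mulr_ge0 a0 (mulr_ge0 (mulr_ge0 qj0 Cr0) (mulr_ge0 C00 e0))).
      apply: (@le_trans _ _ (E * (e * q ^+ j))).
        apply: (@le_trans _ _ (e * q ^+ j + (t2 - tm) * (a * (q ^+ j * Cr * (C0 * e))))).
          by apply: lerD => //; rewrite ler_peMr.
        by rewrite le_eqVlt /E; apply/orP; left; apply/eqP; ring.
      apply: ler_wpM2l; first exact: le_trans ler01 E1.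
      by apply: ler_wpM2r => //; exact: le_trans ler01 qj1.
    rewrite -mulr_sumr /G -!mulrA; apply: ler_wpM2l; first exact: le_trans ler01 E1.
    rewrite -Mw mulrA; apply: dyadic_sum_le => //; last exact: powR_ge0.
    move=> j jM; rewrite /q -exprn_powR//.
    by apply: ge0_ler_powR; rewrite ?nnegrE ?exprn_ge0// ?(ltW jM) ?(ltW s20).
  apply: (@le_lt_trans _ _ (k0 * (G * w))).
    apply: le_trans (_ : k0 * \sum_(j < J) _ <= _); last by apply: ler_wpM2l sumE; exact: ltW.
    rewrite big_split/= -mulr_sumr -mulr_sumr mulrDr.
    by rewrite le_eqVlt; apply/orP; left; apply/eqP; ring.
  have -> : k0 * (G * w) = w * c0 `^ p / 2.
    by rewrite /k0; move: G0 => /gt_eqF/negbT Gn; field; rewrite Gn.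
  have : 0 < w * c0 `^ p by exact: mulr_gt0.
  by move: (w * _) => y; lra.
- move=> x xr; rewrite big1 ?mulr0// => j _; apply: ebump_eq0.
  rewrite enormZ gtr0_norm// /l mulrAC ler_pdivlMr// mul1r (le_trans xr)//.
  by rewrite ler_peMl ?enorm_ge0// exprn_ege1// ler1n.
- by move=> x; exact: (mulr_ge0 (ltW k00) (S0 x)).
Qed.

(** For J large v 0 is at least k >= 1 on [t3, t2], with k^(p-1) >= A + 1. The
    tangent at k then gives y' >= dl^(-2s) y for y = v 0, hence y t2 is at least
    exp (dl^(-2s) d) with d = t2 - t3 independent of J, against y <= B / dl^N. *)
Lemma blow_up :
  (forall J : nat, exists v vt, concentrated (r' / 2 ^+ J) v vt) -> False.
Proof.
move=> H; have [k0 k00 low] := logarithmic_lower_bound.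
have /andP[tm1 tm2] := tm12.
pose d : R := (t2 - tm) / 2.
have d0 : 0 < d by rewrite divr_gt0// subr_gt0.
pose t3 : R := tm + d.
have t3m : tm < t3 by rewrite ltrDl.
have t32 : t3 + d = t2 by rewrite /t3 /d; lra.
(* 2 s n >= N + 1, so that dl^(-2sn) still beats dl^(-N) by a factor 1 / dl. *)
pose n := (Num.bound ((N%:R + 1) / (2 * s))).+1.
have nN : N%:R + 1 <= 2 * s * n%:R.
  have Q0 : 0 <= (N%:R + 1) / (2 * s) by rewrite divr_ge0// ltW.
  have := archi_boundP Q0; rewrite ltr_pdivrMr// mulrC => /ltW h.
  by apply: le_trans h _; rewrite ler_wpM2l ?(ltW s20)// ler_nat.
pose c1 : R := (1 + (A + 1) `^ ((p - 1)^-1)) / (d * k0).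
pose c2 : R := n%:R ^+ n * B * r' / d ^+ n.
have dk : 0 < d * k0 by exact: mulr_gt0.
have c10 : 0 <= c1.
  by apply: divr_ge0; [rewrite addr_ge0// powR_ge0|exact: ltW].
have nn0 : 0 <= n%:R ^+ n :> R by rewrite exprn_ge0.
have dn0 : 0 < d ^+ n by rewrite exprn_gt0.
have c20 : 0 <= c2.
  by apply: divr_ge0; [exact: (mulr_ge0 (mulr_ge0 nn0 B0) (ltW r'0))|exact: ltW].
have csum : 0 <= 1 + c1 + c2 + r' by rewrite !addr_ge0// ltW.
pose J := Num.bound (1 + c1 + c2 + r').
have JJ : 1 + c1 + c2 + r' < J%:R := archi_boundP csum.
have r'p := r'0.
have J0 : 0 < J%:R :> R by apply: le_lt_trans JJ.
have [v [vt vc]] := H J.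
have {low} low := low _ _ _ vc.
have [[C [K [vx vT]]] _ vk vA vB] := vc.
set dl : R := r' / 2 ^+ J in vc vk vA vB.
have dl0 : 0 < dl by rewrite divr_gt0// exprn_gt0.
have dlJ : dl <= r' / J%:R.
  rewrite ler_pM2l// lef_pV2 ?posrE ?exprn_gt0//.
  by rewrite -natrX ler_nat ltnW// ltn_expl.
have dl1 : dl <= 1.
  apply: le_trans dlJ _; rewrite ler_pdivrMr// mul1r.
  by apply/ltW; apply: le_lt_trans JJ; lra.
pose k : R := d * (k0 * J%:R).
have kA : 1 + (A + 1) `^ ((p - 1)^-1) <= k.
  rewrite /k mulrA mulrC -ler_pdivrMr// -/c1.
  by apply/ltW; apply: le_lt_trans JJ; move: c20; lra.
have A1 : 0 <= (A + 1) `^ ((p - 1)^-1) by exact: powR_ge0.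
have k1 : 1 <= k by apply: le_trans kA; rewrite lerDl.
have kp : 0 < k by exact: lt_le_trans ltr01 k1.
have p10 : 0 < p - 1 by rewrite subr_gt0.
have kA1 : A + 1 <= k `^ (p - 1).
  have Ap : 0 <= A + 1 by rewrite addr_ge0.
  have -> : A + 1 = (A + 1) `^ ((p - 1)^-1) `^ (p - 1).
    by rewrite -powRrM mulVf ?(gt_eqF p10)// powRr1.
  apply: ge0_ler_powR; rewrite ?nnegrE ?(ltW p10) ?powR_ge0 ?(ltW kp)//.
  by apply: le_trans kA; rewrite lerDr.
have vk3 t : t3 <= t <= t2 -> k <= v 0 t.
  move=> /andP[t3t tt2]; apply: (@le_trans _ _ ((t - tm) * (k0 * J%:R))); last first.
    by apply: low; rewrite tt2 (le_trans (ltW t3m)).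
  apply: ler_wpM2r; first by rewrite mulr_ge0// ltW.
  by move: t3t; rewrite /t3; lra.
pose lam : R := dl `^ (- (2 * s)).
have lam0 : 0 < lam by rewrite powR_gt0.
have grow t : t3 < t < t2 -> lam * v 0 t <= vt 0 t.
  move=> /andP[t3t tt2].
  have t12' : t1 <= t <= t2 by rewrite (ltW tt2) andbT; apply/ltW; apply: lt_trans tm1 (lt_trans t3m t3t).
  have vkt : k <= v 0 t by apply: vk3; rewrite !ltW.
  have e00 : enorm (0 : 'rV[R]_N) < r by rewrite enorm0.
  have := vk 0 t k e00 t12' kp; rewrite enorm0 add0r -/lam.
  have := vA t t12'; rewrite -/lam; set L := a * _; set y := v 0 t in vkt *.
  move=> LA; have y0 : 0 <= y by apply: le_trans vkt; exact: ltW.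
  have : (A + 1) * y <= k `^ (p - 1) * (p * y - (p - 1) * k).
    apply: (@le_trans _ _ (k `^ (p - 1) * y)); first exact: ler_wpM2r.
    by apply: ler_wpM2l; [exact: powR_ge0|move: vkt p1; nra].
  rewrite -(ler_pM2l lam0) => h1 h2.
  rewrite (_ : lam * y = lam * ((A + 1) * y) - A * lam * y); last by ring.
  rewrite lerBlDr; apply: le_trans h1 _; apply: le_trans h2 _.
  by rewrite lerD2l.
have u12 : t3 <= t2 by rewrite -t32 lerDl ltW.
have E := exp_growth (vT 0) u12 grow.
have t22 : t1 <= t2 <= t2 by rewrite lexx ltW.
have {E} E : expR (lam * d) <= B / dl ^+ N.
  apply: le_trans (vB t2 t22); apply: le_trans E.
  rewrite (_ : t2 - t3 = d); last by rewrite -t32 addrAC subrr add0r.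
  by rewrite ler_peMl ?expR_ge0// (le_trans k1)// vk3// lexx.
have P := pow_le_expR (Num.bound ((N%:R + 1) / (2 * s))) (mulr_ge0 (ltW lam0) (ltW d0)).
rewrite -/n in P.
have {P E} P : (lam * d) ^+ n <= n%:R ^+ n * (B / dl ^+ N).
  by apply: le_trans P _; exact: ler_wpM2l.
have lamn : 1 <= dl * (lam ^+ n * dl ^+ N).
  rewrite /lam -exprn_powR ?(ltW dl0)// -powR_mulrn ?(ltW dl0)// -powRrM.
  rewrite -(powR_mulrn N (ltW dl0)) -{1}(powRr1 (ltW dl0)).
  rewrite -!powRD ?(gt_eqF dl0) ?implybT//.
  rewrite -[leLHS](powRr0 dl); apply: ger_powR; first by rewrite dl0.
  by move: nN; rewrite mulrN (mulrC n%:R); lra.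
have dN : 0 < dl ^+ N by rewrite exprn_gt0.
have P2 : d ^+ n <= n%:R ^+ n * B * dl.
  apply: (@le_trans _ _ (dl * (lam ^+ n * dl ^+ N) * d ^+ n)).
    by rewrite ler_peMl// ltW.
  rewrite (_ : _ * d ^+ n = dl * dl ^+ N * (lam * d) ^+ n); last first.
    by rewrite [(lam * d) ^+ n]exprMn; move: (lam ^+ n) (dl ^+ N) (d ^+ n) => y1 y2 y3; ring.
  apply: le_trans (_ : _ <= dl * dl ^+ N * (n%:R ^+ n * (B / dl ^+ N))) _.
    by apply: ler_wpM2l P; apply: mulr_ge0; exact: ltW.
  by rewrite le_eqVlt; apply/orP; left; apply/eqP; field; rewrite gt_eqF.
have P3 : d ^+ n <= n%:R ^+ n * B * r' / J%:R.
  apply: le_trans P2 _; rewrite -[leRHS]mulrA; apply: ler_wpM2l dlJ; exact: mulr_ge0.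
have : J%:R <= c2.
  rewrite /c2 ler_pdivlMr// mulrC.
  by move: P3; rewrite ler_pdivlMr.
by apply/negP; rewrite -ltNge; apply: le_lt_trans JJ; move: c10; lra.
Qed.

End blow_up.

(** * Mass away from the origin forces blow-up *)

(** Young's inequality with the exponents p and p / (p - 1). *)
Lemma powR_tangent (R : realType) (p k y : R) : 1 < p -> 0 < k -> 0 <= y ->
  k `^ (p - 1) * (p * y - (p - 1) * k) <= y `^ p.
Proof.
move=> p1 k0 y0; have p0 : 0 < p by rewrite (lt_trans ltr01).
have p10 : 0 < p - 1 by rewrite subr_gt0.
have pn := gt_eqF p0; have p1n := gt_eqF p10.
have q0 : 0 < p / (p - 1) by rewrite divr_gt0.
have e : p^-1 + (p / (p - 1))^-1 = 1 by field; rewrite pn p1n.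
have := conjugate_powR y0 (powR_ge0 k (p - 1)) p0 q0 e.
rewrite -powRrM (_ : (p - 1) * (p / (p - 1)) = p); last by field; rewrite p1n.
have -> : k `^ p = k `^ (p - 1) * k.
  rewrite -[X in _ = _ * X](powRr1 (ltW k0)) -powRD ?subrK//.
  by rewrite (gt_eqF k0) implybT.
move: (k `^ _) (y `^ p) => K Y; rewrite -(ler_pM2l p0).
rewrite (_ : p * (Y / p + _) = Y + K * k * (p - 1)); last by field; rewrite pn p1n.
lra.
Qed.

Section core.
Context {R : realType} {N : nat}.
Local Notation leb := (@lebesgue_rV R N).
Local Notation lebt := (@lebesgue_measure R).
Local Notation V := ('rV[R]_N * measurableTypeR R)%type.
Local Notation mu := (product_sigma_finite leb lebt).
Variables (s a T p D r tau t1 t2 : R) (U : V -> R).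
Hypothesis hs : 0 < s < 1.
Hypothesis a0 : 0 < a.
Hypothesis hT : 0 < T.
Hypothesis hp : 1 < p.
Hypothesis D0 : 0 < D.
Hypothesis r0 : 0 < r.
Hypothesis tau0 : 0 < tau.
Hypothesis t12 : t1 < t2.
Hypothesis ttau : t2 - t1 <= tau / 2.
Hypothesis tauT : t2 + tau <= T.
Hypothesis U0 : forall z, 0 <= U z.
Hypothesis Ui : mu.-integrable setT (EFin \o U).
Hypothesis Fi : mu.-integrable setT
  (EFin \o (fun z => U z `^ p / enorm z.1 `^ (2 * s))).
Hypothesis Uz : forall z, U z != 0 ->
  [/\ z.1 != 0, enorm z.1 <= D & 0 < z.2 < T].

Hypothesis weak : forall K C eta deta (psi : 'rV[R]_N -> R),
  tame1 K eta deta -> eta T = 0 -> tame C psi -> (forall x, 0 <= psi x) ->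
  (forall x, 4 * r <= enorm x -> psi x = 0) ->
  \int[mu]_z (U z `^ p / enorm z.1 `^ (2 * s) * (eta z.2 * psi z.1)) <=
  \int[mu]_z (U z * (- deta z.2 * psi z.1 + eta z.2 * (a * fracL s psi z.1))).

(** The part of U that is averaged near the origin, and the part that acts on it
    from a distance. *)
Definition inner (z : V) : R := U z * (enorm z.1 < 4 * r)%R%:R.
Definition outer (z : V) : R :=
  U z * ((4 * r <= enorm z.1) && (t1 < z.2 < t2))%:R.
Local Notation w := inner.

Let inner_lt z : enorm z.1 < 4 * r -> inner z = U z /\ outer z = 0.
Proof.
move=> zr; have E : (4 * r <= enorm z.1) = false by rewrite leNgt zr.
split; first by rewrite /inner (_ : (_ < _) = true) ?mulr1.
by rewrite /outer (_ : (_ <= _) = false) ?mulr0.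
Qed.

Let inner_ge z : 4 * r <= enorm z.1 ->
  inner z = 0 /\ outer z = U z * (t1 < z.2 < t2)%R%:R.
Proof.
move=> zr; have E : (enorm z.1 < 4 * r) = false by rewrite ltNge zr.
split; first by rewrite /inner (_ : (_ < _) = false) ?mulr0.
by rewrite /outer (_ : (_ <= _) = true).
Qed.

Let Um : measurable_fun setT U.
Proof. by have /measurable_int/measurable_EFinP := Ui. Qed.

Let mball : measurable_fun setT (fun z : V => (enorm z.1 < 4 * r)%R%:R : R).
Proof.
apply: (@measurable_fst_comp _ _ _ _ _ (fun x => (enorm x < 4 * r)%R%:R)).
by apply: measurable_indic_bool; exact: measurable_eball.
Qed.

Lemma inner_ge0 z : 0 <= w z.
Proof. by rewrite mulr_ge0. Qed.

Lemma inner_integrable : mu.-integrable setT (EFin \o w).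
Proof.
apply: (integrable_mul_bounded (M := 1)) => // z.
by case: ltP; rewrite ?normr1 ?normr0.
Qed.

Lemma outer_integrable : mu.-integrable setT (EFin \o outer).
Proof.
apply: (integrable_mul_bounded (M := 1)) => //; last first.
  by move=> z; case: (_ && _); rewrite ?normr1 ?normr0.
apply: measurable_indic_bool.
rewrite (_ : [set _ | _] = (~` [set x | enorm x < 4 * r]) `*`
    (`]t1, t2[%classic : set (measurableTypeR R))).
  apply: measurableX; last exact: measurable_itv.
  by apply: measurableC; exact: measurable_eball.
apply/seteqP; split => z /=; rewrite in_itv/=.
  by move=> /andP[rz zt]; split=> //; apply/negP; rewrite -leNgt.
by move=> [/negP]; rewrite -leNgt => -> ->.
Qed.

Let Ib : R := \int[leb]_x ebump x.
Let Ib0 : 0 < Ib. Proof. exact: ebump_mass_gt0. Qed.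

Let far : R := (D + 2 * r) `^ (- (N%:R + 2 * s)).

Section scale.
Variable dl : R.
Hypothesis dl0 : 0 < dl.
Hypothesis dlr : dl <= r.

Let g (x : 'rV[R]_N) : R := ebump (dl^-1 *: x).
(* The integral over R^N x (0,T) of a translate of g is dl^N Ib T. *)
Let kap : R := (dl ^+ N * Ib * T)^-1.
Let eta (t t' : R) : R := bump1 ((t' - t) / tau).
Let deta (t t' : R) : R := dbump1 ((t' - t) / tau) / tau.

Definition average (x : 'rV[R]_N) (t : R) : R :=
  \int[mu]_z (kap * w z * g (z.1 - x) * eta 0 (z.2 - t)).
Definition average_dt (x : 'rV[R]_N) (t : R) : R :=
  \int[mu]_z (kap * w z * g (z.1 - x) * - deta 0 (z.2 - t)).

Let di : 0 < dl^-1. Proof. by rewrite invr_gt0. Qed.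
Let din : dl^-1 != 0. Proof. exact: lt0r_neq0. Qed.

Let gt : tame (40 * (1 + dl^-1 + dl^-1 ^+ 2)) g.
Proof. exact: scaled_bump_tame. Qed.

Let g0 x : 0 <= g x. Proof. exact: ebump_ge0. Qed.

Let g_eq0 x : dl <= enorm x -> g x = 0.
Proof.
move=> dx; apply: ebump_eq0; rewrite enormZ gtr0_norm// mulrC.
by rewrite ler_pdivlMr// mul1r.
Qed.

Let gx_tame x : tame (40 * (1 + dl^-1 + dl^-1 ^+ 2)) (fun x' => g (x' - x)).
Proof. exact: (tame_affine x di (@ebump_tame R N)). Qed.

Let fracL_gx x x' : fracL s (fun x' => g (x' - x)) x' = fracL s g (x' - x).
Proof.
have h1 := fracL_affine hs x x' di (@ebump_tame R N).
have h2 := fracL_scaled_bump hs (x' - x) di.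
exact: etrans h1 (esym h2).
Qed.

Let gx_integrable x : leb.-integrable setT (EFin \o (fun x' => g (x' - x))).
Proof.
have := integrable_affine (dl^-1 *: - x) din (@ebump_integrable R N).
by apply: eq_integrable => // y _ /=; rewrite /g scalerDr.
Qed.

Let gx_mass x : \int[leb]_x' g (x' - x) = dl ^+ N * Ib.
Proof.
have := Rintegral_affine (dl^-1 *: - x) din (@ebump_integrable R N).
rewrite gtr0_norm// exprVn invrK => <-.
by apply: eq_Rintegral => y _; rewrite /g scalerDr.
Qed.

Let kap0 : 0 < kap.
Proof. by rewrite invr_gt0 mulr_gt0// mulr_gt0// exprn_gt0. Qed.

Let eta_tame t : tame1 (64 * (1 + tau^-1 + tau^-1 ^+ 2)) (eta t) (deta t).
Proof. exact: tame1_bump1. Qed.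

Let eta0E t t' : eta 0 (t' - t) = eta t t'.
Proof. by rewrite /eta subr0. Qed.

Let deta0E t t' : deta 0 (t' - t) = deta t t'.
Proof. by rewrite /deta subr0. Qed.

Let mX : measurable_fun setT (fun z : V => z.1). Proof. exact: measurable_fst. Qed.
Let mY : measurable_fun setT ((fun z : V => z.2) : V -> measurableTypeR R).
Proof. exact: measurable_snd. Qed.

Let eta_m t : measurable_fun setT (fun z : V => eta t z.2).
Proof. exact: (measurable_snd_comp (measurable_eta (eta_tame t))). Qed.

Let deta_m t : measurable_fun setT (fun z : V => deta t z.2).
Proof.
have [_ _ _ dL _] := eta_tame t.
apply: (@measurable_snd_comp _ _ _ (measurableTypeR R)).
by apply: continuous_measurable_fun; exact: lip_continuous1 dL.
Qed.

Let mgx x : measurable_fun setT (fun z : V => g (z.1 - x)).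
Proof. exact: (measurable_fst_comp (tame_measurable (gx_tame x))). Qed.

Let kw_integrable : mu.-integrable setT (EFin \o (fun z => kap * w z)).
Proof. exact: (integrableZl measurableT kap inner_integrable). Qed.

Let Wt t (z : V) : R := kap * w z * eta t z.2.

Let Wt_integrable t : mu.-integrable setT (EFin \o Wt t).
Proof.
apply: (integrable_mul_bounded (M := 1)) => // z.
by rewrite ger0_norm ?bump1_ge0 ?bump1_le1.
Qed.

Let Wt_ge0 t z : 0 <= Wt t z.
Proof.
apply: mulr_ge0; last exact: bump1_ge0.
by apply: mulr_ge0; [exact: ltW|exact: inner_ge0].
Qed.

Let averageE t : average ^~ t = mollify mu (fun z : V => z.1) (Wt t) g.
Proof.
apply/funext => x; apply: eq_Rintegral => z _; rewrite eta0E /Wt.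
by rewrite mulrAC.
Qed.

Let average_tame : exists C K, (forall t, tame C (average ^~ t)) /\
  (forall x, tame1 K (average x) (average_dt x)).
Proof.
pose M : R := \int[mu]_z (kap * w z).
have M_ge (h : V -> R) : measurable_fun setT h -> (forall z, 0 <= h z <= 1) ->
    \int[mu]_z (kap * w z * h z) <= M.
  move=> mh h01; apply: le_Rintegral => //.
    apply: (integrable_mul_bounded (M := 1)) => // z.
    by have /andP[h0 h1] := h01 z; rewrite ger0_norm.
  move=> z _; have /andP[h0 h1] := h01 z.
  by rewrite ler_piMr// mulr_ge0 ?(ltW kap0) ?inner_ge0.
have tame_mono C C' f : C <= C' -> tame C f -> @tame R N C' f.
  move=> CC [fC fL f2]; split=> [x|x y|x z].
  - exact: le_trans (fC x) CC.
  - by apply: le_trans (fL x y) _; rewrite ler_wpM2r ?enorm_ge0.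
  - by apply: le_trans (f2 x z) _; rewrite ler_wpM2r ?sqr_ge0.
have tame1_mono K K' y dy : K <= K' -> tame1 K y dy -> @tame1 R K' y dy.
  move=> KK [h1 h2 h3 h4 h5]; split=> [t|t|t t'|t t'|t k].
  - by have /andP[-> /=] := h1 t; move=> /le_trans -> .
  - exact: le_trans (h2 t) KK.
  - by apply: le_trans (h3 t t') _; rewrite ler_wpM2r.
  - by apply: le_trans (h4 t t') _; rewrite ler_wpM2r.
  - by apply: le_trans (h5 t k) _; rewrite ler_wpM2r ?sqr_ge0.
exists ((40 * (1 + dl^-1 + dl^-1 ^+ 2)) * M).
exists ((64 * (1 + tau^-1 + tau^-1 ^+ 2)) * M); split.
  move=> t; rewrite averageE; apply: tame_mono (mollify_tame mX (Wt_integrable t) gt).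
  apply: ler_wpM2l; first exact: tame_ge0 gt.
  rewrite (_ : Rintegral _ _ _ = \int[mu]_z (kap * w z * eta t z.2)).
    by apply: M_ge => // z; rewrite bump1_ge0 bump1_le1.
  by apply: eq_Rintegral => z _; rewrite ger0_norm.
move=> x.
have gx1 z : 0 <= g (z - x) <= 1 by rewrite g0 ebump_le1.
have Wi : mu.-integrable setT (EFin \o (fun z => kap * w z * g (z.1 - x))).
  apply: (integrable_mul_bounded (M := 1)) => // z.
  by rewrite ger0_norm ?ebump_le1.
have W0 z : 0 <= kap * w z * g (z.1 - x).
  exact: (mulr_ge0 (mulr_ge0 (ltW kap0) (inner_ge0 z)) (g0 _)).
apply: tame1_mono (mollify_time mY Wi W0 (eta_tame 0)).
apply: ler_wpM2l; last exact: (M_ge _ (mgx x) (fun z => gx1 z.1)).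
by have [/(_ 0)/andP[e1 e2] _ _ _ _] := eta_tame 0; exact: le_trans e1 e2.
Qed.

Let average_dtE x t : average_dt x t =
  kap * \int[mu]_z (w z * (- deta t z.2 * g (z.1 - x))).
Proof.

have [eK dK _ _ _] := eta_tame t; have [gC _ _] := gt.
rewrite -(RintegralZl kap measurableT (_ : mu.-integrable _ (EFin \o (fun z => w z * (- deta t z.2 * g (z.1 - x)))))).
  by apply: eq_Rintegral => z _; rewrite deta0E; ring.
apply: (integrable_mul_bounded inner_integrable) => [|z].
  by apply: measurable_funM; [exact: (measurable_funN (deta_m t))|exact: mgx].
by rewrite normrM normrN; apply: ler_pM.
Qed.

Let Lg_bound y : `|fracL s g y| <= 2 * (40 * (1 + dl^-1 + dl^-1 ^+ 2)) * kmass (N := N) s.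
Proof. by apply: (fracL_bound hs); exact: gt. Qed.

Let mLg x : measurable_fun setT (fun z : V => fracL s g (z.1 - x)).
Proof.
apply: (measurable_translate mX).
exact: (measurable_fracL hs gt).
Qed.

Let average_LE x t : fracL s (average ^~ t) x =
  \int[mu]_z (Wt t z * fracL s g (z.1 - x)).
Proof. by rewrite averageE; exact: (fracL_mollify hs mX x (Wt_integrable t) gt). Qed.

Let average_LE' x t : a * fracL s (average ^~ t) x =
  kap * \int[mu]_z (w z * (eta t z.2 * (a * fracL s g (z.1 - x)))).
Proof.
rewrite average_LE.
have i1 := integrable_mul_bounded (Wt_integrable t) (mLg x) (fun z => Lg_bound _).
rewrite -(RintegralZl a measurableT i1).
rewrite -(RintegralZl kap measurableT (_ : mu.-integrable _ (EFin \o (fun z => w z * (eta t z.2 * (a * fracL s g (z.1 - x))))))).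
  by apply: eq_Rintegral => z _; rewrite /Wt; ring.
apply: (integrable_mul_bounded inner_integrable (M := 1 * (a * (2 * (40 * (1 + dl^-1 + dl^-1 ^+ 2)) * kmass (N := N) s)))) => [|z].
  by apply: measurable_funM => //; exact: measurable_funM.
rewrite normrM; apply: ler_pM => //; first by rewrite ger0_norm ?bump1_ge0 ?bump1_le1.
by rewrite normrM (gtr0_norm a0) ler_wpM2l// ltW.
Qed.

(** At the scale dl the inequality fracL_bump_le has the constant C0 dl^(-2s). *)
Let average_growth C0 x t : (forall y : 'rV[R]_N, fracL s ebump y <= C0 * ebump y) ->
  a * fracL s (average ^~ t) x <= a * C0 * dl `^ (- (2 * s)) * average x t.
Proof.
move=> C0L; rewrite -!mulrA; apply: ler_wpM2l; first exact: ltW.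
have -> : average x t = \int[mu]_z (Wt t z * g (z.1 - x)).
  by apply: eq_Rintegral => z _; rewrite eta0E /Wt mulrAC.
rewrite average_LE [leRHS]mulrA.
have iW : mu.-integrable setT (EFin \o (fun z => Wt t z * g (z.1 - x))).
  exact: (mollify_integrable mX x (Wt_integrable t) gt).
rewrite -(RintegralZl (C0 * dl `^ (- (2 * s))) measurableT iW).
apply: le_Rintegral => //.
- exact: (integrable_mul_bounded (Wt_integrable t) (mLg x) (fun z => Lg_bound _)).
- exact: (integrableZl measurableT _ (mollify_integrable mX x (Wt_integrable t) gt)).
move=> z _; rewrite [leRHS]mulrCA; apply: ler_wpM2l; first exact: Wt_ge0.
have -> : fracL s g (z.1 - x) = dl^-1 `^ (2 * s) * fracL s ebump (dl^-1 *: (z.1 - x)).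
  exact: fracL_scaled_bump.
have -> : dl^-1 `^ (2 * s) = dl `^ (- (2 * s)).
  by rewrite -powR_inv1 ?(ltW dl0)// -powRrM mulN1r.
rewrite (mulrC C0) -mulrA; apply: ler_wpM2l; first exact: powR_ge0.
exact: C0L.
Qed.

Let average_bound t : average 0 t <= (\int[mu]_z w z / (Ib * T)) / dl ^+ N.
Proof.
have -> : \int[mu]_z w z / (Ib * T) / dl ^+ N = kap * \int[mu]_z w z.
  rewrite /kap; have Ibn := lt0r_neq0 Ib0; have Tn := lt0r_neq0 hT.
  have dn : dl ^+ N != 0 by rewrite expf_neq0// lt0r_neq0.
  by move: (Rintegral _ _ _) => I; field; rewrite Ibn Tn dn.
rewrite -(RintegralZl kap measurableT inner_integrable).
have [g1 _ _] := gt.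
have -> : average 0 t = \int[mu]_z (Wt t z * g (z.1 - 0)).
  by apply: eq_Rintegral => z _; rewrite eta0E /Wt mulrAC.
apply: le_Rintegral => //.
- exact: (mollify_integrable mX 0 (Wt_integrable t) gt).
- move=> z _; apply: (@le_trans _ _ (Wt t z)).
    by rewrite ler_piMr// ebump_le1.
  rewrite /Wt ler_piMr ?bump1_le1//.
  exact: (mulr_ge0 (ltW kap0) (inner_ge0 z)).
Qed.

Let bump1_ge_half (q : R) : `|q| <= 1 / 2 -> 1 / 2 <= bump1 q.
Proof.
move=> q2; have q4 : q ^+ 2 <= 1 / 4.
  rewrite -real_normK ?num_real//; have := normr_ge0 q.
  by move: (`|q|) q2 => y; nra.
by rewrite /bump1 /cutoff max_r; move: q4; [nra|lra].
Qed.

(** The weak inequality tested with eta t and the translate of g by x. Where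
    |x'| >= 4 r the translate vanishes and fracL_far applies, and it turns the
    mass of outer into a source; eta t is at least 1 / 2 on (t1, t2) because this
    interval is shorter than tau / 2. *)
Let average_supersolution x t : enorm x <= r -> t1 <= t <= t2 ->
  kap * \int[mu]_z (U z `^ p / enorm z.1 `^ (2 * s) * (eta t z.2 * g (z.1 - x))) +
  kap * (a * (far * (dl ^+ N * Ib)) * ((\int[mu]_z outer z) / 2)) <=
  average_dt x t + a * fracL s (average ^~ t) x.
Proof.
move=> xr /andP[t1t tt2]; 
have eT : eta t T = 0.
  apply: bump1_eq0; rewrite ger0_norm; first by rewrite ler_pdivlMr// mul1r; move: tauT tt2; lra.
  by rewrite divr_ge0 ?(ltW tau0)//; move: tauT tt2 tau0; lra.
have gfar x' : 4 * r <= enorm x' -> g (x' - x) = 0.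
  move=> x'r; apply: g_eq0; have := enormD (x' - x) x; rewrite subrK.
  by move: dlr xr x'r r0; lra.
have W := weak (eta_tame t) eT (gx_tame x) (fun x' => g0 _) gfar.
rewrite average_dtE average_LE' -!mulrDr; apply: ler_wpM2l; first exact: ltW.
rewrite -lerBrDr; apply: le_trans W _.
have [eK dK _ _ _] := eta_tame t; have [gC _ _] := gt.
have ib : mu.-integrable setT (EFin \o (fun z => w z * (- deta t z.2 * g (z.1 - x)))).
  apply: (integrable_mul_bounded inner_integrable) => [|z].
    by apply: measurable_funM; [exact: (measurable_funN (deta_m t))|exact: mgx].
  by rewrite normrM normrN; apply: ler_pM.
have bnd z : `|eta t z.2 * (a * fracL s g (z.1 - x))| <= 1 * (a * (2 * (40 * (1 + dl^-1 + dl^-1 ^+ 2)) * kmass (N := N) s)).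
  rewrite normrM; apply: ler_pM => //; first by rewrite ger0_norm ?bump1_ge0 ?bump1_le1.
  by rewrite normrM (gtr0_norm a0) ler_wpM2l// ltW.
have mh : measurable_fun setT (fun z : V => eta t z.2 * (a * fracL s g (z.1 - x))).
  by apply: measurable_funM => //; exact: measurable_funM.
have ic := integrable_mul_bounded inner_integrable mh bnd.
pose c : R := a * (far * (dl ^+ N * Ib)) / 2.
have -> : a * (far * (dl ^+ N * Ib)) * ((\int[mu]_z outer z) / 2) = c * \int[mu]_z outer z.
  by rewrite /c; move: (a * (far * _)) (\int[mu]_z outer z) => y I; rewrite mulrA mulrAC.
rewrite -(RintegralZl c measurableT outer_integrable) -(RintegralD measurableT ib ic).
rewrite -(RintegralB measurableT (integrableD measurableT ib ic) (integrableZl measurableT c outer_integrable)).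
apply: le_Rintegral => //.
- apply: (integrable_mul_bounded Ui
    (M := 64 * (1 + tau^-1 + tau^-1 ^+ 2) * (40 * (1 + dl^-1 + dl^-1 ^+ 2)) + 1 * (a * (2 * (40 * (1 + dl^-1 + dl^-1 ^+ 2)) * kmass (N := N) s)))) => [|z].
    apply: measurable_funD; first by apply: measurable_funM; [exact: (measurable_funN (deta_m t))|exact: mgx].
    under eq_fun do rewrite fracL_gx; exact: mh.
  apply: le_trans (ler_normD _ _) _; apply: lerD.
    by rewrite normrM normrN; apply: ler_pM.
  by rewrite fracL_gx; exact: bnd.
- exact: (integrableB measurableT (integrableD measurableT ib ic) (integrableZl measurableT c outer_integrable)).
suff pw (z : V) : U z * (- deta t z.2 * g (z.1 - x) +
      eta t z.2 * (a * fracL s (fun x' => g (x' - x)) z.1)) <=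
    w z * (- deta t z.2 * g (z.1 - x)) +
    w z * (eta t z.2 * (a * fracL s g (z.1 - x))) - c * outer z.
  by move=> z _; exact: pw.
have [zr|zr] := ltP (enorm z.1) (4 * r).
  have [-> ->] := inner_lt zr; rewrite mulr0 subr0 fracL_gx -mulrDr.
  exact: lexx.
have [-> ->] := inner_ge zr; rewrite !mul0r !add0r.
rewrite (gfar _ zr) mulr0 add0r.
have [->|Uzn0] := eqVneq (U z) 0; first by rewrite !mul0r mulr0 oppr0.
have [_ zD _] := Uz Uzn0.
have Dr : 0 < D + 2 * r by rewrite addr_gt0// mulr_gt0.
have /= L := fracL_far hs Dr (gx_tame x) (fun y => g0 _) (gx_integrable x) (gfar _ zr).
have {L} L : fracL s (fun x' => g (x' - x)) z.1 <= - (far * (dl ^+ N * Ib)).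
  rewrite -(gx_mass x); apply: L => y yn0.
  have yd : enorm (y - x) < dl.
    by rewrite ltNge; apply: contra yn0 => /g_eq0 ->.
  have := enormD (y - x) (x - z.1); rewrite addrA subrK.
  have := enormD x (- z.1); rewrite enormN.
  by move: yd dlr xr zD; lra.
have e0 : 0 <= eta t z.2 by exact: bump1_ge0.
have fm : 0 <= a * (far * (dl ^+ N * Ib)).
  apply: mulr_ge0; first exact: ltW.
  apply: mulr_ge0; first exact: powR_ge0.
  by apply: mulr_ge0; [rewrite exprn_ge0// ltW|exact: ltW].
apply: (@le_trans _ _ (- (a * (far * (dl ^+ N * Ib)) * (U z * eta t z.2)))).
  rewrite (_ : U z * _ = U z * eta t z.2 * (a * fracL s (fun x' => g (x' - x)) z.1)); last by ring.
  rewrite mulrC -mulNr; apply: ler_wpM2r; first exact: mulr_ge0.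
  by rewrite -mulrN; apply: ler_wpM2l => //; exact: ltW.
rewrite lerN2 /c; move: (a * (far * _)) fm => y y0.
case: (boolP (t1 < z.2 < t2)) => [/andP[z1 z2]|_]; last first.
  by rewrite mulr0 mulr0; apply: mulr_ge0 => //; exact: mulr_ge0.
rewrite mulr1 (_ : y / 2 * U z = y * (U z * (1 / 2))); last by ring.
do 2![apply: ler_wpM2l => //]; apply: bump1_ge_half.
rewrite normrM normfV (gtr0_norm tau0) ler_pdivrMr// ler_norml.
by move: ttau t1t tt2 z1 z2; move=> ? ? ? ? ?; apply/andP; split; lra.
Qed.

(** The tangent inequality holds pointwise before averaging, and on the support
    of the test function the potential is at least (|x| + dl)^(-2s). *)
Let average_tangent x t k : enorm x <= r -> 0 < k ->
  (enorm x + dl) `^ (- (2 * s)) * (k `^ (p - 1) * (p * average x t - (p - 1) * k))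
  <= kap * \int[mu]_z (U z `^ p / enorm z.1 `^ (2 * s) * (eta t z.2 * g (z.1 - x))).
Proof.
move=> xr k0; have s20 : 0 < 2 * s by rewrite mulr_gt0//; case/andP: hs.
have p0 : 0 < p by rewrite (lt_trans ltr01).
have p10 : 0 < p - 1 by rewrite subr_gt0.
have c0 : 0 <= (enorm x + dl) `^ (- (2 * s)) * k `^ (p - 1).
  by apply: mulr_ge0; exact: powR_ge0.
set c : R := _ * k `^ _ in c0; rewrite mulrA -/c.
pose e (z : V) : R := eta t z.2 * g (z.1 - x).
have e0 z : 0 <= e z by apply: mulr_ge0; [exact: bump1_ge0|exact: g0].
have me : measurable_fun setT e by apply: measurable_funM; [exact: eta_m|exact: mgx].
have e1 z : `|e z| <= 1.
  rewrite ger0_norm//.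
  exact: (mulr_ile1 (bump1_ge0 _) (g0 _) (bump1_le1 _) (ebump_le1 _)).
pose TI (t' : measurableTypeR R) : R := \1_(`]0, T[%classic : set (measurableTypeR R)) t'.
have iT : (lebt : measure _ R).-integrable [set: measurableTypeR R] (EFin \o TI).
  exact: integrable_indic_itv.
have TIE : \int[lebt]_t' TI t' = T.
  rewrite /Rintegral integral_indic//.
  by rewrite setIT [X in fine X]lebesgue_measure_itv/= lte_fin hT -EFinB subr0.
have igT : mu.-integrable setT (EFin \o (fun z : V => g (z.1 - x) * TI z.2)).
  exact: (integrable_prod (gx_integrable x) iT).
have gTE : \int[mu]_z (g (z.1 - x) * TI z.2) = dl ^+ N * Ib * T.
  by have := Rintegral_prod (gx_integrable x) iT; rewrite gx_mass TIE.
have iwe := integrable_mul_bounded inner_integrable me e1.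
have -> : average x t = kap * \int[mu]_z (w z * e z).
  rewrite -(RintegralZl kap measurableT iwe); apply: eq_Rintegral => z _.
  by rewrite eta0E /e; ring.
have -> : p * (kap * \int[mu]_z (w z * e z)) - (p - 1) * k =
    kap * (p * \int[mu]_z (w z * e z) - (p - 1) * k * \int[mu]_z (g (z.1 - x) * TI z.2)).
  rewrite gTE /kap; have Ibn := lt0r_neq0 Ib0; have Tn := lt0r_neq0 hT.
  have dn : dl ^+ N != 0 by rewrite expf_neq0// lt0r_neq0.
  by move: (Rintegral _ _ _) Ibn dn Tn; move: Ib (dl ^+ N) => I0 d I In dn Tn; field; rewrite In Tn dn.
rewrite mulrCA; apply: ler_wpM2l; first exact: ltW.
have ip := integrableZl measurableT p iwe.
have ig := integrableZl measurableT ((p - 1) * k) igT.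
rewrite -(RintegralZl p measurableT iwe) -(RintegralZl ((p - 1) * k) measurableT igT).
rewrite -(RintegralB measurableT ip ig).
rewrite -(RintegralZl c measurableT (integrableB measurableT ip ig)).
apply: le_Rintegral => //.
- exact: (integrableZl measurableT c (integrableB measurableT ip ig)).
- exact: (integrable_mul_bounded Fi me e1).
suff pw (z : V) : c * (p * (w z * e z) - (p - 1) * k * (g (z.1 - x) * TI z.2)) <=
    U z `^ p / enorm z.1 `^ (2 * s) * e z by move=> z _; exact: pw.
have TI0 : 0 <= TI z.2 by rewrite /TI indicE ler0n.
have F0 : 0 <= U z `^ p / enorm z.1 `^ (2 * s).
  by apply: divr_ge0; exact: powR_ge0.
have pk0 : 0 <= (p - 1) * k by apply: mulr_ge0; exact: ltW.
have [gz|gz] := eqVneq (g (z.1 - x)) 0.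
  by rewrite /e gz !mulr0 mul0r mulr0 subr0 !mulr0.
have zd : enorm (z.1 - x) < dl by rewrite ltNge; apply: contra gz => /g_eq0 ->.
have zx : enorm z.1 < enorm x + dl.
  by have := enormD (z.1 - x) x; rewrite subrK; move: zd; lra.
have zr : enorm z.1 < 4 * r by move: zx xr dlr r0; lra.
have [-> _] := inner_lt zr.
have [->|Uz0] := eqVneq (U z) 0.
  rewrite mul0r mulr0 sub0r mulrN; apply: (@le_trans _ _ 0).
    by rewrite oppr_le0; apply: mulr_ge0 => //; apply: mulr_ge0 => //; exact: mulr_ge0.
  by apply: mulr_ge0 => //; apply: divr_ge0; exact: powR_ge0.
have [z1 _ zT] := Uz Uz0.
have -> : TI z.2 = 1 by rewrite /TI indicE mem_set//= in_itv.
rewrite mulr1; apply: (@le_trans _ _ (c * (p * U z - (p - 1) * k) * e z)).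
  rewrite -[leRHS]mulrA; apply: ler_wpM2l => //.
  move: ((p - 1) * k) pk0 => q q0; rewrite mulrBl -mulrA lerD2l lerN2.
  by apply: ler_wpM2l => //; rewrite /e ler_piMl// bump1_le1.
apply: ler_wpM2r => //.
have ez : 0 < enorm z.1.
  by rewrite lt_neqAle enorm_ge0 andbT eq_sym; apply: contra z1 => /eqP/enorm_eq0 ->.
apply: (@le_trans _ _ ((enorm x + dl) `^ (- (2 * s)) * U z `^ p)).
  by rewrite /c -mulrA; apply: ler_wpM2l; [exact: powR_ge0|exact: powR_tangent].
rewrite mulrC; apply: ler_wpM2l; first exact: powR_ge0.
rewrite powRN lef_pV2 ?posrE ?powR_gt0 ?(lt_trans ez zx)//.
by apply: ge0_ler_powR; rewrite ?nnegrE ?enorm_ge0 ?(ltW s20) ?(ltW zx)// (le_trans (ltW ez))// ltW.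
Qed.

Lemma average_concentrated C0 :
  0 < \int[mu]_z outer z -> (forall y : 'rV[R]_N, fracL s ebump y <= C0 * ebump y) ->
  concentrated s a p r t1 t2 (a * (far * ((\int[mu]_z outer z) / 2)) / T) (a * C0)
    (\int[mu]_z w z / (Ib * T)) dl average average_dt.
Proof.
move=> out0 C0L.
have S := average_supersolution.
have mE : kap * (a * (far * (dl ^+ N * Ib)) * ((\int[mu]_z outer z) / 2)) =
    a * (far * ((\int[mu]_z outer z) / 2)) / T.
  rewrite /kap; have Ibn := lt0r_neq0 Ib0; have Tn := lt0r_neq0 hT.
  have dn : dl ^+ N != 0 by rewrite expf_neq0// lt0r_neq0.
  move: (Rintegral _ _ _) Ibn dn Tn; move: Ib (dl ^+ N) far => I0 d f I In dn Tn.
  by field; rewrite In Tn dn.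
have m0 : 0 <= a * (far * ((\int[mu]_z outer z) / 2)) / T.
  apply: divr_ge0; last exact: ltW.
  apply: mulr_ge0; first exact: ltW.
  by apply: mulr_ge0; [exact: powR_ge0|apply: divr_ge0 => //; exact: ltW].
split.
- exact: average_tame.
- move=> x t xr tt; apply: le_trans (S x t (ltW xr) tt); rewrite mE lerDr.
  apply: mulr_ge0; first exact: ltW.
  apply: Rintegral_ge0 => z _; apply: mulr_ge0.
    by apply: divr_ge0; exact: powR_ge0.
  by apply: mulr_ge0; [exact: bump1_ge0|exact: g0].
- move=> x t k xr tt k0; apply: le_trans (S x t (ltW xr) tt); rewrite mE.
  by apply: le_trans (average_tangent t (ltW xr) k0) _; rewrite lerDl.
- by move=> t _; exact: average_growth.
- by move=> t _; exact: average_bound.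
Qed.

End scale.

(** Otherwise the averages at the scales (r / 2) 2^-J would contradict blow_up,
    with a source proportional to the integral of outer. *)
Lemma outer_eq0 : \int[mu]_z outer z = 0.
Proof.
have o0 z : 0 <= outer z by apply: mulr_ge0.
apply/eqP; rewrite eq_le; apply/andP; split; last by apply: Rintegral_ge0.
rewrite leNgt; apply/negP => out0.
have [C0 C00 C0L] := fracL_bump_le (N := N) hs.
have Dr : 0 < D + 2 * r by rewrite addr_gt0// mulr_gt0.
have m0 : 0 < a * (far * ((\int[mu]_z outer z) / 2)) / T.
  by apply: divr_gt0 => //; apply: mulr_gt0 => //; apply: mulr_gt0; [exact: powR_gt0|exact: divr_gt0].
have B0 : 0 <= \int[mu]_z w z / (Ib * T).
  apply: divr_ge0; last by rewrite mulr_ge0// ltW.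
  by apply: Rintegral_ge0 => z _; exact: inner_ge0.
apply: (blow_up (N := N) hs (ltW a0) hp r0 t12 m0 (mulr_ge0 (ltW a0) C00) B0) => J.
have dl0 : 0 < r / 2 / 2 ^+ J by rewrite divr_gt0 ?exprn_gt0// divr_gt0.
have dlr : r / 2 / 2 ^+ J <= r.
  rewrite ler_pdivrMr ?exprn_gt0// ler_pdivrMr// -mulrA ler_peMr ?(ltW r0)//.
  by rewrite mulr_ege1 ?exprn_ege1 ?ler1n.
exists (average (r / 2 / 2 ^+ J)), (average_dt (r / 2 / 2 ^+ J)).
exact: average_concentrated.
Qed.

End core.

(** * Vanishing inside the domain *)

Lemma Rintegral_eq0_ae d (T : measurableType d) (R : realType)
    (m : {measure set T -> \bar R}) (f : T -> R) :
  (forall z, 0 <= f z) -> m.-integrable setT (EFin \o f) -> \int[m]_z f z = 0 ->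
  m.-negligible [set z | f z != 0].
Proof.
move=> f0 fi fI; have mf : measurable_fun setT (EFin \o f) := measurable_int m fi.
have H : (\int[m]_(x in setT) `|(EFin \o f) x| = 0)%E.
  rewrite (eq_integral (EFin \o f)); last by move=> x _ /=; rewrite ger0_norm.
  have := integrable_fin_num measurableT fi; move: fI; rewrite /Rintegral.
  by move: (integral _ _ _) => -[y| |]//= ->.
have := (ae_eq_integral_abs m measurableT mf).1 H.
move=> A; apply: negligibleS A => z /= fz.
by move=> /(_ I) [] E; rewrite E eqxx in fz.
Qed.

Section interior.
Context {R : realType} {N : nat}.
Local Notation leb := (@lebesgue_rV R N).
Local Notation lebt := (@lebesgue_measure R).
Local Notation V := ('rV[R]_N * measurableTypeR R)%type.
Local Notation mu := (product_sigma_finite leb lebt).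
Variables (s T p D r0 : R) (Omega : set 'rV[R]_N) (u : 'rV[R]_N -> R -> R).
Hypothesis hs : 0 < s < 1.
Hypothesis N0 : (0 < N)%N.
Hypothesis hT : 0 < T.
Hypothesis hp : 1 < p.
Hypothesis mO : measurable Omega.
Hypothesis D0 : 0 < D.
Hypothesis OD : forall x, Omega x -> enorm x <= D.
Hypothesis r00 : 0 < r0.
Hypothesis Or : forall x, enorm x < 4 * r0 -> Omega x.
Hypothesis hu : forall x (t : R), 0 <= t < T -> 0 <= u x t.
Hypothesis hsup : weak_supersolution s Omega T
       (fun x t => u x t `^ p / enorm x `^ (2 * s)) u.

Local Notation U := (punctured T Omega u).

Let U0 z : 0 <= U z. Proof. exact: punctured_ge0. Qed.

Let Ui : mu.-integrable setT (EFin \o U).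
Proof. exact: (punctured_integrable hs N0 hT hp mO D0 OD hu hsup). Qed.

(** Every point of the punctured cylinder belongs to one of countably many sets
    to which outer_eq0 applies. *)
Lemma punctured_negligible : mu.-negligible [set z | U z != 0].
Proof.
have Fi := punctured_F_integrable N0 hp mO hsup.
pose tau (n : nat) : R := n.+1%:R^-1.
pose rn (n : nat) : R := r0 / n.+1%:R.
pose h n : R := tau n / 4.
have tau0 n : 0 < tau n by rewrite invr_gt0.
have rn0 n : 0 < rn n by rewrite divr_gt0.
have rnr n : rn n <= r0.
  by rewrite /rn ler_pdivrMr// ler_peMr ?(ltW r00)// ler1n.
(* The time windows have length 2 h and start at the multiples of h, so each time
   lies in the interior of one of them. *)
pose A (n k : nat) : set V := [set z | (h n * k.+1%:R + tau n <= T) &&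
  (outer (rn n) (h n * (k%:R - 1)) (h n * k.+1%:R) U z != 0)].
have AN n k : mu.-negligible (A n k).
  have [hT'|hT'] := boolP (h n * k.+1%:R + tau n <= T); last first.
    by apply: negligibleS (negligible_set0 _) => z /=; rewrite /A/= (negbTE hT').
  have h0 : 0 < h n by rewrite divr_gt0.
  have t12 : h n * (k%:R - 1) < h n * k.+1%:R.
    by rewrite ltr_pM2l// -natr1; lra.
  have tt : h n * k.+1%:R - h n * (k%:R - 1) <= tau n / 2.
    by rewrite -mulrBr -natr1 /h; move: (tau n) => y; rewrite (_ : _ - _ = 2); lra.
  have W K C eta deta (psi : 'rV[R]_N -> R) : tame1 K eta deta -> eta T = 0 ->
    tame C psi -> (forall x, 0 <= psi x) ->
    (forall x, 4 * rn n <= enorm x -> psi x = 0) ->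
    \int[mu]_z (U z `^ p / enorm z.1 `^ (2 * s) * (eta z.2 * psi z.1)) <=
    \int[mu]_z (U z * (- deta z.2 * psi z.1 + eta z.2 * (@frac_lap_const R N s * fracL s psi z.1))).
    move=> et eT pt p0 pr.
    apply: (weak_inequality_punctured hs N0 hT hp mO D0 OD hu hsup et eT pt p0) => x Ox.
    apply: pr; rewrite leNgt; apply/negP => xr; apply: Ox; apply: Or.
    by apply: lt_le_trans xr _; rewrite ler_pM2l.
  have Uz z : U z != 0 -> [/\ z.1 != 0, enorm z.1 <= D & 0 < z.2 < T].
    by move=> /punctured_neq0[z1 Oz zt]; split=> //; exact: OD.
  have a0 := frac_lap_const_gt0 N hs.
  have O := outer_eq0 hs a0 hT hp D0 (rn0 n) (tau0 n) t12 tt hT' U0 Ui Fi Uz W.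
  apply: negligibleS (Rintegral_eq0_ae _ _ O).
  - by move=> z /= /andP[].
  - by move=> z; apply: mulr_ge0.
  - exact: outer_integrable.
apply: negligibleS (negligible_bigcup (fun n => negligible_bigcup (AN n))).
move=> z /= Uz0; have [z1 Oz /andP[zt zT]] := punctured_neq0 Uz0.
have z0 : 0 < enorm z.1.
  by rewrite lt_neqAle enorm_ge0 andbT eq_sym; apply: contra z1 => /eqP/enorm_eq0 ->.
have Tz : 0 < T - z.2 by rewrite subr_gt0.
pose M : R := 4 * r0 / enorm z.1 + 2 / (T - z.2).
have M1 : 0 <= 4 * r0 / enorm z.1 by rewrite divr_ge0 ?(ltW z0)// mulr_ge0// ltW.
have M2 : 0 <= 2 / (T - z.2) by rewrite divr_ge0// ltW.
pose n := Num.bound M.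
have nM : M < n%:R by apply: archi_boundP; exact: addr_ge0.
have nM' : M <= n.+1%:R by rewrite (le_trans (ltW nM))// ler_nat.
have n0 : 0 < n.+1%:R :> R by rewrite ltr0n.
have rz : 4 * rn n <= enorm z.1.
  rewrite /rn mulrA ler_pdivrMr// [leRHS]mulrC -ler_pdivrMr//.
  by apply: le_trans nM'; rewrite lerDl.
have tz : 2 * tau n <= T - z.2.
  rewrite /tau ler_pdivrMr// [leRHS]mulrC -ler_pdivrMr//.
  by apply: le_trans nM'; rewrite lerDr.
have h0 : 0 < h n by rewrite divr_gt0.
have zh : 0 <= z.2 / h n by rewrite divr_ge0// ltW.
exists n => //; exists (Num.truncn (z.2 / h n)) => //.
have /andP[k1 k2] := truncn_itv zh.
have k1' : h n * (Num.truncn (z.2 / h n))%:R <= z.2 by rewrite mulrC -ler_pdivlMr.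
have k2' : z.2 < h n * (Num.truncn (z.2 / h n)).+1%:R by rewrite mulrC -ltr_pdivrMr.
rewrite /A /=; apply/andP; split.
  rewrite -natr1 mulrDr mulr1; move: k1' tz; rewrite /h; move: (tau0 n).
  by move: (tau n) ((Num.truncn _)%:R) => y q; lra.
rewrite /outer mulf_neq0//.
have -> : h n * ((Num.truncn (z.2 / h n))%:R - 1) < z.2.
  by rewrite mulrBr mulr1; move: k1' h0; lra.
by rewrite rz k2' oner_neq0.
Qed.

Let mUsec t : measurable_fun setT (fun x : 'rV[R]_N => (U (x, t))%:E).
Proof.
apply/measurable_EFinP.
have Um : measurable_fun setT U by have /measurable_int/measurable_EFinP := Ui.
apply: (measurableT_comp Um (f := U) (g := fun x : 'rV[R]_N => (x, t : measurableTypeR R))).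
exact: measurable_fun_pair.
Qed.

Let slices : lebt.-negligible
  [set t : measurableTypeR R | (\int[leb]_x (U (x, t))%:E != 0)%E].
Proof.
have mU := measurable_int mu Ui.
have U0e z : (0 <= (EFin \o U) z)%E by rewrite lee_fin.
have I0 : (\int[mu]_z `|(EFin \o U) z| = 0)%E.
  apply/(ae_eq_integral_abs mu measurableT mU).
  apply: negligibleS punctured_negligible => z /=.
  by apply: contra_notN => /eqP Uz _; rewrite Uz.
rewrite (eq_integral (EFin \o U)) in I0; last first.
  by move=> z _; rewrite gee0_abs.
have J0 : (\int[lebt]_t (\int[leb]_x (U (x, t))%:E) = 0)%E.
  by have := fubini_tonelli2 (m1 := leb) (m2 := lebt) (EFin \o U) mU U0e; rewrite I0 => ->.
have mG := measurable_fun_fubini_tonelli_G (m1 := leb) (EFin \o U) mU U0e.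
have G0 t : (0 <= fubini_G leb (EFin \o U) t)%E by apply: integral_ge0.
have H : (\int[lebt]_t `|fubini_G leb (EFin \o U) t| = 0)%E.
  rewrite (eq_integral (fubini_G leb (EFin \o U))); first exact: J0.
  by move=> t _; rewrite gee0_abs.
have A := (ae_eq_integral_abs lebt measurableT mG).1 H.
by apply: negligibleS A => t /= /eqP It /(_ I) E; apply: It; exact: E.
Qed.

(** Almost every time slice of u vanishes; by continuity in time with values in
    L^1, all of them do. *)
Lemma slice_vanish (t0 : R) : 0 <= t0 < T ->
  {ae leb, forall x, Omega x -> u x t0 = 0}.
Proof.
move=> /andP[t00 t0T]; have [_ uC _ _] := hsup.
have It0 : `[0, T[%classic t0 by rewrite /= in_itv/= t00.
have [mu0 u0fin cvg0] := uC t0 It0.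
have mn0 : measurable_fun Omega (fun x => (`|u x t0| ^+ 1)%:E).
  apply/measurable_EFinP; under eq_fun do rewrite expr1.
  exact: measurableT_comp.
set I0 := (\int[leb]_(x in Omega) _)%E in u0fin.
have I00 : (0 <= I0)%E by apply: integral_ge0.
have [I0E|I0n] := eqVneq I0 0%E.
  have H : (\int[leb]_(x in Omega) `| (`|u x t0| ^+ 1)%:E | = 0)%E.
    by rewrite -I0E; apply: eq_integral => x _; rewrite gee0_abs.
  have A := (ae_eq_integral_abs leb mO mn0).1 H.
  apply: negligibleS A => x /= /not_implyP[Ox ux] /(_ Ox) []; rewrite expr1.
  by move/eqP; rewrite normr_eq0 => /eqP.
exfalso; pose i : R := fine I0.
have iE : I0 = i%:E by rewrite fineK// ge0_fin_numE.
have i0 : 0 < i by rewrite -lte_fin -iE lt_neqAle eq_sym I0n.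
have := cvg0 _ (@nbhs_open_ereal_lt R 0 (fun=> i) i0).
rewrite !nbhs_simpl /= => /nbhs_ballP[e /= e0 He].
pose e' : R := Num.min (t0 + e) T.
have te' : t0 < e' by rewrite lt_min t0T ltrDl e0.
have [t [/andP[tt te] It]] : exists t : R, t0 < t < e' /\ (\int[leb]_x (U (x, t))%:E = 0)%E.
  apply: contrapT => Hn.
  have mI : measurable (`]t0, e'[%classic : set (measurableTypeR R)) by exact: measurable_itv.
  have H : lebt.-negligible (`]t0, e'[%classic : set (measurableTypeR R)).
    apply: negligibleS slices => t /=; rewrite in_itv/= => tt; apply/eqP => It.
    by apply: Hn; exists t.
  have E : lebt (`]t0, e'[%classic : set (measurableTypeR R)) = (e' - t0)%:E.
    by rewrite lebesgue_measure_itv/= lte_fin te' -EFinB.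
  have := (negligibleP lebt mI).1 H; rewrite [X in X = _]E => -[] /eqP.
  by rewrite subr_eq0 => /eqP E'; rewrite E' ltxx in te'.
have tT : 0 < t < T.
  by rewrite (le_lt_trans t00 tt) (lt_le_trans te)// ge_min lexx orbT.
have It1 : `[0, T[%classic t by rewrite /= in_itv/= ltW; case/andP: tT.
have [mut _ _] := uC t It1.
have tb : ball t0 e t.
  rewrite /ball/= distrC ger0_norm ?subr_ge0 ?(ltW tt)// ltrBlDl.
  by apply: lt_le_trans te _; rewrite ge_min lexx.
have := He t tb It1; rewrite /= -iE; apply/negP; rewrite -leNgt.
rewrite le_eqVlt; apply/orP; left; apply/eqP.
have Us := (ae_eq_integral_abs leb measurableT (mUsec t)).1.
have {}Us : ae_eq leb setT (fun x => (U (x, t))%:E) (cst 0%E).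
  by apply: Us; rewrite -It; apply: eq_integral => x _; rewrite gee0_abs// lee_fin.
apply: ae_eq_integral => //.
  apply/measurable_EFinP; under eq_fun do rewrite expr1.
  by apply: measurableT_comp => //; exact: measurable_funB.
have Z : leb.-negligible [set (0 : 'rV[R]_N)].
  by apply/negligibleP; [exact: measurable_set1_rV|exact: lebesgue_rV_set0].
apply: negligibleS (negligibleU Us Z) => x /= /not_implyP[Ox nE].
have [->|x0] := eqVneq x 0; first by right.
left => /(_ I) [] UE; apply: nE; rewrite /= !expr1.
have : U (x, t) = u x t.
  rewrite /punctured /patch ifT// inE; split=> /=; last by rewrite in_itv.
  by split=> //; apply/eqP.
by rewrite UE => <-; rewrite sub0r normrN.
Qed.

Let nullQ : mu.-negligible [set z : V | Qcyl T Omega z /\ u z.1 z.2 <> 0].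
Proof.
pose Z : set V := [set 0] `*` (`]0, T[%classic : set (measurableTypeR R)).
have mZ : measurable Z.
  by apply: measurableX; [exact: measurable_set1_rV|exact: measurable_itv].
have Z0 : mu.-negligible Z.
  apply/(negligibleP _ mZ); rewrite /= /Z product_measure1E//; last exact: measurable_set1_rV.
  by rewrite [X in (X * _)%E](@lebesgue_rV_set0 R N N0) mul0e.
apply: negligibleS (negligibleU punctured_negligible Z0) => z [[Oz tz] uz].
have [z1|z1] := pselect (z.1 = 0); first by right; split.
left => /=; apply/eqP => Uz0; apply: uz; rewrite -Uz0.
by rewrite /punctured /patch ifT// inE; split.
Qed.

(** Off Omega the fractional Laplacian of a test function that is positive in a
    ball around the origin is strictly negative, so that the weak inequality
    with u = 0 in Omega forces u to vanish there too. *)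
Lemma vanish_everywhere :
  {ae (leb \x lebt)%E, forall z : 'rV[R]_N * R, 0 < z.2 < T -> u z.1 z.2 = 0}.
Proof.
pose l : R := (4 * r0)^-1.
have r4 : 0 < 4 * r0 by rewrite mulr_gt0.
have l0 : 0 < l by rewrite invr_gt0.
pose psi (x : 'rV[R]_N) : R := ebump (l *: x).
have pt : tame (40 * (1 + l + l ^+ 2)) psi by exact: scaled_bump_tame.
have p0 x : 0 <= psi x by exact: ebump_ge0.
have lO x : ~ Omega x -> 1 <= enorm (l *: x).
  move=> Ox; rewrite enormZ gtr0_norm// mulrC ler_pdivlMr// mul1r leNgt.
  by apply/negP => /Or.
have pO x : ~ Omega x -> psi x = 0 by move=> /lO; exact: ebump_eq0.
have Lneg x : ~ Omega x -> fracL s psi x < 0.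
  move=> /lO lx; rewrite [fracL _ _ _](fracL_scaled_bump hs x l0).
  by rewrite pmulr_rlt0 ?powR_gt0// fracL_bump_lt0.
pose eta (t : R) : R := bump1 ((t - 0) / T).
pose deta (t : R) : R := dbump1 ((t - 0) / T) / T.
have et : tame1 (64 * (1 + T^-1 + T^-1 ^+ 2)) eta deta by exact: tame1_bump1.
have eT : eta T = 0 by apply: bump1_eq0; rewrite subr0 divff ?normr1 ?lt0r_neq0.
have e0 t : 0 <= eta t by exact: bump1_ge0.
have ep t : 0 < t < T -> 0 < eta t.
  move=> /andP[t0 tT]; apply: cutoff_gt0; rewrite subr0 expr_lt1//.
    by rewrite ltr_pdivrMr// mul1r.
  by rewrite divr_ge0// ltW.
have a0 := frac_lap_const_gt0 N hs.
have tc := product_test_class hs mO OD (ltW a0) et eT pt pO.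
have [_ _ _ /(_ _ tc)] := hsup.
move=> /(_ (fun x t _ => mulr_ge0 (e0 t) (p0 x))) H.
pose QT : set V := setT `*` (`]0, T[%classic : set (measurableTypeR R)).
have mQT : measurable QT by apply: measurableX => //; exact: measurable_itv.
have mQ : measurable (Qcyl T Omega) by exact: (measurable_Q T mO).
pose h1 (z : V) : R := - deta z.2 * psi z.1.
pose h2 (z : V) : R := eta z.2 * (@frac_lap_const R N s * fracL s psi z.1).
pose f (z : V) : \bar R := (u z.1 z.2 * h2 z)%:E.
have mpsi : measurable_fun setT (fun z : V => psi z.1).
  exact: (measurable_fst_comp (tame_measurable pt)).
have meta : measurable_fun setT (fun z : V => eta z.2).
  exact: measurable_snd_comp (measurable_eta et).
have mdeta : measurable_fun setT (fun z : V => deta z.2).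
  have [_ _ _ dL _] := et.
  apply: (@measurable_snd_comp _ _ _ (measurableTypeR R)).
  by apply: continuous_measurable_fun; exact: lip_continuous1 dL.
have mL : measurable_fun setT (fun z : V => fracL s psi z.1).
  exact: (measurable_fst_comp (measurable_fracL hs pt)).
have mh1 : measurable_fun setT h1.
  by apply: measurable_funM => //; exact: (measurable_funN mdeta).
have mh2 : measurable_fun setT h2.
  by apply: measurable_funM => //; exact: measurable_funM.
have mf : measurable_fun QT f.
  apply/measurable_EFinP; apply: measurable_funM; first exact: (measurable_uT hsup).
  exact: measurable_funTS.
have E1 : (\int[mu]_(z in Qcyl T Omega)
    (- derive1 (fun t => eta t * psi z.1)%R z.2 * u z.1 z.2)%:E = 0)%E.
  rewrite (eq_integral (fun z : V => (u z.1 z.2 * h1 z)%:E)); last first.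
    by move=> z _; congr EFin; rewrite (derive1_product psi et) /h1; ring.
  rewrite (ae_eq_integral (cst 0%E)) ?integral0//.
    apply/measurable_EFinP; apply: measurable_funM; first exact: (measurable_uQ hsup).
    exact: measurable_funTS.
  apply: negligibleS nullQ => z /= /not_implyP[Qz nE]; split=> // uz; apply: nE.
  by rewrite uz mul0r.
have E2 : (\int[mu]_(z in QT)
      (u z.1 z.2 * frac_lap s (fun x => eta z.2 * psi x)%R z.1)%:E =
    - \int[mu]_(z in QT) `|f z|)%E.
  rewrite -integral_ge0N//.
  rewrite (eq_integral f); last first.
    by move=> z _; congr EFin; rewrite (frac_lap_product hs et pt).
  apply: ae_eq_integral => //.
    by apply: measurableT_comp => //; exact: measurableT_comp.
  apply: negligibleS nullQ => z /= /not_implyP[[_ zt] nE].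
  have zt' : 0 < z.2 < T by move: zt; rewrite /= in_itv.
  have u0 : 0 <= u z.1 z.2 by rewrite hu//; case/andP: zt' => /ltW -> ->.
  have [Oz|Oz] := pselect (Omega z.1).
    by split; [split|move=> uz; apply: nE; rewrite /f uz mul0r normr0 oppr0].
  exfalso; apply: nE; rewrite /f /= ler0_norm ?opprK//.
  apply: mulr_ge0_le0 => //; apply: mulr_ge0_le0 => //.
  by apply: mulr_ge0_le0; [exact: ltW|exact/ltW/Lneg].
have E3 : (0 <= \int[mu]_(z in Qcyl T Omega)
    (u z.1 z.2 `^ p / enorm z.1 `^ (2 * s) * (eta z.2 * psi z.1))%:E)%E.
  apply: integral_ge0 => z _; rewrite lee_fin; apply: mulr_ge0.
    by apply: divr_ge0; exact: powR_ge0.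
  exact: (mulr_ge0 (e0 _) (p0 _)).
have E4 : (0 <= \int[leb]_(x in Omega) (u x 0 * (eta 0 * psi x))%:E)%E.
  apply: integral_ge0 => x _; rewrite lee_fin; apply: mulr_ge0.
    by rewrite hu// lexx.
  exact: (mulr_ge0 (e0 0) (p0 x)).
have f0 : (\int[mu]_(z in QT) `|f z| = 0)%E.
  apply/eqP; rewrite eq_le integral_ge0// andbT -oppe_ge0 -E2.
  have : (0 <= \int[mu]_(z in Qcyl T Omega)
      (- derive1 (fun t => eta t * psi z.1)%R z.2 * u z.1 z.2)%:E +
    \int[mu]_(z in QT)
      (u z.1 z.2 * frac_lap s (fun x => eta z.2 * psi x)%R z.1)%:E)%E.
    exact: (le_trans (adde_ge0 E3 E4) H).
  by rewrite E1 add0e.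
have A := (ae_eq_integral_abs mu mQT mf).1 f0.
apply: negligibleS (negligibleU A nullQ) => z /= /not_implyP[zt uz].
have zI : `]0, T[%classic z.2 by rewrite /= in_itv.
have [Oz|Oz] := pselect (Omega z.1); first by right; split=> //; split.
left => fz; have QTz : QT z by split.
have hn : h2 z < 0.
  by rewrite /h2 (pmulr_rlt0 _ (ep _ zt)) (pmulr_rlt0 _ a0); exact: Lneg.
have := fz QTz; rewrite /f/= => -[] /eqP; rewrite mulf_eq0 => /orP[/eqP//|].
by rewrite (lt_eqF hn).
Qed.

End interior.

Theorem theorem5p5 (R : realType) (N : nat) (s T p : R)
    (Omega : set 'rV[R]_N) (u : 'rV[R]_N -> R -> R)
    (hs : 0 < s < 1) (hN : 2 * s < N%:R)
    (hOmega : bounded_C11_domain Omega) (h0 : Omega 0)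
    (hT : 0 < T) (hp : 1 < p)
    (hu : forall x (t : R), 0 <= t < T -> 0 <= u x t)
    (hsup : weak_supersolution s Omega T
       (fun x t => u x t `^ p / enorm x `^ (2 * s)) u) :
  (forall t : R, 0 <= t < T ->
     {ae @lebesgue_rV R N, forall x, Omega x -> u x t = 0}) /\
  {ae lebesgue_xt R N, forall z : 'rV[R]_N * R, 0 < z.2 < T -> u z.1 z.2 = 0}.
Proof.
have [oO _ bO _] := hOmega.
have N0 : (0 < N)%N.
  by rewrite -(ltr_nat R) (lt_trans _ hN)// mulr_gt0//; case/andP: hs.
have mO := open_measurable_rV oO.
have [D D0 OD] : exists2 D : R, 0 < D & forall x, Omega x -> enorm x <= D.
  have [M [_ /(_ (`|M| + 1)) MB]] := bO.
  have {}MB : forall x, Omega x -> `|x| <= `|M| + 1.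
    by move=> x Ox; apply: MB => //; rewrite (le_lt_trans (ler_norm M))// ltrDl.
  exists (N%:R * (`|M| + 1)).
    by rewrite mulr_gt0 ?ltr0n// ltr_wpDl.
  by move=> x /MB xM; apply: le_trans (enorm_le_norm x) _; rewrite ler_wpM2l.
have [r0 r00 Or] : exists2 r0 : R, 0 < r0 & forall x, enorm x < 4 * r0 -> Omega x.
  have /nbhs_ballP[e /= e0 He] : nbhs (0 : 'rV[R]_N) Omega by exact: open_nbhs_nbhs.
  exists (e / 4); first exact: divr_gt0.
  move=> x xe; apply: He; rewrite -ball_normE/= sub0r normrN.
  apply: le_lt_trans (norm_le_enorm x) _; apply: lt_le_trans xe _.
  by rewrite mulrC divfK.
split=> [t t0T|].
  exact: (slice_vanish hs N0 hT hp mO D0 OD r00 Or hu hsup t0T).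
exact: (vanish_everywhere hs N0 hT hp mO D0 OD r00 Or hu hsup).
Qed.
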